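(* Let $n\ge 1$ and let $H(x,y)=H_0(x,y)+H_1(x,y)+\cdots$ be a Hamiltonian, analytic in a neighbourhood of the origin of $\mathbb{C}^{2n}$, where $(x,y)=(x_1,\dots,x_n,y_1,\dots,y_n)$ are canonical coordinates, $H_0(x,y)=\sum_{j=1}^n\lambda_j x_jy_j$ with $(\lambda_1,\dots,\lambda_n)\in\mathbb{C}^n$, and $H_s$ is a homogeneous polynomial of degree $s+2$ for each $s\ge 1$. Assume that: (i) $\lambda_1\neq 0$ and $\lambda_\nu-k\lambda_1\neq 0$ for all $k\in\mathbb{Z}$ and all $\nu=2,\dots,n$; (ii) $\lambda_\nu\pm\lambda_{\nu'}-k\lambda_1\neq 0$ for all $k\in\mathbb{Z}$, all $\nu,\nu'=2,\dots,n$ (the case $\nu'=\nu$ being included) and both choices of sign, except for the trivial case in which $\nu=\nu'$, the sign is minus, and $k=0$. Then there exists a canonical, near the identity transformation, in the form of a power series convergent in a neighbourhood of the origin, which gives the Hamiltonian the normal form $$H(x,y)=H_0(x,y)+\Gamma(x_1y_1,\dots,x_ny_n)+F(x,y),$$ where $(x,y)$ now denote the new canonical coordinates, $H_0$ is the same quadratic polynomial, $\Gamma$ contains only monomials of the form $x_1^jy_1^jx_\nu y_\nu$ with a positive integer $j$ and with $\nu=1,\dots,n$, and $F(x,y)$ is at least cubic in $x_2,\dots,x_n,y_2,\dots,y_n$.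
   Context: A transformation is canonical if it preserves the symplectic form $\sum_j dx_j\wedge dy_j$ (equivalently, the Poisson bracket $\{f,g\}=\sum_{j}\left(\frac{\partial f}{\partial x_j}\frac{\partial g}{\partial y_j}-\frac{\partial f}{\partial y_j}\frac{\partial g}{\partial x_j}\right)$). ''Near the identity'' means that the old coordinates equal the new coordinates plus power series in the new coordinates starting with terms of degree at least $2$. ''$F$ is at least cubic in $x_2,\dots,x_n,y_2,\dots,y_n$'' means that every monomial in the power series expansion of $F$ at the origin has total degree at least $3$ in the variables $x_2,\dots,x_n,y_2,\dots,y_n$. *)

(* Defs.v *)
From mathcomp Require Import all_boot all_order all_algebra.
From mathcomp Require Import -(notations) mpoly.
From mathcomp Require Import all_classical all_reals all_analysis.
From mathcomp Require Import complex.
From mathcomp.analysis.showcase Require summability.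
Import Order.TTheory GRing.Theory Num.Theory numFieldNormedType.Exports.

Set Implicit Arguments.
Unset Strict Implicit.
Unset Printing Implicit Defensive.

Local Open Scope classical_set_scope.
Local Open Scope ring_scope.
Local Open Scope complex_scope.

(* Packaged as a numClosedFieldType, so that the topology and the norm that
   MathComp-Analysis gives to every numFieldType are found. *)
Definition CC (R : realType) : numClosedFieldType := R[i].

(* Unordered (equivalently, absolute) summation along the finite subsets of
   the index type. *)
Definition has_sum (R : realType) (I : choiceType) (u : I -> CC R) (s : CC R) :
    Prop :=
  summability.partial_sum u @ summability.totally --> s.

Definition monomial (R : realType) (m : nat) (z : 'rV[CC R]_m)
    (a : multinom m) : CC R :=
  \prod_(k < m) z 0 k ^+ a k.

(* f is analytic in a neighbourhood of 0 in C^m, where it is the sum of the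
   power series with coefficients c. *)
Definition has_pseries (R : realType) (m : nat) (f : 'rV[CC R]_m -> CC R)
    (c : multinom m -> CC R) : Prop :=
  \forall z \near (0 : 'rV[CC R]_m),
    has_sum (fun a => c a * monomial z a) (f z).

(* C^{2n} is 'rV_(n + n), with the coordinates in the order x_1, ..., x_n,
   y_1, ..., y_n. Indices start at 0: x_1 y_1 is the pair of index ord0. *)
Definition xi (n : nat) (j : 'I_n) : 'I_(n + n) := lshift n j.
Definition yi (n : nat) (j : 'I_n) : 'I_(n + n) := rshift n j.

Definition H0 (R : realType) (n : nat) (lam : 'I_n -> CC R) :
    mpoly (n + n) (CC R) :=
  \sum_(j < n) lam j *: (mpolyX (CC R) (mnm1 (xi j)) *
                         mpolyX (CC R) (mnm1 (yi j))).

(* The formal power series Hs 0 + Hs 1 + ..., when each Hs s is homogeneous of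
   degree s + 2: only Hs (mdeg a - 2) can contribute to the monomial a. If
   mdeg a < 2 the truncated subtraction selects Hs 0, whose coefficient at a
   vanishes. *)
Definition hseries (R : realType) (m : nat) (Hs : nat -> mpoly m (CC R))
    (a : multinom m) : CC R :=
  mcoeff a (Hs (mdeg a - 2)%N).

(* The symplectic form sum_j dx_j /\ dy_j. *)
Definition omega (R : realType) (n : nat) (u v : 'rV[CC R]_(n + n)) : CC R :=
  \sum_(j < n) (u 0 (xi j) * v 0 (yi j) - u 0 (yi j) * v 0 (xi j)).

Definition canonical_at0 (R : realType) (n : nat)
    (phi : 'rV[CC R]_(n + n) -> 'rV[CC R]_(n + n)) : Prop :=
  \forall z \near (0 : 'rV[CC R]_(n + n)),
    differentiable phi z /\
    forall u v, omega ('d phi z u) ('d phi z v) = omega u v.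

Definition near_identity (R : realType) (m : nat)
    (phi : 'rV[CC R]_m -> 'rV[CC R]_m) : Prop :=
  forall i : 'I_m, exists p : multinom m -> CC R,
    has_pseries (fun z => phi z 0 i - z 0 i) p /\
    forall a, p a != 0 -> (2 <= mdeg a)%N.

Definition actions (R : realType) (n : nat) (z : 'rV[CC R]_(n + n)) :
    'rV[CC R]_n :=
  \row_j (z 0 (xi j) * z 0 (yi j)).

(* As a series in the n variables I_k = x_k y_k, G contains only the monomials
   I_1^j I_nu with j > 0; nu = 1 is allowed. *)
Definition Gamma_form (R : realType) (n : nat) (G : 'rV[CC R]_n.+1 -> CC R) :
    Prop :=
  exists g : multinom n.+1 -> CC R,
    has_pseries G g /\
    forall a, g a != 0 -> exists (j : nat) (nu : 'I_n.+1), (0 < j)%N /\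
      a = mnm_add (mnm_muln (mnm1 ord0) j) (mnm1 nu).

Definition cubic_transverse (R : realType) (n : nat)
    (F : 'rV[CC R]_(n.+1 + n.+1) -> CC R) : Prop :=
  exists f : multinom (n.+1 + n.+1) -> CC R,
    has_pseries F f /\
    forall a, f a != 0 ->
      (3 <= \sum_(j < n.+1 | j != ord0) (a (xi j) + a (yi j)))%N.

(* Main.v *)
(* Power series are handled formally, with the l^1 norms |f|_r = sum |f_a| r^|a| controlling
   convergence: every functional equation is solved by an iteration that gains one order of
   vanishing at each step and stays in a ball for such a norm. The map is built in two steps.

   First, the nonresonance of lam_nu with the multiples of lam_1 gives a two-dimensional invariant
   manifold u(xi, eta) on which the flow is a reparametrized linear one, w L u = X_H(u) with
   L = xi d/dxi - eta d/deta. A canonical map sends it to the plane x_nu = y_nu = 0 (nu > 1). On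
   the plane H then depends on x_1 y_1 only, and H has no term linear in the transverse variables.

   Then a generating function quadratic in the transverse variables removes all the quadratic
   terms that are not products of the actions. The divisors are the combinations of the lam_j that
   occur in (ii), and the derivative terms of the homological equation are controlled because
   k / (k lam_1 - mu) stays bounded as k varies: no Diophantine condition is needed. *)

From HB Require Import structures.
Require Import Defs.
From mathcomp Require Import all_boot all_order all_algebra.
From mathcomp Require Import -(notations) mpoly.
From mathcomp Require Import finmap.
From mathcomp Require Import all_classical all_reals all_analysis.
From mathcomp Require Import complex ring lra zify.
Import Order.TTheory GRing.Theory Num.Theory numFieldNormedType.Exports.
Import Normc.

Set Implicit Arguments.
Unset Strict Implicit.
Unset Printing Implicit Defensive.

Local Open Scope classical_set_scope.
Local Open Scope ring_scope.

Local Notation "a +m b" := (mnm_add a b) (at level 50, left associativity).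
Local Notation mX := (mpolyX _).
Local Notation U := (@mnm1 _).
Local Notation m0 := (@mnm0 _).

(** * Formal power series *)

Record fps (K : numFieldType) (m : nat) := Fps { fcoef :> multinom m -> K }.

HB.lock Definition trunc (K : numFieldType) (m N : nat) (f : fps K m) : mpoly m K :=
  \sum_(b : bmultinom m N) f b *: mX b.
HB.lock Definition fps_zero (K : numFieldType) (m : nat) : fps K m := Fps (fun _ => 0).
HB.lock Definition fps_opp (K : numFieldType) (m : nat) (f : fps K m) : fps K m :=
  Fps (fun a => - f a).
HB.lock Definition fps_add (K : numFieldType) (m : nat) (f g : fps K m) : fps K m :=
  Fps (fun a => f a + g a).
HB.lock Definition fps_one (K : numFieldType) (m : nat) : fps K m :=
  Fps (fun a => (a == @mnm0 m)%:R).
HB.lock Definition fps_mul (K : numFieldType) (m : nat) (f g : fps K m) : fps K m :=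
  Fps (fun a => mcoeff a (trunc (mdeg a).+1 f * trunc (mdeg a).+1 g)).
HB.lock Definition pol (K : numFieldType) (m : nat) (p : mpoly m K) : fps K m :=
  Fps (fun a => mcoeff a p).

Arguments trunc {K m} N f.
Arguments fps_zero {K m}.
Arguments fps_opp {K m} f.
Arguments fps_add {K m} f g.
Arguments fps_one {K m}.
Arguments fps_mul {K m} f g.
Arguments pol {K m} p.

Section Ring.
Variables (K : numFieldType) (m : nat).
Local Notation E := (fps K m).
Implicit Types (f g h : E) (a b : multinom m) (p q : mpoly m K).

Lemma fpsP f g : (forall a, f a = g a) <-> f = g.
Proof.
by split=> [|-> //]; case: f; case: g => f g /= fg; congr Fps; apply/funext.
Qed.

HB.instance Definition _ := gen_eqMixin (fps K m).
HB.instance Definition _ := gen_choiceMixin (fps K m).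

Definition agree N p q := forall a, (mdeg a < N)%N -> mcoeff a p = mcoeff a q.

Lemma mcoeff_trunc N f a : (mdeg a < N)%N -> mcoeff a (trunc N f) = f a.
Proof. by rewrite trunc.unlock; apply: mcoeff_mpoly. Qed.

Lemma agree_mul N p p' q q' :
  agree N p p' -> agree N q q' -> agree N (p * q) (p' * q').
Proof.
move=> pp qq a aN; rewrite !mcoeffM; apply: eq_bigr => -[[k1 /= k1P] [k2 /= k2P]] _.
by rewrite pp ?qq // (leq_trans _ aN) // -ltnS.
Qed.

Fact fps_addA : associative (@fps_add K m).
Proof. by move=> f g h; apply/fpsP => a; rewrite !unlock /= addrA. Qed.
Fact fps_addC : commutative (@fps_add K m).
Proof. by move=> f g; apply/fpsP => a; rewrite !unlock /= addrC. Qed.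
Fact fps_add0 : left_id (@fps_zero K m) (@fps_add K m).
Proof. by move=> f; apply/fpsP => a; rewrite !unlock /= add0r. Qed.
Fact fps_addN : left_inverse (@fps_zero K m) (@fps_opp K m) (@fps_add K m).
Proof. by move=> f; apply/fpsP => a; rewrite !unlock /= addNr. Qed.

HB.instance Definition _ :=
  GRing.isZmodule.Build (fps K m) fps_addA fps_addC fps_add0 fps_addN.

Lemma fps0E a : (0 : E) a = 0. Proof. by rewrite /GRing.zero /= unlock. Qed.
Lemma fpsDE f g a : (f + g) a = f a + g a.
Proof. by rewrite /GRing.add /= unlock. Qed.
Lemma fpsNE f a : (- f) a = - f a.
Proof. by rewrite /GRing.opp /= unlock. Qed.
Lemma fpsBE f g a : (f - g) a = f a - g a. Proof. by rewrite fpsDE fpsNE. Qed.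
Lemma fps_sumE I (r : seq I) P (F : I -> E) a :
  (\sum_(i <- r | P i) F i) a = \sum_(i <- r | P i) F i a.
Proof.
by apply: (big_morph (fun h : E => h a)) => [f g|]; rewrite ?fpsDE ?fps0E.
Qed.

Lemma agree_trunc N N' f : (N <= N')%N -> agree N (trunc N f) (trunc N' f).
Proof. by move=> NN a aN; rewrite !mcoeff_trunc // (leq_trans aN). Qed.

Lemma fps_mulE N f g a : (mdeg a < N)%N ->
  fps_mul f g a = mcoeff a (trunc N f * trunc N g).
Proof.
move=> aN; rewrite fps_mul.unlock /=.
by apply: (agree_mul (N := (mdeg a).+1)) => //; apply: agree_trunc.
Qed.

Lemma agree_truncM N f g : agree N (trunc N (fps_mul f g)) (trunc N f * trunc N g).
Proof. by move=> a aN; rewrite mcoeff_trunc // (fps_mulE _ _ aN). Qed.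

Lemma truncD N f g : trunc N (f + g) = trunc N f + trunc N g.
Proof.
rewrite trunc.unlock -big_split; apply: eq_bigr => b _.
by rewrite fpsDE scalerDl.
Qed.

Fact fps_mulA : associative (@fps_mul K m).
Proof.
move=> f g h; apply/fpsP => a; rewrite !(fps_mulE _ _ (ltnSn (mdeg a))).
have aN := ltnSn (mdeg a).
rewrite (agree_mul (fun _ _ => erefl) (@agree_truncM _ g h) aN).
by rewrite (agree_mul (@agree_truncM _ f g) (fun _ _ => erefl) aN) mulrA.
Qed.
Fact fps_mulC : commutative (@fps_mul K m).
Proof. by move=> f g; apply/fpsP => a; rewrite fps_mul.unlock /= mulrC. Qed.
Fact fps_mul1 : left_id (@fps_one K m) (@fps_mul K m).
Proof.
move=> f; apply/fpsP => a; have aN := ltnSn (mdeg a); rewrite (fps_mulE _ _ aN).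
have one : agree (mdeg a).+1 (trunc (mdeg a).+1 fps_one) 1.
  by move=> b bN; rewrite mcoeff_trunc // mcoeff1 fps_one.unlock.
by rewrite (agree_mul one (fun _ _ => erefl) aN) mul1r mcoeff_trunc.
Qed.
Fact fps_mulD : left_distributive (@fps_mul K m) (@fps_add K m).
Proof.
move=> f g h; apply/fpsP => a; rewrite fps_add.unlock fps_mul.unlock /=.
by rewrite -mcoeffD -mulrDl -truncD /GRing.add /= fps_add.unlock.
Qed.
Fact fps_one_neq0 : @fps_one K m != fps_zero.
Proof.
apply/eqP => /(congr1 (fun h : E => h (@mnm0 m))).
by rewrite !unlock /= eqxx => /eqP; rewrite oner_eq0.
Qed.

HB.instance Definition _ := GRing.Zmodule_isComNzRing.Build (fps K m)
  fps_mulA fps_mulC fps_mul1 fps_mulD fps_one_neq0.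

Lemma fps1E a : (1 : E) a = (a == @mnm0 m)%:R.
Proof. by rewrite /GRing.one /= unlock. Qed.

Lemma fpsME N f g a : (mdeg a < N)%N -> (f * g) a =
  \sum_(k : bmultinom m N * bmultinom m N | a == k.1 +m k.2) f k.1 * g k.2.
Proof.
move=> aN; rewrite [f * g]/GRing.mul /= (fps_mulE _ _ aN).
rewrite (mcoeff_poly_mul _ _ aN); apply: eq_bigr => -[[k1 /= k1P] [k2 /= k2P]] _.
by rewrite !mcoeff_trunc.
Qed.

Lemma polE p a : pol p a = mcoeff a p.
Proof. by rewrite pol.unlock. Qed.

Lemma pol_is_additive : additive (@pol K m).
Proof. by move=> p q; apply/fpsP => a; rewrite fpsBE !polE mcoeffB. Qed.
HB.instance Definition _ := GRing.isAdditive.Build (mpoly m K) (fps K m) (@pol K m) pol_is_additive.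
Lemma pol_is_multiplicative : multiplicative (@pol K m).
Proof.
split=> [p q|]; apply/fpsP => a; last by rewrite polE mcoeff1 fps1E.
rewrite polE [RHS](fps_mulE _ _ (ltnSn (mdeg a))).
by apply: (agree_mul (N := (mdeg a).+1)) => // b bN; rewrite mcoeff_trunc // polE.
Qed.
HB.instance Definition _ := GRing.isMultiplicative.Build (mpoly m K) (fps K m) (@pol K m)
  pol_is_multiplicative.

Definition cst (c : K) : E := pol (@mpolyC m K c).
HB.instance Definition _ := GRing.RMorphism.copy cst (@pol K m \o @mpolyC m K).
Definition X i : E := pol (mX (U i)).

Lemma cstE c a : cst c a = c * (a == @mnm0 m)%:R.
Proof. by rewrite polE mcoeffC. Qed.
Lemma XE i a : X i a = (U i == a)%:R.
Proof. by rewrite polE mcoeffX. Qed.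
Lemma polXE b a : pol (mpolyX K b) a = (b == a)%:R.
Proof. by rewrite polE mcoeffX. Qed.
Lemma cstM c f a : (cst c * f) a = c * f a.
Proof.
have aN := ltnSn (mdeg a).
have one : agree (mdeg a).+1 (trunc (mdeg a).+1 (cst c)) (@mpolyC m K c).
  by move=> b bN; rewrite mcoeff_trunc // polE.
by rewrite [_ * _]/GRing.mul /= (fps_mulE _ _ aN) (agree_mul one (fun _ _ => erefl) aN) mcoeffCM mcoeff_trunc.
Qed.

End Ring.

(** * Weighted orders and derivatives *)

HB.lock Definition Wt (K : numFieldType) m (w : 'I_m -> nat) k (f : fps K m) : Prop :=
  forall a : multinom m, (\sum_(i < m) w i * a i < k)%N -> f a = 0.
HB.lock Definition D (K : numFieldType) m (i : 'I_m) (f : fps K m) : fps K m :=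
  Fps (fun a => f (a +m U i) *+ (a i).+1).
Arguments Wt {K m} w k f.
Notation ord := (Wt (fun _ => 1%N)).
Arguments D {K m} i f.

Section Weight.
Variables (K : numFieldType) (m : nat).
Local Notation E := (fps K m).
Implicit Types (f g h : E) (a b : multinom m) (p q : mpoly m K) (w : 'I_m -> nat).

Definition wdeg w a := (\sum_(i < m) w i * a i)%N.
Definition nc f : E := f - cst m (f m0).

Lemma wdeg1 a : wdeg (fun _ => 1%N) a = mdeg a.
Proof. by rewrite mdegE; apply: eq_bigr => i _; rewrite mul1n. Qed.
Lemma wdegD w a b : wdeg w (a +m b) = (wdeg w a + wdeg w b)%N.
Proof. by rewrite -big_split; apply: eq_bigr => i _; rewrite mnmDE mulnDr. Qed.
Lemma wdegU w i : wdeg w (U i) = w i.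
Proof.
rewrite /wdeg (bigD1 i) //= big1 ?addn0 ?mnm1E ?eqxx ?muln1 // => j ji.
by rewrite mnm1E eq_sym (negPf ji) muln0.
Qed.
Lemma wdeg0 w : wdeg w m0 = 0%N.
Proof. by rewrite /wdeg big1 // => i _; rewrite mnm0E muln0. Qed.

Lemma WtP w k f : Wt w k f <-> (forall a, (wdeg w a < k)%N -> f a = 0).
Proof. by rewrite Wt.unlock. Qed.

Lemma ordP k f : ord k f <-> (forall a, (mdeg a < k)%N -> f a = 0).
Proof. by rewrite WtP; split=> H a; have := H a; rewrite wdeg1. Qed.

Lemma Wt_0 w k : Wt w k (0 : E). Proof. by apply/WtP => a _; rewrite fps0E. Qed.
Lemma Wt_0k w f : Wt w 0 f. Proof. by apply/WtP. Qed.
Lemma Wt_le w k l f : (k <= l)%N -> Wt w l f -> Wt w k f.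
Proof. by move=> kl /WtP H; apply/WtP => a ak; apply: H; apply: leq_trans kl. Qed.
Lemma Wt_D w k f g : Wt w k f -> Wt w k g -> Wt w k (f + g).
Proof. by move=> /WtP F /WtP G; apply/WtP => a ak; rewrite fpsDE F ?G ?addr0. Qed.
Lemma Wt_N w k f : Wt w k f -> Wt w k (- f).
Proof. by move=> /WtP F; apply/WtP => a ak; rewrite fpsNE F ?oppr0. Qed.
Lemma Wt_B w k f g : Wt w k f -> Wt w k g -> Wt w k (f - g).
Proof. by move=> F G; apply: Wt_D => //; apply: Wt_N. Qed.
Lemma Wt_sum w k I (r : seq I) (P : pred I) (F : I -> E) :
  (forall i, P i -> Wt w k (F i)) -> Wt w k (\sum_(i <- r | P i) F i).
Proof. by move=> H; apply: big_ind => [|f g|//]; [apply: Wt_0 | apply: Wt_D]. Qed.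
Lemma Wt_M w k l f g : Wt w k f -> Wt w l g -> Wt w (k + l) (f * g).
Proof.
move=> /WtP F /WtP G; apply/WtP => a akl; rewrite (fpsME _ _ (ltnSn (mdeg a))); apply: big1 => -[k1 k2] /= /eqP ak.
have [k1k|k1k] := ltnP (wdeg w k1) k; first by rewrite F ?mul0r.
have [k2l|k2l] := ltnP (wdeg w k2) l; first by rewrite G ?mulr0.
by move: akl; rewrite (congr1 (wdeg w) ak) wdegD ltnNge leq_add.
Qed.
Lemma Wt_Ml w k f g : Wt w k f -> Wt w k (f * g).
Proof. by move=> F; rewrite -[k]addn0; apply: Wt_M => //; apply: Wt_0k. Qed.
Lemma Wt_Mr w k f g : Wt w k g -> Wt w k (f * g).
Proof. by rewrite mulrC; apply: Wt_Ml. Qed.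
Lemma Wt_X w i : Wt w (w i) (X K i).
Proof. by apply/WtP => a; rewrite XE; case: eqP => [<-|//]; rewrite wdegU ltnn. Qed.
Lemma Wt_exp w k f n : Wt w k f -> Wt w (k * n) (f ^+ n).
Proof.
move=> F; elim: n => [|n IH]; first by rewrite muln0; apply: Wt_0k.
by rewrite exprS mulnS; apply: Wt_M.
Qed.
Lemma Wt_nc w k f : Wt w k f -> Wt w k (nc f).
Proof.
move=> /WtP F; apply/WtP => a ak; rewrite fpsBE cstE F // sub0r.
by case: eqP => [a0|_]; rewrite ?mulr0 ?oppr0 // -a0 F // mul0r oppr0.
Qed.
Lemma ord_nc f : ord 1 (nc f).
Proof.
apply/ordP => a; rewrite ltnS leqn0 mdeg_eq0 => /eqP ->.
by rewrite fpsBE cstE eqxx mulr1 subrr.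
Qed.
Lemma ncB f g : nc (f - g) = nc f - nc g.
Proof. by rewrite /nc fpsBE rmorphB /=; ring. Qed.
Lemma nc_id f : f m0 = 0 -> nc f = f.
Proof. by move=> f0; rewrite /nc f0 rmorph0 subr0. Qed.
Lemma ord_coef0 k f : ord k.+1 f -> f m0 = 0.
Proof. by move/ordP; apply; rewrite mdeg0. Qed.
Lemma ord_all f : (forall N, ord N f) -> f = 0.
Proof. by move=> H; apply/fpsP => a; rewrite fps0E; have /ordP := H (mdeg a).+1; apply. Qed.
Lemma ord_eq f g : (forall N, ord N (f - g)) -> f = g.
Proof. by move/ord_all/eqP; rewrite subr_eq0 => /eqP. Qed.
Lemma ord_trunc N f : ord N (f - pol (trunc N f)).
Proof. by apply/ordP => a aN; rewrite fpsBE polE mcoeff_trunc // subrr. Qed.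

Lemma pol_ind (P : E -> Prop) :
  (forall c, P (cst m c)) -> (forall i, P (X K i)) ->
  (forall f g, P f -> P g -> P (f + g)) -> (forall f g, P f -> P g -> P (f * g)) ->
  forall p, P (pol p).
Proof.
move=> Pc PX PD PM p.
have P1 : P 1 by rewrite -(rmorph1 (cst m)); apply: (Pc).
rewrite [p]mpolyE rmorph_sum /=; apply: (big_ind P) => //.
  by rewrite -(rmorph0 (cst m)); apply: (Pc).
move=> b _; rewrite -mul_mpolyC rmorphM /=; apply: (PM); first exact: (Pc _).
rewrite mpolyXE_id rmorph_prod /=; apply: (big_ind P) => // i _.
rewrite rmorphXn /=; elim: (b i) => [//|n IH]; rewrite exprS; apply: (PM) => //.
exact: (PX).
Qed.

Lemma wt_pol_ind w (P : nat -> E -> Prop) :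
  (forall c, P 0%N (cst m c)) -> (forall i, P (w i) (X K i)) ->
  (forall k f g, P k f -> P k g -> P k (f + g)) -> (forall k, P k 0) ->
  (forall k l f, (k <= l)%N -> P l f -> P k f) ->
  (forall k l f g, P k f -> P l g -> P (k + l)%N (f * g)) ->
  forall k N f, Wt w k f -> P k (pol (trunc N f)).
Proof.
move=> Pc PX PD P0 Ple PM k N f /WtP F.
rewrite trunc.unlock rmorph_sum /=; apply: (big_ind (P k)) => // [|b _]; first exact: (PD).
have [bk|kb] := ltnP (wdeg w b) k; first by rewrite F // scale0r rmorph0.
apply: (Ple _ _ _ kb); rewrite -mul_mpolyC rmorphM /= -[wdeg _ _]add0n.
apply: (PM); first exact: (Pc _).
have P1 : P 0%N 1 by rewrite -(rmorph1 (cst m)); apply: (Pc).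
rewrite mpolyXE_id rmorph_prod /= /wdeg.
apply: (big_ind2 P) => // [? ? ? ? ? ?|i _]; first exact: (PM).
rewrite rmorphXn /=; elim: (b i : nat) => [|n IH]; first by rewrite muln0.
by rewrite exprS mulnS; apply: (PM) => //; exact: (PX).
Qed.

Lemma DE i f a : D i f a = f (a +m U i) *+ (a i).+1.
Proof. by rewrite D.unlock. Qed.
Lemma D_is_additive i : additive (@D K m i).
Proof. by move=> f g; apply/fpsP => a; rewrite !(DE, fpsBE) mulrnBl. Qed.
HB.instance Definition _ i := GRing.isAdditive.Build (fps K m) (fps K m) (@D K m i) (D_is_additive i).
Lemma D0 i : D i (0 : E) = 0. Proof. exact: raddf0. Qed.
Lemma DD i : {morph @D K m i : f g / f + g}. Proof. exact: raddfD. Qed.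
Lemma DB i : {morph @D K m i : f g / f - g}. Proof. exact: raddfB. Qed.
Lemma DN i : {morph @D K m i : f / - f}. Proof. exact: raddfN. Qed.

Lemma D_pol i p : D i (pol p) = pol (mderiv i p).
Proof. by apply/fpsP => a; rewrite DE !polE mcoeff_mderiv. Qed.
Lemma Wt_D' w i k f : Wt w k f -> Wt w (k - w i) (D i f).
Proof.
move=> /WtP F; apply/WtP => a ak; rewrite DE F ?mul0rn // wdegD wdegU.
by move: ak; rewrite ltn_subRL addnC.
Qed.
Lemma ord_D i k f : ord k.+1 f -> ord k (D i f).
Proof. by move=> /(@Wt_D' _ i); rewrite subn1. Qed.

Lemma DM i f g : D i (f * g) = D i f * g + f * D i g.
Proof.
apply: ord_eq => N.
suff H p q r s : ord N.+1 r -> ord N.+1 s ->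
    ord N (D i ((r + pol p) * (s + pol q)) -
      (D i (r + pol p) * (s + pol q) + (r + pol p) * D i (s + pol q))).
  have := H (trunc N.+1 f) (trunc N.+1 g) _ _ (@ord_trunc N.+1 f) (@ord_trunc N.+1 g).
  by rewrite !subrK.
move=> Hr Hs.
have -> : (r + pol p) * (s + pol q) = pol (p * q) + (r * s + r * pol q + pol p * s).
  by rewrite (rmorphM (@pol K m)) /=; ring.
rewrite !DD !D_pol mderivM !rmorphD /= !rmorphM /=.
have Dr := ord_D i Hr; have Ds := ord_D i Hs.
have hr : ord N r by apply: Wt_le Hr.
have hs : ord N s by apply: Wt_le Hs.
set x := pol p; set y := pol q; set p' := pol _; set q' := pol _.
set A := D i (r * s); set B := D i (r * y); set C := D i (x * s).
have -> : p' * y + x * q' + (A + B + C) - ((D i r + p') * (s + y) + (r + x) * (D i s + q'))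
  = A + B + C - D i r * (s + y) - p' * s - r * (D i s + q') - x * D i s by ring.
repeat first [apply: Wt_B | apply: Wt_D].
- exact/ord_D/Wt_Ml.
- exact/ord_D/Wt_Ml.
- exact/ord_D/Wt_Mr.
- exact/Wt_Ml.
- exact/Wt_Mr.
- exact/Wt_Ml.
- exact/Wt_Mr.
Qed.

Lemma D_cst i (c : K) : D i (cst m c) = 0.
Proof. by rewrite D_pol mderivC rmorph0. Qed.
Lemma D_X (i j : 'I_m) : D i (X K j) = (i == j)%:R.
Proof.
have UU k : mnm_sub (U k) (U k) = m0 :> multinom m.
  by apply/mnmP => l; rewrite mnmBE subnn mnm0E.
rewrite D_pol mderivX mnm1E (eq_sym i); case: eqP => [->|_]; last by rewrite scale0r rmorph0.
by rewrite scale1r UU mpolyX0 rmorph1.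
Qed.
Lemma DC i j f : D i (D j f) = D j (D i f).
Proof.
apply/fpsP => a; rewrite !DE !mnmDE !mnm1E -!mulrnA.
have -> : a +m U i +m U j = a +m U j +m U i by rewrite -!addmA [U i +m _]addmC.
case: (altP (i =P j)) => [->|ij]; first by rewrite eqxx.
by rewrite (eq_sym j) (negPf ij) !addn0 mulnC.
Qed.

End Weight.
Arguments wdeg {m}.

Lemma mulrB_split (A : comPzRingType) (x x' y y' : A) :
  x * y - x' * y' = (x - x') * y + x' * (y - y').
Proof. by ring. Qed.

(** * Substitution *)

HB.lock Definition sub (K : numFieldType) p m (u : 'I_p -> fps K m) (q : mpoly p K) : fps K m :=
  mmap (cst m) (fun i => nc (u i)) q.

(* Substitution of u - u(0), which is defined without any condition on u. *)
HB.lock Definition comp (K : numFieldType) p m (u : 'I_p -> fps K m) (f : fps K p) : fps K m :=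
  Fps (fun a => sub u (trunc (mdeg a).+1 f) a).
Arguments sub {K p m} u q.
Arguments comp {K p m} u f.

Section Comp.
Variables (K : numFieldType) (p m : nat).
Implicit Types (u v : 'I_p -> fps K m) (f g : fps K p) (w : 'I_p -> nat) (z : 'I_m -> nat).

Lemma subE u q : sub u q = mmap (cst m) (fun i => nc (u i)) q.
Proof. by rewrite sub.unlock. Qed.
Fact sub_is_additive u : additive (@sub K p m u).
Proof. by move=> q r; rewrite !subE raddfB. Qed.
Fact sub_is_multiplicative u : multiplicative (@sub K p m u).
Proof. by split=> [q r|]; rewrite !subE ?rmorphM ?rmorph1. Qed.
HB.instance Definition _ u := GRing.isAdditive.Build (mpoly p K) (fps K m) (@sub K p m u)
  (sub_is_additive u).
HB.instance Definition _ u := GRing.isMultiplicative.Build (mpoly p K) (fps K m)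
  (@sub K p m u) (sub_is_multiplicative u).

Lemma subM u : {morph sub u : x y / x * y}.
Proof. exact: rmorphM. Qed.
Lemma sub_mX u b : sub u (mX b) = \prod_(i < p) nc (u i) ^+ b i.
Proof. by rewrite subE mmapX. Qed.

Lemma sub_sum_Wt u w z k N (c : multinom p -> K) :
  (forall i, Wt z (w i) (u i)) ->
  (forall b, (wdeg w b < k)%N -> c b = 0) ->
  Wt z k (sub u (\sum_(b : bmultinom p N) c b *: mX b)).
Proof.
move=> Hu Hc; rewrite raddf_sum; apply: Wt_sum => b _ /=.
have [bk|kb] := ltnP (wdeg w b) k; first by rewrite Hc // scale0r raddf0; apply: Wt_0.
rewrite -mul_mpolyC rmorphM /=; apply: Wt_Mr; rewrite sub_mX; apply: Wt_le kb _.
rewrite /wdeg.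
apply: (@big_ind2 nat (fps K m) (Wt z)).
- exact: Wt_0k.
- by move=> n f n' f' F G; apply: Wt_M.
- by move=> i _; apply/Wt_exp/Wt_nc.
Qed.

Lemma sub_agree u N q q' : agree N q q' -> ord N (sub u q - sub u q').
Proof.
move=> qq; have [M qM] : exists M, (msize (q - q') <= M)%N by exists (msize (q - q')).
rewrite -raddfB (mpolywE qM) raddf_sum; apply: Wt_sum => b _ /=.
rewrite -mul_mpolyC rmorphM /=.
have [bN|Nb] := ltnP (mdeg b) N.
  by rewrite mcoeffB qq // subrr mpolyC0 raddf0 mul0r; apply: Wt_0.
apply: Wt_Mr; rewrite sub_mX; apply: Wt_le Nb _; rewrite -wdeg1 /wdeg.
apply: (@big_ind2 nat (fps K m) (Wt (fun _ => 1%N))).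
- exact: Wt_0k.
- by move=> n f n' f' F G; apply: Wt_M.
- by move=> i _; apply/Wt_exp/ord_nc.
Qed.

Lemma comp_def u f a : comp u f a = sub u (trunc (mdeg a).+1 f) a.
Proof. by rewrite comp.unlock. Qed.

Lemma compE u N f a : (mdeg a < N)%N -> comp u f a = sub u (trunc N f) a.
Proof.
move=> aN; rewrite comp_def; have /(sub_agree u)/ordP/(_ a) := agree_trunc f aN.
by move/(_ (ltnSn _))/eqP; rewrite fpsBE subr_eq0 => /eqP.
Qed.

Lemma comp_sub u N f : ord N (comp u f - sub u (trunc N f)).
Proof. by apply/ordP => a aN; rewrite fpsBE (compE _ _ aN) subrr. Qed.

Lemma comp_pol u q : comp u (pol q) = sub u q.
Proof.
apply: ord_eq => N; rewrite -(subrK (sub u (trunc N (pol q))) (comp _ _)) -addrA.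
apply: Wt_D; first exact: comp_sub.
by apply: sub_agree => a aN; rewrite mcoeff_trunc // polE.
Qed.

Lemma comp_is_additive u : additive (@comp K p m u).
Proof.
move=> f g; apply/fpsP => a; rewrite fpsBE !comp_def -fpsBE -raddfB /=; congr (sub u _ a).
by rewrite trunc.unlock -sumrB; apply: eq_bigr => b _; rewrite -scalerBl fpsBE.
Qed.
HB.instance Definition _ u := GRing.isAdditive.Build (fps K p) (fps K m) (@comp K p m u)
  (comp_is_additive u).

Lemma compD u : {morph comp u : f g / f + g}. Proof. exact: raddfD. Qed.
Lemma compB u : {morph comp u : f g / f - g}. Proof. exact: raddfB. Qed.
Lemma comp0 u : comp u 0 = 0. Proof. exact: raddf0. Qed.

Lemma comp_ord u N f : ord N f -> ord N (comp u f).
Proof.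
move=> F; rewrite -(subrK (sub u (trunc N f)) (comp _ _)); apply: Wt_D; first exact: comp_sub.
rewrite -[sub _ _]subr0 -(raddf0 (sub u)); apply: sub_agree => a aN.
by rewrite mcoeff_trunc // mcoeff0; move/ordP: F; apply.
Qed.

Lemma comp_is_multiplicative u : multiplicative (@comp K p m u).
Proof.
split=> [f g|]; last first.
  by rewrite -(rmorph1 (@pol K p)) comp_pol rmorph1.
apply: ord_eq => N.
have Hf := @ord_trunc _ _ N f; have Hg := @ord_trunc _ _ N g.
set x := pol (trunc N f) in Hf; set y := pol (trunc N g) in Hg.
have -> : f * g = (f - x) * g + x * (g - y) + x * y by ring.
have -> : comp u f * comp u g = comp u (f - x) * comp u g + comp u x * comp u (g - y)
  + comp u x * comp u y by rewrite !compB; ring.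
rewrite !compD -(rmorphM (@pol K p)) !comp_pol subM.
have E (a b c d e : fps K m) : a + b + c - (d + e + c) = a + b - (d + e) by ring.
rewrite E -(compD _ f) -(compD _ g); apply: Wt_B; apply: Wt_D.
- exact/comp_ord/Wt_Ml.
- exact/comp_ord/Wt_Mr.
- exact/Wt_Ml/comp_ord.
- exact/Wt_Mr/comp_ord.
Qed.
HB.instance Definition _ u := GRing.isMultiplicative.Build (fps K p) (fps K m) (@comp K p m u)
  (comp_is_multiplicative u).

Lemma compM u : {morph comp u : f g / f * g}. Proof. exact: rmorphM. Qed.
Lemma comp1 u : comp u 1 = 1. Proof. exact: rmorph1. Qed.
Lemma comp_cst u c : comp u (cst p c) = cst m c.
Proof. by rewrite comp_pol subE mmapC. Qed.
Lemma comp_X u i : comp u (X K i) = nc (u i).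
Proof. by rewrite comp_pol subE mmapX mmap1U. Qed.
Lemma comp_X0 u i : u i m0 = 0 -> comp u (X K i) = u i.
Proof. by rewrite comp_X; apply: nc_id. Qed.

Lemma comp_coef0 u f : comp u f m0 = f m0.
Proof.
have : ord 1 (f - cst p (f m0)) by apply: ord_nc.
move/(comp_ord u)/ord_coef0/eqP; rewrite compB comp_cst fpsBE cstE eqxx mulr1.
by rewrite subr_eq0 => /eqP.
Qed.

Lemma comp_Wt u w z k f : (forall i, Wt z (w i) (u i)) ->
  Wt w k f -> Wt z k (comp u f).
Proof.
move=> Hu /WtP Hf; apply/WtP => a; rewrite comp_def trunc.unlock.
by have /WtP := @sub_sum_Wt u w z k (mdeg a).+1 f Hu Hf; apply.
Qed.

Lemma comp_Wt_diff u v w z k s f : (forall i, Wt z (w i) (u i)) ->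
  (forall i, Wt z (w i) (v i)) -> (forall i, Wt z (w i + s) (u i - v i)) ->
  Wt w k f -> Wt z (k + s) (comp u f - comp v f).
Proof.
move=> Hu Hv Huv Hf; apply/WtP => a ak.
pose P k f := [/\ Wt z k (comp u f), Wt z k (comp v f) & Wt z (k + s) (comp u f - comp v f)].
suff [_ _ H] : P k (pol (trunc (mdeg a).+1 f)).
  have /WtP/(_ a ak) := H; rewrite !comp_pol !fpsBE => <-.
  by rewrite !(compE _ _ (ltnSn (mdeg a))).
apply: (wt_pol_ind (w := w)) Hf; rewrite /P.
- by move=> c; rewrite !comp_cst subrr; split; (exact: Wt_0k || exact: Wt_0).
- by move=> i; rewrite !comp_X -ncB; split; apply: Wt_nc.
- move=> k' g h [A1 A2 A3] [B1 B2 B3]; rewrite !compD; split; [exact: Wt_D | exact: Wt_D |].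
  by rewrite opprD addrACA; apply: Wt_D.
- by move=> k'; rewrite !comp0 subrr; split; apply: Wt_0.
- move=> k' l g kl [A1 A2 A3]; split.
  + exact: Wt_le A1.
  + exact: Wt_le A2.
  + by apply: Wt_le A3; rewrite leq_add2r.
- move=> k' l g h [A1 A2 A3] [B1 B2 B3]; rewrite !compM; split; [exact: Wt_M | exact: Wt_M |].
  set x := comp u g; set x' := comp v g; set y := comp u h; set y' := comp v h.
  move: A1 A2 A3 B1 B2 B3; rewrite -/x -/x' -/y -/y' => A1 A2 A3 B1 B2 B3; clearbody x x' y y'.
  have -> : x * y - x' * y' = (x - x') * y + x' * (y - y') by ring.
  apply: Wt_D; first by rewrite addnAC; apply: Wt_M.
  by rewrite -addnA; apply: Wt_M.
Qed.

Lemma comp_taylor u v z s f : (forall i, v i m0 = 0) -> (forall i, Wt z s (v i)) ->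
  Wt z (s + s) (comp (fun i => u i + v i) f - comp u f - \sum_(i < p) comp u (D i f) * v i).
Proof.
move=> v0 Hv; apply/WtP => a az; pose u' i := u i + v i.
pose T f := comp u' f - comp u f - \sum_(i < p) comp u (D i f) * v i.
pose P f := Wt z s (comp u' f - comp u f) /\ Wt z (s + s) (T f).
have [_ H] : P (pol (trunc (mdeg a).+2 f)).
  apply: pol_ind; rewrite /P /T.
  - move=> c; rewrite !comp_cst subrr sub0r; split; first exact: Wt_0.
    by rewrite big1 ?oppr0 => [|i _]; [exact: Wt_0 | rewrite D_cst comp0 mul0r].
  - move=> i; rewrite !comp_X.
    have -> : nc (u' i) - nc (u i) = v i by rewrite -ncB /u' addrC addKr nc_id.
    split=> //; rewrite (bigD1 i) //= D_X eqxx comp1 mul1r big1 ?addr0 ?subrr.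
      exact: Wt_0.
    by move=> j ji; rewrite D_X (negPf ji) comp0 mul0r.
  - move=> g h [A1 A2] [B1 B2]; rewrite !compD; split.
      by rewrite opprD addrACA; apply: Wt_D.
    rewrite (eq_bigr (fun i => comp u (D i g) * v i + comp u (D i h) * v i)).
      rewrite big_split /=; move: A2 B2; rewrite /T.
      set x := \sum_(i < p) _; set y := \sum_(i < p) _ => A2 B2; clearbody x y.
      have -> : forall a b c d : fps K m, a + b - (c + d) - (x + y) = (a - c - x) + (b - d - y).
        by move=> *; ring.
      exact: Wt_D.
    by move=> i _; rewrite !(DD, compD) mulrDl.
  - move=> g h [A1 A2] [B1 B2]; rewrite !compM.
    have -> : \sum_(i < p) comp u (D i (g * h)) * v i =
      (\sum_(i < p) comp u (D i g) * v i) * comp u h +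
      comp u g * (\sum_(i < p) comp u (D i h) * v i).
      rewrite big_distrl big_distrr -big_split; apply: eq_bigr => i _ /=.
      by rewrite DM compD /= !compM; ring.
    move: A1 A2 B1 B2.
    set x := comp u g; set x' := comp u' g; set y := comp u h; set y' := comp u' h.
    set d := \sum_(i < p) _; set e := \sum_(i < p) _ => A1 A2 B1 B2.
    clearbody x x' y y' d e; split.
      have -> : x' * y' - x * y = (x' - x) * y' + x * (y' - y) by ring.
      by apply: Wt_D; [apply: Wt_Ml | apply: Wt_Mr].
    have -> : x' * y' - x * y - (d * y + x * e) =
      (x' - x) * (y' - y) + (x' - x - d) * y + x * (y' - y - e) by ring.
    by apply: Wt_D; [apply: Wt_D|]; [apply: Wt_M | apply: Wt_Ml | apply: Wt_Mr].
have /WtP/(_ a az) := H; set q := pol _.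
have oq : ord (mdeg a).+2 (f - q) by apply: ord_trunc.
have z0 (g : fps K m) : ord (mdeg a).+1 g -> g a = 0 by move/ordP; apply.
have : T (f - q) a = 0.
  rewrite /T !(fpsDE, fpsNE).
  have oq' : ord (mdeg a).+1 (f - q) by apply: Wt_le oq.
  rewrite (z0 _ (comp_ord _ oq')) (z0 _ (comp_ord _ oq')) fps_sumE big1 ?subr0 //.
  by move=> i _; apply/z0/Wt_Ml/comp_ord/ord_D.
have -> : T (f - q) = T f - T q.
  rewrite /T !(DB, compB) (eq_bigr (fun i => comp u (D i f) * v i - comp u (D i q) * v i)).
    by rewrite sumrB; ring.
  by move=> i _; rewrite !(DB, compB) mulrBl.
by rewrite fpsBE => /eqP; rewrite subr_eq0 => /eqP -> ->.
Qed.

Lemma chain u f k : D k (comp u f) = \sum_(i < p) comp u (D i f) * D k (u i).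
Proof.
pose T f := D k (comp u f) - \sum_(i < p) comp u (D i f) * D k (u i).
have T0 q : T (pol q) = 0.
  apply: (@pol_ind K p (fun f => T f = 0)); rewrite /T.
  - by move=> c; rewrite !comp_cst D_cst big1 ?subr0 // => i _; rewrite D_cst comp0 mul0r.
  - move=> i; rewrite comp_X (bigD1 i) //= D_X eqxx comp1 mul1r big1 ?addr0.
      by rewrite /nc raddfB /= D_cst subr0 subrr.
    by move=> j ji; rewrite D_X (negPf ji) comp0 mul0r.
  - move=> g h /subr0_eq A1 /subr0_eq B1; rewrite !(DD, compD) A1 B1 -big_split /=.
    rewrite -sumrB big1 // => i _; rewrite !(DD, compD); ring.
  - move=> g h /subr0_eq A1 /subr0_eq B1; rewrite compM DM A1 B1.
    rewrite mulr_suml mulr_sumr -big_split -sumrB big1 // => i _ /=.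
    by rewrite DM compD /= !compM; ring.
apply/eqP; rewrite -subr_eq0 -/(T f); apply/eqP/ord_all => N.
have oq : ord N.+1 (f - pol (trunc N.+1 f)) by apply: ord_trunc.
rewrite -[f](subrK (pol (trunc N.+1 f))); set r := f - _ in oq *; set q := trunc _ _.
have -> : T (r + pol q) = T r + T (pol q).
  rewrite /T !(DD, compD) (eq_bigr (fun i => comp u (D i r) * D k (u i) + comp u (D i (pol q)) * D k (u i))).
    by rewrite big_split /=; ring.
  by move=> i _; rewrite !(DD, compD) mulrDl.
rewrite T0 addr0; apply: Wt_B; first exact/ord_D/comp_ord.
by apply: Wt_sum => i _; apply/Wt_Ml/comp_ord/ord_D.
Qed.

Lemma rmorph_ext (phi psi : {rmorphism fps K p -> fps K m}) :
  (forall N f, ord N f -> ord N (phi f)) -> (forall N f, ord N f -> ord N (psi f)) ->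
  (forall c, phi (cst p c) = psi (cst p c)) ->
  (forall i, phi (X K i) = psi (X K i)) -> phi =1 psi.
Proof.
move=> H1 H2 Hc HX f; apply: ord_eq => N.
have oq : ord N (f - pol (trunc N f)) by apply: ord_trunc.
rewrite -[f](subrK (pol (trunc N f))); set r := f - _ in oq *; set q := trunc _ _.
have E : phi (pol q) = psi (pol q).
  apply: (@pol_ind K p (fun f => phi f = psi f)) => //.
  - by move=> g h A1 B1; rewrite !raddfD /= A1 B1.
  - by move=> g h A1 B1; rewrite !rmorphM /= A1 B1.
have -> : phi (r + pol q) - psi (r + pol q) = phi r - psi r.
  by rewrite (raddfD phi) (raddfD psi) /= E opprD addrACA subrr addr0.
apply: Wt_B; [exact: H1 | exact: H2].
Qed.

Lemma eq_comp u v f : (forall i, u i = v i) -> comp u f = comp v f.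
Proof. by move=> /funext ->. Qed.

End Comp.

Lemma comp_comp (K : numFieldType) p q m (v : 'I_q -> fps K m) (u : 'I_p -> fps K q) f :
  comp v (comp u f) = comp (fun i => comp v (u i)) f.
Proof.
apply: (rmorph_ext (phi := comp v \o comp u)) f => [N f|N f|c|i] /=.
- by move=> /comp_ord /comp_ord.
- exact: comp_ord.
- by rewrite !comp_cst.
- by rewrite !comp_X /nc raddfB /= comp_cst comp_coef0.
Qed.

Lemma comp_id (K : numFieldType) m (f : fps K m) : comp (fun i => X K i) f = f.
Proof.
apply: (rmorph_ext (phi := comp (fun i => X K i)) (psi := idfun)) f => [N f|N f|c|i] //=.
- exact: comp_ord.
- by rewrite comp_cst.
- by rewrite comp_X nc_id // XE -mdeg_eq0 mdeg1.
Qed.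

(** * Majorant norms *)

Lemma ler_sum_inj (R : realDomainType) (I J : finType) (h : I -> J) (F : J -> R) :
  injective h -> (forall j, 0 <= F j) -> \sum_i F (h i) <= \sum_j F j.
Proof.
move=> hi F0; rewrite -(big_imset (h := h) F (A := predT)) /=; last by move=> ? ? _ _ /hi.
rewrite [leRHS](bigID (mem (h @: predT))) /= lerDl.
by apply: sumr_ge0.
Qed.

HB.lock Definition nrm (R : realType) m (r : R) N (f : fps (CC R) m) : R :=
  \sum_(b : bmultinom m N) normc (f b) * r ^+ mdeg b.

Lemma nrmE (R : realType) m (r : R) N (f : fps (CC R) m) :
  nrm r N f = \sum_(b : bmultinom m N) normc (f b) * r ^+ mdeg b.
Proof. by rewrite nrm.unlock. Qed.

Section Norm.
Variables (R : realType) (m : nat).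
Local Notation E := (fps (CC R) m).
Implicit Types (f g h : E) (a b : multinom m) (r s : R) (N : nat).

Lemma normc_ge0 (x : CC R) : 0 <= normc x.
Proof. by case: x => a b; apply: sqrtr_ge0. Qed.
Lemma normcX (x : CC R) n : normc (x ^+ n) = normc x ^+ n.
Proof. by elim: n => [|n IH]; rewrite ?normc1 // !exprS normcM IH. Qed.
Lemma normc_sum (I : Type) (s : seq I) (P : pred I) (F : I -> CC R) :
  normc (\sum_(i <- s | P i) F i) <= \sum_(i <- s | P i) normc (F i).
Proof.
apply: (big_ind2 (fun x y => normc x <= y)) => //; first by rewrite normc0.
by move=> x y x' y' H H'; apply: le_trans (le_normcD _ _) _; apply: lerD.
Qed.

Lemma nrm_term_ge0 r f a : 0 <= r -> 0 <= normc (f a) * r ^+ mdeg a.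
Proof. by move=> r0; rewrite mulr_ge0 ?normc_ge0 ?exprn_ge0. Qed.

Lemma nrm_ge0 r N f : 0 <= r -> 0 <= nrm r N f.
Proof. by move=> r0; rewrite nrmE; apply: sumr_ge0 => b _; apply: nrm_term_ge0. Qed.

Lemma nrmD r N f g : 0 <= r -> nrm r N (f + g) <= nrm r N f + nrm r N g.
Proof.
move=> r0; rewrite !nrmE -big_split; apply: ler_sum => b _ /=.
by rewrite fpsDE -mulrDl ler_wpM2r ?exprn_ge0 // le_normcD.
Qed.
Lemma nrm0 r N : nrm r N (0 : E) = 0.
Proof. by rewrite nrmE big1 // => b _; rewrite fps0E normc0 mul0r. Qed.
Lemma nrmN r N f : nrm r N (- f) = nrm r N f.
Proof. by rewrite !nrmE; apply: eq_bigr => b _; rewrite fpsNE normcN. Qed.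
Lemma nrmB r N f g : 0 <= r -> nrm r N (f - g) <= nrm r N f + nrm r N g.
Proof. by move=> r0; apply: le_trans (nrmD _ _ _ r0) _; rewrite nrmN. Qed.
Lemma nrm_sum r N I (s : seq I) (P : pred I) (F : I -> E) : 0 <= r ->
  nrm r N (\sum_(i <- s | P i) F i) <= \sum_(i <- s | P i) nrm r N (F i).
Proof.
move=> r0; apply: (big_ind2 (fun x y => nrm r N x <= y)) => //; first by rewrite nrm0.
by move=> x y x' y' H H'; apply: le_trans (nrmD _ _ _ r0) _; apply: lerD.
Qed.

Lemma nrm_agree r N f g : ord N (f - g) -> nrm r N f = nrm r N g.
Proof.
move/ordP => H; rewrite !nrmE; apply: eq_bigr => -[b bN] _ /=.
by move: (H b bN) => /eqP; rewrite fpsBE subr_eq0 => /eqP ->.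
Qed.

Lemma nrm_inj m' r N k (f : fps (CC R) m') g (c : R) (h : multinom m -> multinom m') :
  0 <= r -> 0 <= c -> injective h -> (forall a, mdeg (h a) = (mdeg a + k)%N) ->
  (forall a, normc (g a) <= c * normc (f (h a))) ->
  nrm r N g * r ^+ k <= c * nrm r (N + k) f.
Proof.
move=> r0 c0 hi hd H.
have hb (b : bmultinom m N) : (mdeg (h b) < N + k)%N by rewrite hd ltn_add2r; case: b.
pose h' (b : bmultinom m N) := BMultinom (hb b).
have h'i : injective h' by move=> x y [] /hi xy; apply: val_inj.
pose F (b : bmultinom m' (N + k)) := normc (f b) * r ^+ mdeg b.
have F0 x : 0 <= F x by rewrite mulr_ge0 ?normc_ge0 ?exprn_ge0.
rewrite !nrmE mulr_suml; apply: (@le_trans _ _ (c * \sum_(b : bmultinom m N) F (h' b))); last first.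
  by rewrite ler_wpM2l //; exact: (ler_sum_inj h'i F0).
rewrite mulr_sumr; apply: ler_sum => b _; rewrite /F /= hd exprD !mulrA.
by rewrite !ler_wpM2r ?exprn_ge0.
Qed.

Lemma nrm_dom r N f g (c : R) : 0 <= r -> 0 <= c ->
  (forall a, normc (g a) <= c * normc (f a)) -> nrm r N g <= c * nrm r N f.
Proof.
move=> r0 c0 H; have := @nrm_inj m r N 0 f g c id r0 c0 (fun _ _ => id) _ H.
by rewrite expr0 mulr1 addn0; apply=> a; rewrite addn0.
Qed.

Lemma nrm_le r N f g : 0 <= r -> (forall a, normc (g a) <= normc (f a)) ->
  nrm r N g <= nrm r N f.
Proof.
move=> r0 H; rewrite -[leRHS]mul1r; apply: nrm_dom => // a.
by rewrite mul1r.
Qed.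

Lemma nrm_radius r s N k f : 0 <= r -> r <= s -> 0 < s -> ord k f ->
  nrm r N f <= (r / s) ^+ k * nrm s N f.
Proof.
move=> r0 rs s0 /ordP fk; rewrite !nrmE mulr_sumr; apply: ler_sum => b _.
have [bk|kb] := ltnP (mdeg b) k; first by rewrite fk // normc0 !mul0r mulr0.
rewrite mulrCA ler_wpM2l ?normc_ge0 //.
have rs1 : 0 <= r / s <= 1 by rewrite divr_ge0 ?ler_pdivrMr ?mul1r // ltW.
have [/andP[q0 q1]] := rs1.
have -> : r ^+ mdeg b = (r / s) ^+ mdeg b * s ^+ mdeg b.
  by rewrite -exprMn divfK // gt_eqF.
rewrite ler_wpM2r ?exprn_ge0 ?(ltW s0) //.
by rewrite -(subnKC kb) exprD ler_piMr ?exprn_ge0 // exprn_ile1.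
Qed.

Lemma nrm_rad r s N f : 0 <= r -> r <= s -> nrm r N f <= nrm s N f.
Proof.
move=> r0 rs; rewrite !nrmE; apply: ler_sum => b _.
by rewrite ler_wpM2l ?normc_ge0 // lerXn2r // nnegrE (le_trans r0).
Qed.

Lemma nrmM r N f g : 0 <= r -> nrm r N (f * g) <= nrm r N f * nrm r N g.
Proof.
move=> r0; rewrite !nrmE.
pose F (k : bmultinom m N * bmultinom m N) :=
  (normc (f k.1) * r ^+ mdeg k.1) * (normc (g k.2) * r ^+ mdeg k.2).
have F0 k : 0 <= F k by rewrite mulr_ge0 ?nrm_term_ge0.
rewrite big_distrlr pair_big /= -/(F _).
apply: (@le_trans _ _ (\sum_(b : bmultinom m N)
    \sum_(k : bmultinom m N * bmultinom m N | b == k.1 +m k.2 :> multinom m) F k)).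
  apply: ler_sum => -[b bN] _ /=; rewrite (fpsME _ _ bN).
  apply: (@le_trans _ _ ((\sum_(k : bmultinom m N * bmultinom m N | b == k.1 +m k.2 :> multinom m)
    normc (f k.1 * g k.2)) * r ^+ mdeg b)).
    by rewrite ler_wpM2r ?exprn_ge0 ?normc_sum.
  rewrite mulr_suml; apply: ler_sum => k /eqP ->.
  by rewrite /F normcM mdegD exprD mulrACA.
rewrite (exchange_big_dep predT) //=; apply: ler_sum => k _.
have [kN|kN] := ltnP (mdeg (k.1 +m k.2)) N.
  by rewrite (big_pred1 (BMultinom kN)) // => b; rewrite /= -val_eqE.
rewrite big1 => [|[b bN] /= /eqP E]; first exact: (F0 k).
by move: kN; rewrite -E leqNgt bN.
Qed.

Lemma nrm_cst r N c : 0 <= r -> nrm r N (cst m c : E) <= normc c.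
Proof.
move=> r0; rewrite nrmE; have [bN|bN] := ltnP 0 N.
  have b0 : (mdeg (m0 : multinom m) < N)%N by rewrite mdeg0.
  rewrite (bigD1 (BMultinom b0)) //= big1 ?addr0 => [|b b0'].
    by rewrite cstE eqxx mulr1 mdeg0 expr0 mulr1.
  by rewrite cstE; move: b0'; rewrite -val_eqE /= => /negPf ->; rewrite mulr0 normc0 mul0r.
rewrite big1 ?normc_ge0 // => -[b bb] _.
by have := bb; rewrite ltnNge (leq_trans bN).
Qed.
Lemma nrm1 r N : 0 <= r -> nrm r N (1 : E) <= 1.
Proof.
move=> r0; rewrite -[X in nrm _ _ X](rmorph1 (cst m)).
by apply: le_trans (nrm_cst _ _ r0) _; rewrite normc1.
Qed.
Lemma nrm_X r N i : 0 <= r -> nrm r N (X (CC R) i : E) <= r.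
Proof.
move=> r0; rewrite nrmE; have [bN|bN] := ltnP (mdeg (U i : multinom m)) N.
  rewrite (bigD1 (BMultinom bN)) //= big1 ?addr0 => [|b b0'].
    by rewrite XE eqxx normc1 mdeg1 expr1 mul1r.
  by rewrite XE eq_sym; move: b0'; rewrite -val_eqE /= => /negPf ->; rewrite normc0 mul0r.
rewrite big1 // => -[b bb] _ /=; rewrite XE; case: eqP => [E|]; last by rewrite normc0 mul0r.
by move: bb; rewrite -E ltnNge bN.
Qed.

Lemma nrm_nc r N f : 0 <= r -> nrm r N (nc f) <= nrm r N f.
Proof.
move=> r0; apply: nrm_le => // a; rewrite fpsBE cstE.
by case: eqP => [->|_]; rewrite ?mulr1 ?mulr0 ?subrr ?subr0 ?normc0 ?normc_ge0.
Qed.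

Lemma nrm_exp r N f s n : 0 <= r -> nrm r N f <= s -> nrm r N (f ^+ n) <= s ^+ n.
Proof.
move=> r0 fs; elim: n => [|n IH]; first by rewrite !expr0 nrm1.
rewrite !exprS; apply: le_trans (nrmM _ _ _ r0) _.
by apply: ler_pM => //; apply: nrm_ge0.
Qed.

Lemma nrm_comp p r s N (u : 'I_p -> E) (f : fps (CC R) p) : 0 <= r -> 0 <= s ->
  (forall i, nrm r N (nc (u i)) <= s) -> nrm r N (comp u f) <= nrm s N f.
Proof.
move=> r0 s0 us; rewrite (nrm_agree r (comp_sub u N f)) trunc.unlock raddf_sum /=.
apply: le_trans (nrm_sum _ _ _ _ r0) _; rewrite [leRHS]nrmE; apply: ler_sum => b _.
rewrite -mul_mpolyC subM sub_mX.
apply: le_trans (nrmM _ _ _ r0) _; apply: ler_pM; rewrite ?nrm_ge0 //.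
  by rewrite subE mmapC nrm_cst.
rewrite mdegE -prodrXr.
apply: (big_ind2 (fun x y => nrm r N x <= y)); first exact: nrm1.
  move=> x y x' y' H H'; apply: le_trans (nrmM _ _ _ r0) _.
  by apply: ler_pM => //; apply: nrm_ge0.
by move=> i _; apply: nrm_exp.
Qed.

Lemma nrm_D r N i f : 0 <= r -> nrm (r / 2) N (D i f) * r <= nrm r N.+1 f.
Proof.
move=> r0.
pose g : E := Fps (fun a => f (a +m U i)).
apply: (@le_trans _ _ (nrm r N g * r)).
  rewrite ler_wpM2r // !nrmE; apply: ler_sum => b _.
  rewrite DE /= normcMn mulrnAl -mulrnAr ler_wpM2l ?normc_ge0 // expr_div_n.
  rewrite -mulr_natr -mulrA ler_piMr ?exprn_ge0 // mulrC ler_pdivrMr ?exprn_gt0 // mul1r.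
  rewrite -natrX ler_nat; apply: leq_ltn_trans (ltn_expl _ (ltnSn 1)).
  by rewrite mdegE (bigD1 i) //= leq_addr.
have := @nrm_inj m r N 1 f g 1 (fun a => a +m U i) r0 ler01 (@addIm _ _).
rewrite expr1 mul1r addn1; apply=> a; first by rewrite mdegD mdeg1.
by rewrite mul1r.
Qed.

End Norm.

(** * Convergent series, fixed points and inverse maps *)

Lemma comp_nc (K : numFieldType) p m (u : 'I_p -> fps K m) f :
  comp (fun i => nc (u i)) f = comp u f.
Proof.
apply: (rmorph_ext (phi := comp (fun i => nc (u i))) (psi := comp u)) => [N g|N g|c|i] /=.
- exact: comp_ord.
- exact: comp_ord.
- by rewrite !comp_cst.
- by rewrite !comp_X nc_id // -(comp_X u) comp_coef0 XE -mdeg_eq0 mdeg1.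
Qed.

Lemma comp_causal (K : numFieldType) p m (u v : 'I_p -> fps K m) k q f :
  (forall i, ord k (u i - v i)) -> ord q.+1 f -> ord (k + q) (comp u f - comp v f).
Proof.
move=> uv fq; rewrite -(comp_nc u) -(comp_nc v).
apply: (@Wt_le _ _ _ _ (q.+1 + k.-1)); first by case: k uv => [|k] _ /=; lia.
apply: (comp_Wt_diff (w := fun _ => 1%N)) fq => i; [exact: ord_nc | exact: ord_nc |].
rewrite -ncB; case: k uv => [|k] uv /=; first exact: ord_nc.
exact/Wt_nc/uv.
Qed.

Lemma ord_mulB (K : numFieldType) m k l (f f' g g' : fps K m) :
  ord k (f - f') -> ord l (g - g') -> ord 1 g -> ord 1 f' -> 
  ord (minn k l).+1 (f * g - f' * g').
Proof.
move=> ff gg g1 f1; rewrite mulrB_split; apply: Wt_D.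
  by apply: (@Wt_le _ _ _ _ (k + 1)); [lia | apply: Wt_M].
by apply: (@Wt_le _ _ _ _ (1 + l)); [lia | apply: Wt_M].
Qed.

Section FixedPoint.
Variables (R : realType) (p m : nat) (Phi : ('I_p -> fps (CC R) m) -> 'I_p -> fps (CC R) m).
Hypothesis causal : forall k u v, (forall i, ord k (u i - v i)) ->
  forall i, ord k.+1 (Phi u i - Phi v i).

Lemma fixed_point (r s : R) : 0 <= r -> 0 <= s ->
  (forall u, (forall i N, nrm r N (u i) <= s) -> forall i N, nrm r N (Phi u i) <= s) ->
  exists u, (forall i, Phi u i = u i) /\ (forall i N, nrm r N (u i) <= s).
Proof.
move=> r0 s0 bound; pose v k := iter k Phi (fun _ => 0).
have vS k i : ord k (v k.+1 i - v k i).
  by elim: k i => [|k IH] i; [exact: Wt_0k | exact: causal].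
have vl k l i : ord k (v (k + l)%N i - v k i).
  elim: l => [|l IH]; first by rewrite addn0 subrr; exact: Wt_0.
  rewrite -[v (k + l.+1)%N i](subrK (v (k + l)%N i)) addnS -addrA; apply: Wt_D => //.
  by apply: (@Wt_le _ _ _ _ (k + l)); [lia | exact: vS].
pose u i : fps (CC R) m := Fps (fun a => v (mdeg a).+1 i a).
have uv k i : ord k (u i - v k i).
  apply/ordP => a ak; rewrite fpsBE /u /=; apply/eqP; rewrite subr_eq0 eq_sym -subr_eq0.
  have /ordP/(_ a (ltnSn _)) := vl (mdeg a).+1 (k - (mdeg a).+1)%N i.
  by rewrite subnKC // fpsBE => ->.
have vb k i N : nrm r N (v k i) <= s.
  elim: k i N => [|k IH] i N /=; first by rewrite nrm0.
  exact: bound.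
exists u; split=> i; last by move=> N; rewrite (nrm_agree r (uv N i)).
apply: ord_eq => k; rewrite -[Phi u i](subrK (v k.+1 i)) -addrA; apply: Wt_D.
  by apply: (@Wt_le _ _ _ _ k.+1); [lia | apply: causal => j; apply: uv].
rewrite -opprB; apply: Wt_N; apply: (@Wt_le _ _ _ _ k.+1) (uv _ _); lia.
Qed.

End FixedPoint.

Section Conv.
Variable R : realType.

Definition conv m (f : fps (CC R) m) : Prop :=
  exists r M : R, 0 < r /\ forall N, nrm r N f <= M.

Lemma conv_fam (I : finType) m (u : I -> fps (CC R) m) : (forall i, conv (u i)) ->
  exists r M : R, [/\ 0 < r, 0 <= M & forall i N, nrm r N (u i) <= M].
Proof.
move=> H.
have H' i : exists x : R * R, [/\ 0 < x.1, x.1 <= 1, 0 <= x.2 & forall N, nrm x.1 N (u i) <= x.2].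
  have [r [M [r0 rM]]] := H i.
  have r1 : 0 < Num.min r 1 by rewrite lt_min r0 ltr01.
  exists (Num.min r 1, M); split=> //=; first by rewrite ge_min lexx orbT.
    by apply: le_trans (rM 0%N); apply: nrm_ge0 (ltW r0).
  by move=> N; apply: le_trans (rM N); apply: nrm_rad; rewrite ?ge_min ?lexx // ltW.
pose x i := projT1 (cid (H' i)).
have Hx i : [/\ 0 < (x i).1, (x i).1 <= 1, 0 <= (x i).2 & forall N, nrm (x i).1 N (u i) <= (x i).2].
  exact: projT2 (cid (H' i)).
have x0 i : 0 < (x i).1 by case: (Hx i).
exists (\prod_i (x i).1), (\sum_i (x i).2); split.
- by apply: prodr_gt0 => i _.
- by apply: sumr_ge0 => i _; case: (Hx i).
move=> i N; have [_ _ _ /(_ N) xi] := Hx i.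
apply: (@le_trans _ _ (x i).2); last first.
  by rewrite (bigD1 i) //= lerDl; apply: sumr_ge0 => j _; case: (Hx j).
apply: le_trans xi; apply: nrm_rad; first by apply: prodr_ge0 => j _; apply: ltW.
rewrite (bigD1 i) //= ler_piMr //; first exact: ltW.
suff /andP[] : 0 <= \prod_(j | j != i) (x j).1 <= 1 by [].
apply: (big_ind (fun y => 0 <= y <= 1)) => [|y z /andP[y0 y1] /andP[z0 z1]|j _].
- by rewrite ler01 lexx.
- by rewrite mulr_ge0 // mulr_ile1.
- by rewrite ltW // ; case: (Hx j).
Qed.

Lemma convP m (f : fps (CC R) m) (r M : R) :
  0 < r -> (forall N, nrm r N f <= M) -> conv f.
Proof. by move=> r0 rM; exists r, M. Qed.

Lemma conv2 m (f g : fps (CC R) m) : conv f -> conv g ->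
  exists r M : R, [/\ 0 < r, 0 <= M, forall N, nrm r N f <= M & forall N, nrm r N g <= M].
Proof.
move=> cf cg; have [[]|r [M [r0 M0 H]]] := @conv_fam bool m (fun b => if b then f else g) => //.
by exists r, M; split=> // N; [apply: (H true)| apply: (H false)].
Qed.

Lemma conv_D m (f g : fps (CC R) m) : conv f -> conv g -> conv (f + g).
Proof.
move=> cf /(conv2 cf) [r [M [r0 M0 fM gM]]]; apply: (@convP _ _ r (M + M)) => // N.
by apply: le_trans (nrmD _ _ _ (ltW r0)) _; apply: lerD.
Qed.
Lemma conv_N m (f : fps (CC R) m) : conv f -> conv (- f).
Proof. by move=> [r [M [r0 fM]]]; exists r, M; split=> // N; rewrite nrmN. Qed.
Lemma conv_B m (f g : fps (CC R) m) : conv f -> conv g -> conv (f - g).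
Proof. by move=> cf cg; apply: conv_D => //; apply: conv_N. Qed.
Lemma conv_M m (f g : fps (CC R) m) : conv f -> conv g -> conv (f * g).
Proof.
move=> cf /(conv2 cf) [r [M [r0 M0 fM gM]]]; apply: (@convP _ _ r (M * M)) => // N.
by apply: le_trans (nrmM _ _ _ (ltW r0)) _; apply: ler_pM => //; apply: nrm_ge0 (ltW r0).
Qed.
Lemma conv_cst m c : conv (cst m c : fps (CC R) m).
Proof. by apply: (@convP _ _ 1 (normc c)) => // N; apply: nrm_cst. Qed.
Lemma conv_0 m : conv (0 : fps (CC R) m).
Proof. by rewrite -(rmorph0 (cst m)); apply: conv_cst. Qed.
Lemma conv_X m i : conv (X (CC R) i : fps (CC R) m).
Proof. by apply: (@convP _ _ 1 1) => // N; apply: nrm_X. Qed.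
Lemma conv_sum m (I : Type) (s : seq I) (P : pred I) (F : I -> fps (CC R) m) :
  (forall i, P i -> conv (F i)) -> conv (\sum_(i <- s | P i) F i).
Proof. by move=> H; apply: big_ind => //; [exact: conv_0 | exact: conv_D]. Qed.
Lemma conv_dom m (f g : fps (CC R) m) (c : R) : 0 <= c ->
  (forall a, normc (g a) <= c * normc (f a)) -> conv f -> conv g.
Proof.
move=> c0 H [r [M [r0 fM]]]; apply: (@convP _ _ r (c * M)) => // N.
by apply: le_trans (nrm_dom _ (ltW r0) c0 H) _; apply: ler_wpM2l.
Qed.
Lemma conv_Dx m i (f : fps (CC R) m) : conv f -> conv (D i f).
Proof.
move=> [r [M [r0 fM]]]; apply: (@convP _ _ (r / 2) (M / r)) => [|N]; first by rewrite divr_gt0.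
by rewrite ler_pdivlMr //; apply: le_trans (nrm_D _ _ _ (ltW r0)) _.
Qed.
Lemma conv_inj m m' (f : fps (CC R) m') (g : fps (CC R) m) k (h : multinom m -> multinom m') :
  injective h -> (forall a, mdeg (h a) = (mdeg a + k)%N) ->
  (forall a, normc (g a) <= normc (f (h a))) -> conv f -> conv g.
Proof.
move=> hi hd H [r [M [r0 fM]]]; apply: (@convP _ _ r (M / r ^+ k)) => // N.
rewrite ler_pdivlMr ?exprn_gt0 //; apply: le_trans (fM (N + k)%N).
rewrite -[leRHS]mul1r; apply: (@nrm_inj R m m' r N k f g 1 h) => //; first exact: ltW.
by move=> a; rewrite mul1r.
Qed.

Lemma conv_comp p m (u : 'I_p -> fps (CC R) m) f :
  (forall i, conv (u i)) -> conv f -> conv (comp u f).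
Proof.
move=> /conv_fam [r [M [r0 M0 uM]]] [s [A [s0 fA]]].
have M1 : 0 < M + 1 by lra.
pose t := r * Num.min 1 (s / (M + 1)).
have q0 : 0 < Num.min 1 (s / (M + 1)) by rewrite lt_min ltr01 divr_gt0.
have q1 : Num.min 1 (s / (M + 1)) <= 1 by rewrite ge_min lexx.
have t0 : 0 < t by rewrite mulr_gt0.
apply: (@convP _ _ t A) => // N; apply: le_trans (fA N).
apply: nrm_comp (ltW t0) (ltW s0) _ => i.
apply: (@le_trans _ _ ((t / r) ^+ 1 * nrm r N (nc (u i)))).
  apply: nrm_radius => //; [exact: ltW | | exact: ord_nc].
  by rewrite /t ler_piMr // ltW.
have -> : (t / r) ^+ 1 = Num.min 1 (s / (M + 1)) by rewrite expr1 /t mulrAC divff ?mul1r // gt_eqF.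
have cM : nrm r N (nc (u i)) <= M + 1.
  apply: le_trans (nrm_nc _ _ (ltW r0)) _; apply: le_trans (uM i N) _; lra.
apply: (@le_trans _ _ (s / (M + 1) * (M + 1))); last by rewrite divfK ?gt_eqF.
apply: ler_pM => //; [exact: ltW | exact: nrm_ge0 (ltW r0) |].
by rewrite ge_min lexx orbT.
Qed.

Lemma inverse_right m (u : 'I_m -> fps (CC R) m) :
  (forall i, ord 2 (u i - X (CC R) i)) -> (forall i, conv (u i)) ->
  exists v : 'I_m -> fps (CC R) m, [/\ forall i, ord 2 (v i - X (CC R) i), forall i, conv (v i)
    & forall i, comp v (u i) = X (CC R) i].
Proof.
move=> u2 cu; pose uh i := u i - X (CC R) i.
have [R0 [M [R00 M0 uM]]] : exists r M : R, [/\ 0 < r, 0 <= M & forall i N, nrm r N (uh i) <= M].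
  by apply: conv_fam => i; apply: conv_B => //; apply: conv_X.
pose Phi (w : 'I_m -> fps (CC R) m) i := - comp (fun j => X (CC R) j + w j) (uh i).
have causal k w w' : (forall i, ord k (w i - w' i)) -> forall i, ord k.+1 (Phi w i - Phi w' i).
  move=> ww i; rewrite /Phi -opprD; apply: Wt_N; rewrite -[k.+1]addn1; apply: (comp_causal _ (u2 i)) => j.
  by rewrite opprD addrACA subrr add0r.
pose r := R0 ^+ 2 / (4 * (M + R0)).
have MR : 0 < M + R0 by lra.
have r0 : 0 < r by rewrite divr_gt0 ?exprn_gt0 // mulr_gt0.
have rE : r * (4 * (M + R0)) = R0 ^+ 2 by rewrite divfK // gt_eqF // mulr_gt0.
have r2 : 2 * r <= R0 by rewrite -(ler_pM2r MR); nra.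
have rM : (2 * r / R0) ^+ 2 * M <= r.
  rewrite expr_div_n mulrAC ler_pdivrMr ?exprn_gt0 // -rE; nra.
have [|w [fixw wr]] := fixed_point causal (ltW r0) (ltW r0).
  move=> w wr i N; rewrite nrmN; apply: le_trans rM.
  apply: (@le_trans _ _ (nrm (2 * r) N (uh i))).
    apply: nrm_comp; [exact: ltW | by rewrite mulr_ge0 // ltW |] => j.
    apply: le_trans (nrm_nc _ _ (ltW r0)) _; apply: le_trans (nrmD _ _ _ (ltW r0)) _.
    have := nrm_X N j (ltW r0); have := wr j N; lra.
  apply: (@le_trans _ _ ((2 * r / R0) ^+ 2 * nrm R0 N (uh i))).
    have r20 : 0 <= 2 * r by rewrite mulr_ge0 // ltW.
    exact: (nrm_radius N r20 r2 R00 (u2 i)).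
  by apply: ler_wpM2l; [apply/exprn_ge0/divr_ge0; lra | exact: uM].
have w2 i : ord 2 (w i).
  rewrite -fixw /Phi -comp_nc; apply: Wt_N; apply: (comp_Wt (w := fun _ => 1%N)) (u2 i) => j; exact: ord_nc.
exists (fun i => X (CC R) i + w i); split=> i.
- by rewrite addrC addKr.
- by apply: conv_D; [exact: conv_X | apply: (@convP _ _ r r)].
- rewrite -[u i](subrK (X (CC R) i)) compD comp_X nc_id; last first.
    by rewrite fpsDE XE (ord_coef0 (w2 i)) -mdeg_eq0 mdeg1 addr0.
  by rewrite -[in X in _ + X]fixw /Phi addrCA subrr addr0.
Qed.

Lemma inverse m (u : 'I_m -> fps (CC R) m) :
  (forall i, ord 2 (u i - X (CC R) i)) -> (forall i, conv (u i)) ->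
  exists v : 'I_m -> fps (CC R) m, [/\ forall i, ord 2 (v i - X (CC R) i), forall i, conv (v i),
    forall i, comp v (u i) = X (CC R) i & forall i, comp u (v i) = X (CC R) i].
Proof.
move=> u2 cu; have [v [v2 cv vu]] := inverse_right u2 cu.
have [w [w2 _ wv]] := inverse_right v2 cv.
exists v; split=> //.
suff uw i : u i = w i by move=> i; rewrite (eq_comp _ uw).
have := congr1 (comp w) (vu i); rewrite comp_comp comp_X nc_id.
  by rewrite (eq_comp _ wv) comp_id.
rewrite -[w i](subrK (X (CC R) i)) fpsDE XE (ord_coef0 (w2 i)) -mdeg_eq0 mdeg1.
by rewrite addr0.
Qed.

End Conv.

(** * Canonical maps from generating functions *)

Section Blocks.
Variables (d : nat).

Definition dblk (A : Type) (f g : 'I_d -> A) (i : 'I_(d + d)) : A :=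
  match fintype.split i with inl j => f j | inr j => g j end.
Lemma dblk_x A (f g : 'I_d -> A) j : dblk f g (xi j) = f j.
Proof. by rewrite /dblk (unsplitK (inl j)). Qed.
Lemma dblk_y A (f g : 'I_d -> A) j : dblk f g (yi j) = g j.
Proof. by rewrite /dblk (unsplitK (inr j)). Qed.
Lemma xy_ind (P : 'I_(d + d) -> Prop) :
  (forall j, P (xi j)) -> (forall j, P (yi j)) -> forall i, P i.
Proof. by move=> Px Py i; rewrite -(splitK i); case: (fintype.split i) => j; [exact: Px | exact: Py]. Qed.
Lemma xi_eq (j k : 'I_d) : (xi j == xi k) = (j == k).
Proof. by rewrite eq_lshift. Qed.
Lemma yi_eq (j k : 'I_d) : (yi j == yi k) = (j == k).
Proof. by rewrite eq_rshift. Qed.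
Lemma xi_yi (j k : 'I_d) : (xi j == yi k) = false.
Proof. exact: eq_lrshift. Qed.
Lemma yi_xi (j k : 'I_d) : (yi j == xi k) = false.
Proof. exact: eq_rlshift. Qed.
Lemma big_xy (A : zmodType) (F : 'I_(d + d) -> A) :
  \sum_i F i = \sum_(j < d) F (xi j) + \sum_(j < d) F (yi j).
Proof. exact: big_split_ord. Qed.

Definition Om (A : pzRingType) (u v : 'I_(d + d) -> A) : A :=
  \sum_(j < d) (u (xi j) * v (yi j) - u (yi j) * v (xi j)).

End Blocks.

Section Generating.
Variables (R : realType) (d : nat).
Local Notation K := (CC R).
Local Notation E := (fps K (d + d)).

Lemma X_m0 m (i : 'I_m) : X K i m0 = 0.
Proof. by rewrite XE -mdeg_eq0 mdeg1. Qed.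

(* The mixed-variable generating function sum_j x_j eta_j + W(x, eta). *)
Definition genx (W : E) : 'I_(d + d) -> E :=
  dblk (fun j => X K (xi j) + D (yi j) W) (fun j => X K (yi j)).
Definition geny (W : E) : 'I_(d + d) -> E :=
  dblk (fun j => X K (xi j)) (fun j => X K (yi j) + D (xi j) W).

Definition symplectic (phi : 'I_(d + d) -> E) :=
  forall a b, Om (fun i => D a (phi i)) (fun i => D b (phi i)) =
              Om (fun i => D a (X K i)) (fun i => D b (X K i)).

Lemma generating (W : E) : ord 3 W -> conv W ->
  exists theta phi : 'I_(d + d) -> E,
  [/\ [/\ forall i, ord 2 (theta i - X K i),
       forall i, comp theta (genx W i) = X K i & forall i, comp (genx W) (theta i) = X K i],
      [/\ forall i, conv (phi i), forall i, ord 2 (phi i - X K i) & symplectic phi],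
      forall i, phi i = comp theta (geny W i) &
      forall i, comp (genx W) (phi i) = geny W i].
Proof.
move=> W3 cW.
have DW i : ord 2 (D i W) by apply: ord_D.
have g2 i : ord 2 (genx W i - X K i).
  elim/xy_ind: i => j; rewrite /genx ?dblk_x ?dblk_y; last by rewrite subrr; exact: Wt_0.
  by rewrite addrAC subrr add0r.
have cg i : conv (genx W i).
  elim/xy_ind: i => j; rewrite /genx ?dblk_x ?dblk_y; last exact: conv_X.
  by apply: conv_D; [exact: conv_X | exact: conv_Dx].
have [th [th2 cth thg gth]] := inverse g2 cg.
have th0 i : th i m0 = 0.
  by rewrite -[th i](subrK (X K i)) fpsDE X_m0 (ord_coef0 (th2 i)) addr0.
have thy j : th (yi j) = X K (yi j) by have := thg (yi j); rewrite /genx dblk_y comp_X nc_id.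
pose phi i := comp th (geny W i).
have phx j : phi (xi j) = th (xi j) by rewrite /phi /geny dblk_x comp_X nc_id.
have phy j : phi (yi j) = X K (yi j) + comp th (D (xi j) W).
  by rewrite /phi /geny dblk_y compD comp_X nc_id // thy.
have cphi i : conv (phi i).
  elim/xy_ind: i => j; rewrite ?phx ?phy //; apply: conv_D; first exact: conv_X.
  by apply: conv_comp => //; apply: conv_Dx.
have phi2 i : ord 2 (phi i - X K i).
  elim/xy_ind: i => j; rewrite ?phx ?phy //.
  by rewrite addrAC subrr add0r; apply: comp_ord.
exists th, phi; split=> //; last first.
  by move=> i; rewrite /phi comp_comp (eq_comp _ gth) comp_id.
split=> // a b; pose S i k := comp th (D i (D k W)).
have DS c k : D c (comp th (D k W)) = \sum_i S i k * D c (th i) by rewrite chain.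
have thx c j : D c (X K (xi j)) = D c (th (xi j)) + \sum_i S i (yi j) * D c (th i).
  by rewrite -{1}(thg (xi j)) /genx dblk_x compD comp_X nc_id // DD DS.
have xy c j : D c (X K (yi j)) = D c (th (yi j)) by rewrite thy.
have py c j : D c (phi (yi j)) = D c (th (yi j)) + \sum_i S i (xi j) * D c (th i).
  by rewrite phy DD DS thy.
apply/eqP; rewrite -subr_eq0; apply/eqP; rewrite /Om -sumrB.
pose p i := D a (th i); pose q i := D b (th i).
transitivity (\sum_k \sum_i (S i k * p k * q i - S i k * p i * q k)).
  rewrite big_xy -big_split; apply: eq_bigr => j _ /=.
  rewrite !phx !py !thx !xy -/(p _) -/(q _).
  have sB c : \sum_i (S i c * p c * q i - S i c * p i * q c) =
    p c * (\sum_i S i c * q i) - (\sum_i S i c * p i) * q c.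
    by rewrite mulr_sumr mulr_suml -sumrB; apply: eq_bigr => i _; ring.
  by rewrite !sB; ring.
under eq_bigr => k _ do rewrite sumrB.
rewrite sumrB [X in _ - X]exchange_big /=; apply/eqP; rewrite subr_eq0; apply/eqP.
by apply: eq_bigr => k _; apply: eq_bigr => i _; rewrite /S DC.
Qed.

End Generating.

(** * Small divisors *)

HB.lock Definition mulT (K : numFieldType) m (t : multinom m -> K) (f : fps K m) : fps K m :=
  Fps (fun a => t a * f a).

Section Util.
Variables (K : numFieldType) (m : nat).
Local Notation E := (fps K m).
Implicit Types (f g h : E) (a b : multinom m).

Lemma XMU i f a : (X K i * f) (a +m U i) = f a.
Proof.
pose N := (mdeg (a +m U i)).+1; have aN : (mdeg (a +m U i) < N)%N by [].
rewrite [_ * _]/GRing.mul /= (fps_mulE _ _ aN).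
have one : agree N (trunc N (X K i)) (mX (U i)) by move=> b bN; rewrite mcoeff_trunc // polE.
rewrite (agree_mul one (fun _ _ => erefl) aN) mulrC addmC mcoeffMX mcoeff_trunc //.
by rewrite /N mdegD; lia.
Qed.
Lemma XM0 i f a : a i = 0%N -> (X K i * f) a = 0.
Proof.
move=> ai; pose w (j : 'I_m) := (j == i : nat).
have : Wt w 1 (X K i * f) by apply: Wt_Ml; rewrite -{1}[1%N]/(true : nat) -(eqxx i); exact: Wt_X.
move/WtP; apply; rewrite /wdeg (bigD1 i) //= ai muln0 big1 // => j /negPf ji.
by rewrite /w ji.
Qed.
Lemma mnm_subU i a : a i != 0%N -> exists b, a = b +m U i.
Proof.
move=> ai; exists (mnm_sub a (U i)); rewrite submK //; apply/mnm_lepP => j.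
by rewrite mnm1E; case: eqP => [<-|//]; rewrite lt0n.
Qed.
Lemma XM_eq0 i f : X K i * f = 0 -> f = 0.
Proof.
by move=> H; apply/fpsP => a; rewrite -(XMU i) H !fps0E.
Qed.
Lemma XDE i f a : (X K i * D i f) a = (a i)%:R * f a.
Proof.
have [ai|ai] := eqVneq (a i) 0%N; first by rewrite XM0 // ai mul0r.
have [b ->] := mnm_subU ai; rewrite XMU DE mnmDE mnm1E eqxx addn1.
by rewrite mulr_natl.
Qed.
Lemma fps_cancel g f : g m0 != 0 -> g * f = 0 -> f = 0.
Proof.
move=> g0 gf; apply: ord_all => k; elim: k => [|k IH]; first exact: Wt_0k.
have : ord k.+1 (cst m (g m0) * f).
  have -> : cst m (g m0) * f = - (nc g * f) by rewrite /nc mulrBl gf sub0r opprK.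
  by apply: Wt_N; rewrite -[k.+1]add1n; apply: Wt_M => //; exact: ord_nc.
move=> /ordP H; apply/ordP => a ak; have := H a ak; rewrite cstM => /eqP.
by rewrite mulf_eq0 (negPf g0) => /eqP.
Qed.
Lemma fps_mulI g f f' : g m0 != 0 -> g * f = g * f' -> f = f'.
Proof.
move=> g0 /eqP; rewrite -subr_eq0 -mulrBr => /eqP /(fps_cancel g0) /eqP.
by rewrite subr_eq0 => /eqP.
Qed.

Lemma mulTE (t : multinom m -> K) f a : mulT t f a = t a * f a.
Proof. by rewrite mulT.unlock. Qed.
Lemma mulTB t f g : mulT t (f - g) = mulT t f - mulT t g.
Proof. by apply/fpsP => a; rewrite !(mulTE, fpsBE) mulrBr. Qed.
Lemma Wt_mulT w k t f : Wt w k f -> Wt w k (mulT t f).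
Proof. by move=> /WtP F; apply/WtP => a ak; rewrite mulTE F ?mulr0. Qed.

Lemma charge_mul (A : zmodType) (c : multinom m -> A) f g k l :
  (forall a b, c (a +m b) = c a + c b) ->
  (forall a, c a != k -> f a = 0) -> (forall a, c a = l -> g a = 0) ->
  forall a, c a = k + l -> (f * g) a = 0.
Proof.
move=> cD fk gl a ca; rewrite (fpsME _ _ (ltnSn (mdeg a))).
apply: big1 => -[b1 b2] /= /eqP ab.
have [cb|cb] := eqVneq (c b1) k; last by rewrite fk // mul0r.
by rewrite gl ?mulr0 //; move: ca; rewrite (congr1 c ab) cD cb => /addrI.
Qed.
End Util.

Section UtilR.
Variable R : realType.

Lemma nrm_mulT m (r C : R) N t (f : fps (CC R) m) : 0 <= r -> 0 <= C ->
  (forall a, normc (t a) <= C) -> nrm r N (mulT t f) <= C * nrm r N f.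
Proof.
move=> r0 C0 tC; apply: nrm_dom => // a; rewrite mulTE normcM.
by apply: ler_wpM2r => //; exact: normc_ge0.
Qed.

Lemma small_radius (a b : R) : 0 <= a -> 0 <= b ->
  exists r : R, [/\ 0 < r, a * r <= 1 & b * r <= 1].
Proof.
move=> a0 b0; exists (a + b + 1)^-1; have p : 0 < a + b + 1 by lra.
by split; rewrite ?invr_gt0 // ler_pdivrMr //; lra.
Qed.

Lemma normc_int (k : int) : normc (k%:~R : CC R) = `|k%:~R|.
Proof.
case: k => n; last first.
  by rewrite NegzE mulrNz normcN normrN -!pmulrn ger0_norm // normcMn normc1.
by rewrite -!pmulrn ger0_norm // normcMn normc1.
Qed.

Lemma normcB_ge (x y : CC R) : normc x - normc y <= normc (x - y).
Proof. by rewrite lerBlDr -{1}(subrK y x) le_normcD. Qed.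

Lemma divisor_bound (l mu : CC R) : l != 0 ->
  exists2 C : R, 0 <= C & forall k : int, (1 + `|k%:~R|) * normc (k%:~R * l - mu)^-1 <= C.
Proof.
move=> l0; have nl : 0 < normc l.
  by rewrite lt_def normc_ge0 andbT; apply: contra l0 => /eqP/eq0_normc ->.
pose B := Num.truncn (2 * normc mu / normc l + 1).
pose F (k : int) := (1 + `|k%:~R|) * normc (k%:~R * l - mu)^-1.
have F0 k : 0 <= F k by rewrite mulr_ge0 ?addr_ge0 ?normc_ge0.
have S0 : 0 <= \sum_(i < B.+1) (F i%:Z + F (- i%:Z)) by apply: sumr_ge0 => i _; rewrite addr_ge0.
exists (4 / normc l + \sum_(i < B.+1) (F i%:Z + F (- i%:Z))).
  by rewrite addr_ge0 // divr_ge0 // ltW.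
move=> k; have [kB|kB] := ltnP (absz k) B.+1.
  apply: (@le_trans _ _ (\sum_(i < B.+1) (F i%:Z + F (- i%:Z)))); last first.
    by rewrite lerDr divr_ge0 // ltW.
  rewrite (bigD1 (Ordinal kB)) //= -/(F k); apply: (@le_trans _ _ (F (absz k) + F (- (absz k)%:Z))).
    have [k0|k0] := leP 0 k; first by rewrite gez0_abs // lerDl.
    by rewrite ltz0_abs // opprK lerDr.
  by rewrite lerDl; apply: sumr_ge0 => i _; rewrite addr_ge0.
rewrite ler_wpDr // normcV.
have kR : 2 * normc mu / normc l + 1 < `|k%:~R|.
  have b0 : 0 <= 2 * normc mu / normc l + 1 by rewrite addr_ge0 // divr_ge0 ?mulr_ge0 ?normc_ge0.
  have /andP[_] := truncn_itv b0 => /lt_le_trans; apply.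
  by rewrite -intr_norm -abszE -pmulrn ler_nat.
have mk : 2 * normc mu + normc l <= `|k%:~R| * normc l.
  by move: (ltW kR); rewrite -(ler_pM2r nl) mulrDl mul1r divfK // gt_eqF.
have low := normcB_ge (k%:~R * l) mu; rewrite normcM normc_int in low.
have mu0 := normc_ge0 mu.
have k1 : 1 <= `|k%:~R : R|.
  by apply: ltW; apply: le_lt_trans kR; rewrite lerDr divr_ge0 ?mulr_ge0 ?normc_ge0.
have pos : 0 < normc (k%:~R * l - mu) by lra.
rewrite ler_pdivrMr // mulrAC ler_pdivlMr //.
nra.
Qed.

End UtilR.

(** * The invariant plane *)

Definition e2 (a : multinom 2) : int := (a ord0)%:Z - (a ord_max)%:Z.
HB.lock Definition Lop (K : numFieldType) (f : fps K 2) : fps K 2 :=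
  X K ord0 * D ord0 f - X K ord_max * D ord_max f.
(* X0 * dsh g is the part of g of charge 1. *)
HB.lock Definition dsh (K : numFieldType) (g : fps K 2) : fps K 2 :=
  Fps (fun a => if e2 a == 0 then g (a +m U ord0) else 0).

Section Two.
Variable K : numFieldType.
Local Notation E := (fps K 2).
Local Notation X0 := (X K (ord0 : 'I_2)).
Local Notation X1 := (X K (ord_max : 'I_2)).
Implicit Types (f g : E) (a b : multinom 2).

Lemma LopE f : Lop f = X0 * D ord0 f - X1 * D ord_max f.
Proof. by rewrite Lop.unlock. Qed.
Lemma Lopc f a : Lop f a = (e2 a)%:~R * f a.
Proof. by rewrite LopE fpsBE !XDE -mulrBl /e2 rmorphB. Qed.
Lemma LopD f g : Lop (f + g) = Lop f + Lop g.
Proof. by apply/fpsP => a; rewrite !(Lopc, fpsDE) mulrDr. Qed.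
Lemma LopM f g : Lop (f * g) = Lop f * g + f * Lop g.
Proof. by rewrite !LopE !DM; ring. Qed.
Lemma Lop0 : Lop (0 : E) = 0.
Proof. by apply/fpsP => a; rewrite Lopc fps0E mulr0. Qed.
Lemma Lop_X0 : Lop X0 = X0.
Proof. by rewrite LopE !D_X /=; ring. Qed.
Lemma Lop_X1 : Lop X1 = - X1.
Proof. by rewrite LopE !D_X /=; ring. Qed.
Lemma Lop_comp m (u : 'I_m -> E) (f : fps K m) :
  Lop (comp u f) = \sum_i comp u (D i f) * Lop (u i).
Proof.
rewrite LopE !chain !mulr_sumr -sumrB; apply: eq_bigr => i _.
by rewrite LopE; ring.
Qed.
Lemma e2D a b : e2 (a +m b) = e2 a + e2 b.
Proof. by rewrite /e2 !mnmDE; lia. Qed.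
Lemma e2_0 : e2 m0 = 0.
Proof. by rewrite /e2 !mnm0E. Qed.
Lemma Lop_eq0 f : Lop f = 0 -> forall a, e2 a != 0 -> f a = 0.
Proof.
move=> Lf a ea; have := congr1 (fun g : E => g a) Lf; rewrite Lopc fps0E => /eqP.
by rewrite mulf_eq0 intr_eq0 (negPf ea) => /eqP.
Qed.
Lemma Lop_diag f : (forall a, e2 a != 0 -> f a = 0) -> Lop f = 0.
Proof.
move=> H; apply/fpsP => a; rewrite Lopc fps0E.
by have [->|/H ->] := eqVneq (e2 a) 0; rewrite ?mul0r ?mulr0.
Qed.

Lemma dshE g a : dsh g a = if e2 a == 0 then g (a +m U ord0) else 0.
Proof. by rewrite dsh.unlock. Qed.
Lemma Wt_dsh k g : ord k.+1 g -> ord k (dsh g).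
Proof.
move=> /ordP G; apply/ordP => a ak; rewrite dshE; case: ifP => // _.
by apply: G; rewrite mdegD mdeg1 addn1 ltnS.
Qed.
Lemma dshB f g : dsh f - dsh g = dsh (f - g).
Proof. by apply/fpsP => a; rewrite !(dshE, fpsBE); case: ifP; rewrite ?subr0. Qed.
Lemma X0_dsh g a : e2 a = 1 -> (X0 * dsh g) a = g a.
Proof.
move=> ea; have [|b ab] := @mnm_subU 2 ord0 a; first by move: ea; rewrite /e2; case: (a ord0) => //; lia.
rewrite ab XMU dshE; have -> : e2 b = 0 by move: ea; rewrite ab e2D /e2 !mnm1E /=; lia.
by rewrite eqxx.
Qed.
Lemma X0_dsh0 g a : e2 a != 1 -> (X0 * dsh g) a = 0.
Proof.
move=> ea; have [a0|a0] := eqVneq (a ord0) 0%N; first by rewrite XM0.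
have [b ab] := mnm_subU a0; rewrite ab XMU dshE; case: eqP => // eb.
by move: ea; rewrite ab e2D eb /e2 !mnm1E /=.
Qed.
Lemma dsh_diag g a : e2 a != 0 -> dsh g a = 0.
Proof. by rewrite dshE => /negPf ->. Qed.

End Two.

Section Plane.
Variables (R : realType) (n : nat) (lam : 'I_n.+1 -> CC R).
Local Notation K := (CC R).
Local Notation m := (n.+1 + n.+1)%N.
Local Notation X0 := (X K (ord0 : 'I_2)).
Local Notation X1 := (X K (ord_max : 'I_2)).
Local Notation x1 := (xi (ord0 : 'I_n.+1)).
Local Notation y1 := (yi (ord0 : 'I_n.+1)).

Definition H0f : fps K m := \sum_(j < n.+1) cst m (lam j) * (X K (xi j) * X K (yi j)).
Definition mu : 'I_m -> K := dblk lam (fun j => - lam j).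
Definition base : 'I_m -> fps K 2 :=
  dblk (fun j => if j == ord0 then X0 else 0) (fun j => if j == ord0 then X1 else 0).
Definition XH (H : fps K m) : 'I_m -> fps K m :=
  dblk (fun j => D (yi j) H) (fun j => - D (xi j) H).

Lemma D_H0_y j : D (yi j) H0f = cst m (lam j) * X K (xi j).
Proof.
rewrite /H0f raddf_sum (bigD1 j) //= big1 ?addr0 => [|k kj].
  by rewrite !DM D_cst !D_X yi_xi eqxx /=; ring.
by rewrite !DM D_cst !D_X yi_xi yi_eq (eq_sym j k) (negPf kj) /=; ring.
Qed.
Lemma D_H0_x j : D (xi j) H0f = cst m (lam j) * X K (yi j).
Proof.
rewrite /H0f raddf_sum (bigD1 j) //= big1 ?addr0 => [|k kj].
  by rewrite !DM D_cst !D_X xi_yi eqxx /=; ring.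
by rewrite !DM D_cst !D_X xi_yi xi_eq (eq_sym j k) (negPf kj) /=; ring.
Qed.
Lemma XH_lin H i : ord 3 (H - H0f) -> ord 2 (XH H i - cst m (mu i) * X K i).
Proof.
move=> H3; have dH k : ord 2 (D k (H - H0f)) by apply: ord_D.
elim/xy_ind: i => j; rewrite /XH /mu ?dblk_x ?dblk_y.
  by rewrite -D_H0_y -DB.
rewrite rmorphN /= mulNr opprK addrC -D_H0_x -opprB -DB; apply: Wt_N; exact: dH.
Qed.
Lemma base0 i : base i m0 = 0.
Proof.
by elim/xy_ind: i => j; rewrite /base ?dblk_x ?dblk_y; case: ifP; rewrite ?X_m0 ?fps0E.
Qed.

Hypotheses (lam1_neq0 : lam ord0 != 0)
  (nonres1 : forall (k : int) (nu : 'I_n.+1), nu != ord0 -> lam nu - k%:~R * lam ord0 != 0).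
Variable H : fps K m.
Hypotheses (H3 : ord 3 (H - H0f)) (cH : conv H).

Let N i : fps K m := XH H i - cst m (mu i) * X K i.
(* On a resonant monomial the divisor vanishes, and so does its inverse. *)
Let tau i (a : multinom 2) : K := ((e2 a)%:~R * lam ord0 - mu i)^-1.
Let lt i (a : multinom 2) : K := (e2 a)%:~R * tau i a.
Let un (f : 'I_m -> fps K 2) i : fps K 2 := base i + mulT (tau i) (f i).
(* The invariance equation w * Lop (u i) = XH H i o u is solved with w = lam_1 + a, where X0 * a
   is the resonant part of the x_1 component; f = Phi f is its nonresonant part. *)
Let Phi (f : 'I_m -> fps K 2) i : fps K 2 :=
  comp (un f) (N i) - dsh (comp (un f) (N x1)) * mulT (lt i) (f i).

Let N2 i : ord 2 (N i). Proof. exact: XH_lin. Qed.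
Let cN i : conv (N i).
Proof.
apply: conv_B; last by apply: conv_M; [exact: conv_cst | exact: conv_X].
elim/xy_ind: i => j; rewrite /XH ?dblk_x ?dblk_y; [|apply: conv_N]; exact: conv_Dx.
Qed.

Let causal k f g : (forall i, ord k (f i - g i)) -> forall i, ord k.+1 (Phi f i - Phi g i).
Proof.
move=> fg i.
have ufg j : ord k (un f j - un g j).
  by rewrite opprD addrACA subrr add0r -mulTB; apply: Wt_mulT.
have cfg j : ord k.+1 (comp (un f) (N j) - comp (un g) (N j)).
  by rewrite -[k.+1]addn1; apply: (comp_causal ufg (N2 j)).
have o1 (h : 'I_m -> fps K 2) : ord 1 (dsh (comp (un h) (N x1))).
  by apply: Wt_dsh; rewrite -comp_nc; apply: (comp_Wt (w := fun _ => 1%N)) (N2 x1) => j; exact: ord_nc.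
have o2 (h : fps K 2) : ord 1 (mulT (lt i) h).
  apply/ordP => a; rewrite ltnS leqn0 mdeg_eq0 => /eqP ->.
  by rewrite mulTE /lt e2_0 !mul0r.
have -> : Phi f i - Phi g i = comp (un f) (N i) - comp (un g) (N i) -
  (mulT (lt i) (f i) * dsh (comp (un f) (N x1)) - mulT (lt i) (g i) * dsh (comp (un g) (N x1))).
  by rewrite /Phi; ring.
apply: Wt_B => //.
have -> : k.+1 = (minn k k).+1 by rewrite minnn.
apply: ord_mulB => //.
  by rewrite -mulTB; apply: Wt_mulT.
by rewrite dshB; apply: Wt_dsh.
Qed.

Let tau_bound : exists2 C : R, 0 <= C & forall i a, normc (tau i a) <= C /\ normc (lt i a) <= C.
Proof.
pose c i := projT1 (cid2 (divisor_bound (mu i) lam1_neq0)).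
have c0 i : 0 <= c i by exact: (proj1 (projT2 (cid2 (divisor_bound (mu i) lam1_neq0)))).
have Hc i (k : int) : (1 + `|k%:~R|) * normc (k%:~R * lam ord0 - mu i)^-1 <= c i.
  by move: k; exact: (proj2 (projT2 (cid2 (divisor_bound (mu i) lam1_neq0)))).
exists (\sum_i c i); first exact: sumr_ge0.
move=> i a; have ci : c i <= \sum_i c i by rewrite (bigD1 i) //= lerDl; apply: sumr_ge0.
have := Hc i (e2 a); rewrite -/(tau i a) /lt normcM normc_int.
have := normc_ge0 (tau i a); have : 0 <= `|(e2 a)%:~R : R| by [].
by move=> e0 t0; rewrite mulrDl mul1r => Hh; split; nra.
Qed.

Lemma plane_fixed : exists f : 'I_m -> fps K 2,
  (forall i, Phi f i = f i) /\ forall i, conv (mulT (tau i) (f i)).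
Proof.
have [R0 [M [R00 M0 NM]]] := conv_fam cN.
have [C C0 tC] := tau_bound.
pose k := 1 + C; pose A := k ^+ 2 * M * (1 + C) / R0 ^+ 2.
have k0 : 0 < k by rewrite /k; lra.
have A0 : 0 <= A by rewrite /A divr_ge0 ?exprn_ge0 ?mulr_ge0 ?exprn_ge0 // ltW // ; lra.
have [r [r0 rA rk]] := small_radius A0 (ltW (divr_gt0 k0 R00)).
have kr0 : 0 < k * r by rewrite mulr_gt0.
have krR : k * r <= R0 by move: rk; rewrite mulrAC ler_pdivrMr // mul1r.
have [|f [fixf fr]] := fixed_point causal (ltW r0) (ltW r0); last first.
  exists f; split=> // i; apply: (@convP _ _ _ r (C * r)) => // N'.
  apply: le_trans (nrm_mulT _ _ (ltW r0) C0 (fun a => proj1 (tC i a))) _.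
  exact: ler_wpM2l.
move=> f fr i N'.
have ub j N2' : nrm r N2' (nc (un f j)) <= k * r.
  apply: le_trans (nrm_nc _ _ (ltW r0)) _; apply: le_trans (nrmD _ _ _ (ltW r0)) _.
  have := nrm_mulT N2' (f j) (ltW r0) C0 (fun a => proj1 (tC j a)).
  have : nrm r N2' (base j) <= r.
    elim/xy_ind: j => l; rewrite /base ?dblk_x ?dblk_y; case: ifP => _; rewrite ?nrm0 ?nrm_X //; exact: ltW.
  have := fr j N2'; rewrite /k; nra.
pose q := (k * r / R0) ^+ 2 * M.
have cb j N2' : nrm r N2' (comp (un f) (N j)) <= q.
  apply: (@le_trans _ _ (nrm (k * r) N2' (N j))).
    by apply: nrm_comp; [exact: ltW | exact: ltW |].
  apply: le_trans (nrm_radius _ (ltW kr0) krR R00 (N2 j)) _.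
  by apply: ler_wpM2l => //; apply/exprn_ge0/divr_ge0; exact: ltW.
have q0 : 0 <= q by apply: mulr_ge0 => //; apply/exprn_ge0/divr_ge0; exact: ltW.
have db : nrm r N' (dsh (comp (un f) (N x1))) <= q / r.
  rewrite ler_pdivlMr //; apply: le_trans (cb x1 N'.+1).
  rewrite -[leRHS]mul1r -[N'.+1]addn1 -[X in _ * X <= _]expr1.
  apply: (@nrm_inj R 2 2 r N' 1 _ _ 1 (fun a => a +m U ord0)) => //.
  - exact: ltW.
  - exact: addIm.
  - by move=> a; rewrite mdegD mdeg1.
  - by move=> a; rewrite mul1r dshE; case: ifP => // _; rewrite normc0 normc_ge0.
have lb : nrm r N' (mulT (lt i) (f i)) <= C * r.
  apply: le_trans (nrm_mulT _ _ (ltW r0) C0 (fun a => proj2 (tC i a))) _.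
  exact: ler_wpM2l.
apply: le_trans (nrmB _ _ _ (ltW r0)) _.
have := nrmM N' (dsh (comp (un f) (N x1))) (mulT (lt i) (f i)) (ltW r0).
have prod : nrm r N' (dsh (comp (un f) (N x1))) * nrm r N' (mulT (lt i) (f i)) <= q / r * (C * r).
  by apply: ler_pM => //; apply: nrm_ge0 (ltW r0).
have e1 : q / r * (C * r) = q * C by field; exact: lt0r_neq0.
have e3 : q * (1 + C) = A * r * r.
  by rewrite /q /A; field; exact: lt0r_neq0.
have := cb i N'; move: prod; rewrite e1 => prod cbi mle.
have : A * r * r <= r by rewrite ler_piMl // ltW.
rewrite -e3; lra.
Qed.

Lemma invariant_plane : exists (u : 'I_m -> fps K 2) (w : fps K 2),
  [/\ forall i, conv (u i), forall i, ord 2 (u i - base i), w m0 != 0,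
      Lop w = 0 /\ Lop (comp u H) = 0 & forall i, w * Lop (u i) = comp u (XH H i)].
Proof.
have [f [fixf cT]] := plane_fixed.
pose u := un f; pose a := dsh (comp u (N x1)); pose w := cst 2 (lam ord0) + a.
have lt0 h i : (mulT (lt i) h) m0 = 0 by rewrite mulTE /lt e2_0 !mul0r.
have oN i : ord 2 (comp u (N i)).
  by rewrite -comp_nc; apply: (comp_Wt (w := fun _ => 1%N)) (N2 i) => j; exact: ord_nc.
have oa : ord 1 a by exact: Wt_dsh.
have f2 i : ord 2 (f i).
  rewrite -fixf; apply: Wt_B => //; apply: (@Wt_M _ _ _ 1 1) => //.
  by rewrite -[mulT _ _]nc_id //; exact: ord_nc.
have T2 i : ord 2 (mulT (tau i) (f i)) by exact: Wt_mulT.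
have u2 i : ord 2 (u i - base i) by rewrite /u /un addrC addKr.
have u0 i : u i m0 = 0 by rewrite /u /un fpsDE base0 (ord_coef0 (T2 i)) addr0.
have w0 : w m0 = lam ord0 by rewrite fpsDE cstE eqxx mulr1 (ord_coef0 oa) addr0.
have LT i : Lop (mulT (tau i) (f i)) = mulT (lt i) (f i).
  by apply/fpsP => b; rewrite Lopc !mulTE mulrA.
have XHc i : comp u (XH H i) = comp u (N i) + cst 2 (mu i) * u i.
  by rewrite -[XH H i](subrK (cst m (mu i) * X K i)) compD compM comp_cst comp_X nc_id.
pose Rf i : fps K 2 := Fps (fun b => if (e2 b)%:~R * lam ord0 == mu i then f i b else 0).
have RfE i : cst 2 (lam ord0) * mulT (lt i) (f i) - cst 2 (mu i) * mulT (tau i) (f i) = f i - Rf i.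
  apply/fpsP => b; rewrite !fpsBE !cstM !mulTE /Rf /lt /tau /=.
  have [->|ne] := eqVneq ((e2 b)%:~R * lam ord0) (mu i).
    by rewrite !subrr invr0 !(mul0r, mulr0) subrr.
  rewrite subr0; move: ne; rewrite -subr_eq0; move: ((e2 b)%:~R : K) => e ne; by field.
have Lbase i : cst 2 (lam ord0) * Lop (base i) = cst 2 (mu i) * base i.
  elim/xy_ind: i => j; rewrite /base /mu ?dblk_x ?dblk_y; case: eqP => [->|_].
  - by rewrite Lop_X0.
  - by rewrite Lop0 !mulr0.
  - by rewrite Lop_X1 rmorphN mulrN mulNr.
  - by rewrite Lop0 !mulr0.
(* The defect Er is supported on the y_1 component. Since H o u is a first integral, it vanishes. *)
pose Er i := a * Lop (base i) - Rf i.
have main i : w * Lop (u i) = comp u (XH H i) + Er i.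
  have fE : f i = comp u (N i) - a * mulT (lt i) (f i) by rewrite -{1}fixf.
  rewrite XHc /Er /w /u /un LopD LT -/u.
  move: (RfE i) (Lbase i) fE.
  set t := mulT (lt i) (f i); set s := mulT (tau i) (f i); set c := cst 2 (lam ord0).
  set d := cst 2 (mu i); set b := base i; set Lb := Lop b; set nn := comp u (N i).
  clearbody t s c d b Lb nn; set R' := Rf i; set f' := f i; clearbody R' f' => E1 E2 E3.
  have -> : (c + a) * (Lb + t) = c * Lb + (c * t - d * s) + d * s + a * Lb + a * t by ring.
  by rewrite E1 E2 {1}E3; ring.
have aE b : e2 b != 0 -> a b = 0 by exact: dsh_diag.
have l1e (b : multinom 2) (k : int) : ((e2 b)%:~R * lam ord0 == k%:~R * lam ord0) = (e2 b == k).
  rewrite -subr_eq0 -mulrBl mulf_eq0 (negPf lam1_neq0) orbF -rmorphB /= intr_eq0.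
  by rewrite subr_eq0.
have Rf0 i b : (e2 b)%:~R * lam ord0 != mu i -> Rf i b = 0 by rewrite /Rf /= => /negPf ->.
have Er0 j : j != ord0 -> Er (xi j) = 0 /\ Er (yi j) = 0.
  move=> j0; have r0 k : k%:~R * lam ord0 != lam j.
    by rewrite eq_sym -subr_eq0; exact: nonres1.
  split; rewrite /Er /base ?dblk_x ?dblk_y (negPf j0) Lop0 mulr0 sub0r; apply/eqP;
    rewrite oppr_eq0; apply/eqP/fpsP => b; rewrite fps0E Rf0 // /mu ?dblk_x ?dblk_y //.
  by have := r0 (- e2 b); rewrite rmorphN mulNr -eqr_oppLR.
have lt_res i b k : k%:~R * lam ord0 = mu i -> e2 b = k -> (mulT (lt i) (f i)) b = 0.
  by move=> ki bk; rewrite mulTE /lt /tau bk ki subrr invr0 mulr0 mul0r.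
have mux : mu x1 = 1%:~R * lam ord0 by rewrite /mu dblk_x mul1r.
have muy : mu y1 = (-1)%:~R * lam ord0 by rewrite /mu dblk_y rmorphN mulN1r.
have Ex : Er x1 = 0.
  apply/fpsP => b; rewrite /Er /base dblk_x eqxx Lop_X0 mulrC fpsBE fps0E.
  have [b1|b1] := eqVneq (e2 b) 1; last first.
    by rewrite X0_dsh0 // Rf0 ?subr0 // mux l1e.
  rewrite X0_dsh // /Rf /= mux l1e b1 eqxx -{1}fixf /Phi fpsBE -/u -/a.
  rewrite (@charge_mul _ _ _ e2 a _ 0 1 e2D aE) ?subr0 ?subrr ?add0r //.
  by move=> b' b'1; apply: (lt_res _ _ 1) => //; rewrite mux.
have Ey b : e2 b != -1 -> Er y1 b = 0.
  move=> b1; rewrite /Er /base dblk_y eqxx Lop_X1 mulrN fpsBE fpsNE.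
  rewrite Rf0 ?muy ?l1e // subr0 (@charge_mul _ _ _ e2 a _ 0 (e2 b) e2D aE) ?oppr0 ?add0r //.
  move=> b' b'E; rewrite XE; case: eqP => // ub; move: b1; rewrite -b'E -ub.
  by rewrite /e2 !mnm1E.
have wL : w * Lop (comp u H) = comp u (D y1 H) * Er y1.
  rewrite Lop_comp mulr_sumr big_xy (bigD1 ord0) //= [X in _ + X](bigD1 ord0) //=.
  have E i : w * (comp u (D i H) * Lop (u i)) = comp u (D i H) * (comp u (XH H i) + Er i).
    by rewrite -main; ring.
  rewrite !E Ex.
  set A := \sum_(i < _ | _) _; set B := \sum_(i < _ | _) _.
  have AB : A + B = 0.
    rewrite /A /B -big_split big1 //= => j j0; have [e1 e3] := Er0 j j0.
    by rewrite !E e1 e3 /XH dblk_x dblk_y raddfN /=; ring.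
  rewrite /XH dblk_x dblk_y raddfN /= !addr0 addrACA AB; ring.
have Hy : comp u (D y1 H) = w * Lop (u x1).
  by rewrite main Ex addr0 /XH dblk_x.
have Lh : Lop (comp u H) = Lop (u x1) * Er y1.
  by apply: (@fps_mulI _ _ w); rewrite ?w0 // wL Hy mulrA.
have Lux : Lop (u x1) = X0 + mulT (lt x1) (f x1).
  by rewrite /u /un LopD LT /base dblk_x eqxx Lop_X0.
have Ey0 : Er y1 = 0.
  apply: (@XM_eq0 _ _ ord0); apply/fpsP => b; rewrite fps0E mulrC.
  have [b0|b0] := eqVneq (e2 b) 0; last first.
    apply: (@charge_mul _ _ _ e2 _ _ (-1) (e2 b + 1) e2D Ey); last lia.
    move=> b' b'E; rewrite XE; case: eqP => // ub.
    by move: b'E b0; rewrite -ub /e2 !mnm1E /= => /eqP; lia.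
  have LE0 : (mulT (lt x1) (f x1) * Er y1) b = 0.
    rewrite mulrC; apply: (@charge_mul _ _ _ e2 _ _ (-1) 1 e2D Ey) => //.
    by move=> b' b'1; apply: (lt_res _ _ 1) => //; rewrite mux.
  have := congr1 (fun h : fps K 2 => h b) Lh.
  by rewrite Lopc b0 mul0r Lux mulrDl fpsDE LE0 addr0 mulrC.
have Eall i : Er i = 0.
  by elim/xy_ind: i => j; have [->|/Er0 []] := eqVneq j ord0.
exists u, w; split=> //.
- move=> i; apply: conv_D => //; elim/xy_ind: i => j; rewrite /base ?dblk_x ?dblk_y;
    case: ifP => _; (exact: conv_X || exact: conv_0).
- by rewrite w0.
- split; last by rewrite Lh Ey0 mulr0.
  apply: Lop_diag => b b0; rewrite /w fpsDE aE // addr0 cstE.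
  by case: eqP => [bE|_]; rewrite ?mulr0 //; move: b0; rewrite bE e2_0.
- by move=> i; rewrite main Eall addr0.
Qed.

End Plane.

(** * Straightening the invariant plane *)

Section More.
Variables (R : realType).
Local Notation K := (CC R).

Lemma mul_m0 m (f g : fps K m) : (f * g) m0 = f m0 * g m0.
Proof.
have : ord 1 (nc f * g + cst m (f m0) * nc g).
  by apply: Wt_D; [apply: Wt_Ml | apply: Wt_Mr]; exact: ord_nc.
move=> /ord_coef0; have -> : nc f * g + cst m (f m0) * nc g = f * g - cst m (f m0) * cst m (g m0).
  by rewrite /nc; ring.
by rewrite -rmorphM fpsBE cstE eqxx mulr1 => /eqP; rewrite subr_eq0 => /eqP.
Qed.

(* The primitive is the Euler average of the closed form sum_i g_i dX_i. *)
Lemma poincare m (g : 'I_m -> fps K m) k : (forall i, conv (g i)) -> (forall i, ord k (g i)) ->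
  (forall i j, D j (g i) = D i (g j)) ->
  exists W, [/\ conv W, ord k.+1 W & forall i, D i W = g i].
Proof.
move=> cg gk gD; pose P := \sum_i X K i * g i.
exists (mulT (fun a => (mdeg a)%:R^-1) P); split.
- apply: (@conv_dom _ _ P _ 1) => // [a|].
    rewrite mul1r mulTE normcM; apply: ler_piMl; first exact: normc_ge0.
    case: (mdeg a) => [|l]; first by rewrite invr0 normc0.
    rewrite normcV invf_le1 //; first by rewrite normcMn normc1 ler1n.
    by rewrite normcMn normc1 ltr0n.
  by apply: conv_sum => i _; apply: conv_M => //; exact: conv_X.
- apply/Wt_mulT/Wt_sum => i _; rewrite -[k.+1]add1n; apply: Wt_M => //.
  exact: (Wt_X K (fun _ => 1%N) i).
- move=> i; apply/fpsP => a; rewrite DE mulTE mdegD mdeg1 addn1.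
  rewrite -mulrnAr -DE /P raddf_sum /=.
  have -> : \sum_j D i (X K j * g j) = g i + \sum_j X K j * D j (g i).
    rewrite (eq_bigr (fun j => D i (X K j) * g j + X K j * D j (g i))) => [|j _]; last first.
      by rewrite DM gD.
    rewrite big_split /= (bigD1 i) //= D_X eqxx mul1r big1 ?addr0 // => j ji.
    by rewrite D_X eq_sym (negPf ji) mul0r.
  rewrite fpsDE fps_sumE (eq_bigr (fun j => (a j)%:R * g i a)) => [|j _]; last by rewrite XDE.
  rewrite -mulr_suml -natr_sum -mdegE.
  have -> : g i a + (mdeg a)%:R * g i a = (mdeg a).+1%:R * g i a.
    by rewrite -addn1 natrD mulrDl mul1r addrC.
  by rewrite mulrA mulVf ?mul1r // pnatr_eq0.
Qed.

Lemma ord_X m (i : 'I_m) : ord 1 (X K i).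
Proof. exact: (Wt_X K (fun _ => 1%N) i). Qed.
Lemma ord_m0 m (f g : fps K m) k : ord k.+1 (f - g) -> f m0 = g m0.
Proof. by move=> /ord_coef0 /eqP; rewrite fpsBE subr_eq0 => /eqP. Qed.

End More.

Section Straight.
Variables (R : realType) (n : nat) (lam : 'I_n.+1 -> CC R).
Local Notation K := (CC R).
Local Notation m := (n.+1 + n.+1)%N.
Local Notation o0 := (ord0 : 'I_2).
Local Notation o1 := (ord_max : 'I_2).
Local Notation X0 := (X K o0).
Local Notation X1 := (X K o1).
Local Notation x1 := (xi (ord0 : 'I_n.+1)).
Local Notation y1 := (yi (ord0 : 'I_n.+1)).
Local Notation base := (@base R n).

Definition tw : 'I_m -> nat := dblk (fun j : 'I_n.+1 => (j != ord0) : nat) (fun j => (j != ord0) : nat).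

Definition pair2 (A : Type) (f g : A) (i : 'I_2) : A := if i == ord0 then f else g.
Lemma pair2_ind (P : 'I_2 -> Prop) : P o0 -> P o1 -> forall i, P i.
Proof.
move=> P0 P1 i; have [->//|i0] := eqVneq i ord0.
by have -> : i = o1 by apply/val_inj; move: i0; rewrite -val_eqE /=; case: i => -[|[|]].
Qed.
Lemma big2 (F : 'I_2 -> fps K 2) : \sum_i F i = F o0 + F o1.
Proof. by rewrite big_ord_recl big_ord1; congr (_ + F _); apply: val_inj. Qed.

Definition emb : 'I_2 -> fps K m := pair2 (X K x1) (X K y1).

Lemma emb_m0 i : emb i m0 = 0.
Proof. by elim/pair2_ind: i; rewrite /emb /pair2 /= X_m0. Qed.

Lemma D_emb i g : D i (comp emb g) = (i == x1)%:R * comp emb (D o0 g) + (i == y1)%:R * comp emb (D o1 g).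
Proof.
rewrite chain big_ord_recl big_ord1 /emb /pair2 /= !D_X.
by rewrite (_ : lift ord0 ord0 = o1) 1?mulrC 1?[X in _ + X]mulrC //; apply: val_inj.
Qed.

Lemma comp_base_eq0 (F : fps K m) : comp base F = 0 -> forall a, wdeg tw a = 0%N -> F a = 0.
Proof.
move=> F0 a ta; pose pi i := comp emb (base i).
have piE : comp pi F = 0 by rewrite -comp_comp F0 comp0.
have : Wt tw (0 + 1) (comp pi F - comp (fun i => X K i) F).
  apply: (comp_Wt_diff (w := fun _ => 0%N)) => [i|i|i|]; try exact: Wt_0k.
  elim/xy_ind: i => j; rewrite /pi /base ?dblk_x ?dblk_y; case: eqP => [->|/eqP j0].
  - by rewrite comp_X0 ?emb_m0 // /emb /pair2 /= subrr; exact: Wt_0.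
  - rewrite comp0 sub0r; apply: Wt_N.
    by have := Wt_X K tw (xi j); rewrite /tw dblk_x j0.
  - by rewrite comp_X0 ?emb_m0 // /emb /pair2 /= subrr; exact: Wt_0.
  - rewrite comp0 sub0r; apply: Wt_N.
    by have := Wt_X K tw (yi j); rewrite /tw dblk_y j0.
rewrite piE comp_id sub0r => /WtP/(_ a); rewrite ta fpsNE => /(_ isT) /eqP.
by rewrite oppr_eq0 => /eqP.
Qed.

Lemma wdeg_tw1 a : wdeg tw a = 1%N ->
  exists i b, [/\ a = b +m U i, wdeg tw b = 0%N, i != x1 & i != y1].
Proof.
move=> ta; have [k] : exists i, (tw i * a i)%N != 0%N.
  apply/existsP; apply: contraTT isT => /existsPn H; move: ta; rewrite /wdeg big1 // => i _.
  by apply/eqP; have := H i; rewrite negbK.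
rewrite muln_eq0 negb_or => /andP[twi /mnm_subU [b ab]]; exists k, b; split => //.
- by move: ta twi; rewrite ab wdegD wdegU; lia.
- by apply: contraNneq twi => ->; rewrite /tw dblk_x eqxx.
- by apply: contraNneq twi => ->; rewrite /tw dblk_y eqxx.
Qed.

Lemma Om_X a b : (a == x1) || (a == y1) -> b != x1 -> b != y1 ->
  Om (fun i => D a (X K i)) (fun i => D b (X K i)) = 0 :> fps K m.
Proof.
move=> a1 bx yb; rewrite /Om big1 // => j _; rewrite !D_X.
have [->|j0] := eqVneq j ord0; first by rewrite (negPf bx) (negPf yb) !mulr0 subrr.
by case/orP: a1 => /eqP ->; rewrite ?xi_yi ?yi_xi ?xi_eq ?yi_eq (eq_sym _ j) (negPf j0) !mul0r subrr.
Qed.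

Variables (H : fps K m) (u : 'I_m -> fps K 2) (w : fps K 2).
Hypotheses (cu : forall i, conv (u i)) (u2 : forall i, ord 2 (u i - base i)).
Hypotheses (w0 : w m0 != 0) (Lw : Lop w = 0) (Lh : Lop (comp u H) = 0).
Hypothesis (ode : forall i, w * Lop (u i) = comp u (XH H i)).

Let u0 i : u i m0 = 0.
Proof. by rewrite (ord_m0 (u2 i)) base0. Qed.

Let ux2 j : j != ord0 -> ord 2 (u (xi j)) /\ ord 2 (u (yi j)).
Proof.
move=> j0; have := u2 (xi j); have := u2 (yi j).
by rewrite /base dblk_x dblk_y (negPf j0) !subr0.
Qed.
Let u2x : ord 2 (u x1 - X0). Proof. by have := u2 x1; rewrite /base dblk_x eqxx. Qed.
Let u2y : ord 2 (u y1 - X1). Proof. by have := u2 y1; rewrite /base dblk_y eqxx. Qed.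

(* The flow preserves the symplectic form f dX0 /\ dX1 pulled back to the plane, so f is a series
   in X0 * X1 and the plane has canonical coordinates (G, X1) with G = X0 * g. *)
Let f := Om (fun i => D o0 (u i)) (fun i => D o1 (u i)).

Let OmMl (g : fps K 2) (p q : 'I_m -> fps K 2) : g * Om p q = Om (fun i => g * p i) q.
Proof. by rewrite /Om mulr_sumr; apply: eq_bigr => j _; ring. Qed.
Let OmBl (p p' q : 'I_m -> fps K 2) : Om (fun i => p i - p' i) q = Om p q - Om p' q.
Proof. by rewrite /Om -sumrB; apply: eq_bigr => j _ /=; ring. Qed.
Let Om_diag (p : 'I_m -> fps K 2) : Om p p = 0.
Proof. by rewrite /Om big1 // => j _; ring. Qed.

Lemma Om_ode (q : 'I_m -> fps K 2) : w * Om (fun i => Lop (u i)) q = \sum_i comp u (D i H) * q i.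
Proof.
rewrite OmMl /Om big_xy -big_split; apply: eq_bigr => j _ /=.
by rewrite !ode /XH dblk_x dblk_y raddfN /=; ring.
Qed.

Let wXf : w * (X0 * f) = D o1 (comp u H).
Proof.
rewrite chain -Om_ode; congr (_ * _); rewrite /f OmMl.
rewrite [RHS](_ : _ = Om (fun i => X0 * D o0 (u i) - X1 * D o1 (u i)) (fun i => D o1 (u i))); last first.
  by apply: eq_bigr => j _; rewrite !LopE.
by rewrite OmBl -[X in _ = _ - X]OmMl Om_diag mulr0 subr0.
Qed.

Let Lf : Lop f = 0.
Proof.
apply: (@XM_eq0 _ _ o0); apply: (fps_cancel w0).
have : Lop (D o1 (comp u H)) = D o1 (comp u H).
  apply/fpsP => a; rewrite Lopc DE; have [a1|a1] := eqVneq (e2 a) 1; first by rewrite a1 mul1r.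
  rewrite (Lop_eq0 Lh) ?mul0rn ?mulr0 //; rewrite e2D; apply: contra a1.
  by rewrite {2}/e2 !mnm1E /=; lia.
rewrite -wXf !LopM Lw Lop_X0 mul0r add0r mulrDr => /eqP.
by rewrite -subr_eq0 addrC addKr => /eqP.
Qed.

Let f0 : f m0 = 1.
Proof.
have Du k i : (D k (u i)) m0 = (D k (base i)) m0.
  by apply: (@ord_m0 _ _ _ _ 0); rewrite -DB; apply: ord_D.
rewrite /f /Om fps_sumE (bigD1 ord0) //= big1 ?addr0 => [|j j0].
  rewrite fpsBE !mul_m0 !Du /base !dblk_x !dblk_y eqxx !D_X /= ?mulr1n ?mulr0n !fps1E !fps0E eqxx.
  rewrite /= mulr1n; ring.
by rewrite fpsBE !mul_m0 !Du /base !dblk_x !dblk_y (negPf j0) !D0 !fps0E mulr0 subrr.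
Qed.

Let cf : conv f.
Proof.
apply: conv_sum => j _; apply: conv_B; apply: conv_M; exact: conv_Dx.
Qed.

Let g := mulT (fun a : multinom 2 => (a o0).+1%:R^-1) f.
Let G := X0 * g.
Let D0G : D o0 G = f.
Proof.
apply/fpsP => a; rewrite DE XMU mulTE -[LHS]mulr_natl mulrA divff ?mul1r //.
Qed.
Let LG : Lop G = G.
Proof.
rewrite LopM Lop_X0; suff -> : Lop g = 0 by rewrite mulr0 addr0.
apply: Lop_diag => a /(Lop_eq0 Lf); rewrite mulTE => ->; exact: mulr0.
Qed.
Let cG : conv G.
Proof.
apply: conv_M; first exact: conv_X.
apply: (@conv_dom _ _ f _ 1) => // a; rewrite mul1r mulTE normcM.
apply: ler_piMl; first exact: normc_ge0.
rewrite normcV normcMn normc1 invf_le1 ?ler1n ?ltr0n //.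
Qed.
Let G2 : ord 2 (G - X0).
Proof.
have -> : G - X0 = X0 * (g - 1) by rewrite /G; ring.
apply: (@Wt_M _ _ _ 1 1); first exact: ord_X.
rewrite -[g - 1]nc_id; first exact: ord_nc.
by rewrite fpsBE fps1E eqxx mulTE f0 mnm0E invr1 mul1r subrr.
Qed.
Let G0 : G m0 = 0. Proof. by rewrite (ord_m0 G2) X_m0. Qed.

Let q := pair2 (u x1) X1.
Let q2 i : ord 2 (q i - X K i).
Proof. by elim/pair2_ind: i; rewrite /q /pair2 //= subrr; exact: Wt_0. Qed.
Let cq i : conv (q i).
Proof. by elim/pair2_ind: i; rewrite /q /pair2 //=; exact: conv_X. Qed.
Let rho := pair2 G X1.
Let rho2 i : ord 2 (rho i - X K i).
Proof. by elim/pair2_ind: i; rewrite /rho /pair2 //= subrr; exact: Wt_0. Qed.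
Let crho i : conv (rho i).
Proof. by elim/pair2_ind: i; rewrite /rho /pair2 //=; exact: conv_X. Qed.

Let sig : 'I_m -> fps K 2 :=
  dblk (fun j => if j == ord0 then G else 0) (fun j => if j == ord0 then X1 else 0).

Let comp_sig_eq0 (F : fps K m) : comp sig F = 0 -> comp base F = 0.
Proof.
have [ka [_ _ kr _]] := inverse rho2 crho; move=> sF.
have E : comp ka (comp rho (comp base F)) = comp base F.
  by rewrite comp_comp (eq_comp _ kr) comp_id.
rewrite -E; suff -> : comp rho (comp base F) = comp sig F by rewrite sF comp0.
rewrite comp_comp; apply: eq_comp => i.
elim/xy_ind: i => j; rewrite /base /sig ?dblk_x ?dblk_y; case: ifP => _; rewrite ?comp0 //.
  by rewrite comp_X0 // /rho /pair2.
by rewrite comp_X0 // /rho /pair2 /= X_m0.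
Qed.
Let straight_core : exists phi : 'I_m -> fps K m,
  [/\ forall i, conv (phi i), forall i, ord 2 (phi i - X K i), symplectic phi
    & forall i, comp sig (phi i) = u i].
Proof.
have [th [th2 cth thq qth]] := inverse q2 cq.
have th0 i : th i m0 = 0 by rewrite (ord_m0 (th2 i)) X_m0.
have q0 i : q i m0 = 0 by rewrite (ord_m0 (q2 i)) X_m0.
have th1 : th o1 = X1 by have := thq o1; rewrite /q /pair2 /= comp_X0.
pose V i := comp th (u i); pose Gt := comp th G.
have Vx1 : V x1 = X0 by have := thq o0; rewrite /q /pair2.
have cV i : conv (V i) by exact: conv_comp.
have qV i : comp q (V i) = u i by rewrite /V comp_comp (eq_comp _ qth) comp_id.
have qG : comp q Gt = G by rewrite /Gt comp_comp (eq_comp _ qth) comp_id.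
have V2 j : j != ord0 -> ord 2 (V (xi j)) /\ ord 2 (V (yi j)).
  by move=> /ux2 [] ? ?; split; apply: comp_ord.
have V2y : ord 2 (V y1 - X1).
  by have := comp_ord th u2y; rewrite compB comp_X0 // th1.
have Gt2 : ord 2 (Gt - X0).
  have -> : Gt - X0 = comp th (G - X0) + (th o0 - X0) by rewrite compB [comp th X0]comp_X0 // addrA subrK.
  by apply: Wt_D => //; apply: comp_ord.
have V0 i : V i m0 = 0 by rewrite /V comp_coef0.
have D0V i : D o0 (V i) = comp th (D o0 (u i)) * D o0 (th o0).
  by rewrite chain big2 th1 D_X mulr0 addr0.
have D1V i : D o1 (V i) = comp th (D o0 (u i)) * D o1 (th o0) + comp th (D o1 (u i)).
  by rewrite chain big2 th1 D_X eqxx mulr1.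
have D0Gt : D o0 Gt = comp th f * D o0 (th o0).
  by rewrite /Gt chain big2 th1 D_X mulr0 addr0 D0G.
have OmV : Om (fun i => D o0 (V i)) (fun i => D o1 (V i)) = D o0 Gt.
  rewrite D0Gt /Om /f /Om raddf_sum mulr_suml; apply: eq_bigr => j _ /=.
  by rewrite !D0V !D1V compB !compM; ring.
have cGt : conv Gt by exact: conv_comp.
clearbody V Gt.
(* The canonical map has a generating function affine in the transverse variables, whose
   restriction to the plane is a primitive of P dX0 + Q dX1. *)
pose P := V y1 - X1 + \sum_(j < n.+1 | j != ord0) V (yi j) * D o0 (V (xi j)).
pose Q := Gt - X0 + \sum_(j < n.+1 | j != ord0) V (yi j) * D o1 (V (xi j)).
have closed : D o1 P = D o0 Q.
  apply/eqP; rewrite -subr_eq0; apply/eqP.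
  have OmE : D o0 Gt = D o1 (V y1) + \sum_(j < n.+1 | j != ord0)
      (D o0 (V (xi j)) * D o1 (V (yi j)) - D o0 (V (yi j)) * D o1 (V (xi j))).
    by rewrite -OmV /Om (bigD1 ord0) //= Vx1 !D_X /=; ring.
  rewrite /P /Q !DD !DN OmE !D_X !eqxx !raddf_sum /=.
  set A := \sum_(j < n.+1 | _) D o1 _; set B := \sum_(j < n.+1 | _) D o0 _.
  set C := \sum_(j < n.+1 | _) _.
  have -> : A = B + C.
    rewrite /A /B /C -big_split; apply: eq_bigr => j _ /=.
    by rewrite !DM [D o1 (D o0 _)]DC; ring.
  by ring.
have oDV j k l : j != ord0 -> ord 2 (V (yi j) * D k (V (xi l))).
  by move=> /V2 [_ ?]; apply: Wt_Ml.
have cPQ (A : fps K 2) k : conv A ->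
    conv (A + \sum_(j < n.+1 | j != ord0) V (yi j) * D k (V (xi j))).
  move=> cA; apply: conv_D => //; apply: conv_sum => j _.
  by apply: conv_M => //; exact: conv_Dx.
have cP : conv P by apply/cPQ/conv_B => //; exact: conv_X.
have cQ : conv Q by apply/cPQ/conv_B => //; exact: conv_X.
have [W0 [cW0 W03 DW0]] : exists W, [/\ conv W, ord 3 W & forall i, D i W = pair2 P Q i].
  apply: (poincare (k := 2)).
  - by elim/pair2_ind.
  - by elim/pair2_ind; rewrite /pair2 /=; apply: Wt_D => //; apply: Wt_sum => j /oDV.
  - by elim/pair2_ind; elim/pair2_ind; rewrite /pair2 //=.
pose io := comp emb.
have io0 (h : fps K 2) : h m0 = 0 -> io h m0 = 0 by rewrite /io comp_coef0.
pose W := io W0 + \sum_(j < n.+1 | j != ord0)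
  (io (V (yi j)) * (X K (xi j) - io (V (xi j))) - io (V (xi j)) * X K (yi j)).
have cemb i : conv (emb i) by elim/pair2_ind: i; exact: conv_X.
have cio h : conv h -> conv (io h) by move=> ch; exact: conv_comp.
have cW : conv W.
  apply: conv_D; first exact: cio.
  apply: conv_sum => j _; apply: conv_B; apply: conv_M; try exact: cio; try exact: conv_X.
  by apply: conv_B; [exact: conv_X | exact: cio].
have W3 : ord 3 W.
  apply: Wt_D; first exact: comp_ord.
  apply: Wt_sum => j /V2 [Vx Vy]; apply: Wt_B.
    apply: (@Wt_M _ _ _ 2 1); first exact: comp_ord.
    apply: Wt_B; [exact: ord_X | apply: (@Wt_le _ _ _ _ 2) => //; exact: comp_ord].
  by apply: (@Wt_M _ _ _ 2 1); [exact: comp_ord | exact: ord_X].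
have Dx j : j != ord0 -> D (xi j) W = io (V (yi j)).
  move=> j0; rewrite /W DD D_emb xi_eq xi_yi (negPf j0) !mul0r !add0r raddf_sum (bigD1 j) //=.
  rewrite big1 ?addr0 => [|l /andP[l0 lj]]; rewrite DB !DM DB !D_X !D_emb;
    rewrite ?xi_eq ?xi_yi ?(negPf j0) ?eqxx ?(eq_sym j l) ?(negPf lj) /=; ring.
have Dy j : j != ord0 -> D (yi j) W = - io (V (xi j)).
  move=> j0; rewrite /W DD D_emb yi_eq yi_xi (negPf j0) !mul0r !add0r raddf_sum (bigD1 j) //=.
  rewrite big1 ?addr0 => [|l /andP[l0 lj]]; rewrite DB !DM DB !D_X !D_emb;
    rewrite ?yi_eq ?yi_xi ?(negPf j0) ?eqxx ?(eq_sym j l) ?(negPf lj) /=; ring.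
have Dx1 : D x1 W = io (V y1 - X1) + \sum_(j < n.+1 | j != ord0)
   (io (D o0 (V (yi j))) * (X K (xi j) - io (V (xi j))) - io (D o0 (V (xi j))) * X K (yi j)).
  rewrite /W DD D_emb eqxx xi_yi mul1r mul0r addr0 DW0 /pair2 /= /P compD -addrA; congr (_ + _).
  rewrite !raddf_sum -big_split; apply: eq_bigr => j j0 /=.
  rewrite DB !DM DB !D_X !D_emb !xi_eq !xi_yi (eq_sym _ j) (negPf j0) !eqxx /= /io compM; ring.
have Dy1 : D y1 W = io (Gt - X0) + \sum_(j < n.+1 | j != ord0)
   (io (D o1 (V (yi j))) * (X K (xi j) - io (V (xi j))) - io (D o1 (V (xi j))) * X K (yi j)).
  rewrite /W DD D_emb eqxx yi_xi mul1r mul0r add0r DW0 /pair2 /= /Q compD -addrA; congr (_ + _).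
  rewrite !raddf_sum -big_split; apply: eq_bigr => j j0 /=.
  rewrite DB !DM DB !D_X !D_emb !yi_eq !yi_xi (eq_sym _ j) (negPf j0) !eqxx /= /io compM; ring.
have [tht [phi [[tht2 _ gt] [cphi phi2 sphi] phiE _]]] := generating W3 cW.
exists phi; split=> //.
pose ups : 'I_m -> fps K 2 := dblk (fun j => u (xi j)) (fun j => if j == ord0 then X1 else 0).
have ups0 i : ups i m0 = 0.
  by elim/xy_ind: i => j; rewrite /ups ?dblk_x ?dblk_y //; case: ifP; rewrite ?X_m0 ?fps0E.
have upsio h : comp ups (io h) = comp q h.
  rewrite /io comp_comp; apply: eq_comp; elim/pair2_ind; rewrite /emb /pair2 /= comp_X0 //.
    by rewrite /ups dblk_x.
  by rewrite /ups dblk_y eqxx.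
have upsX i : comp ups (X K i) = ups i by rewrite comp_X0.
have transv (A B : fps K 2 -> fps K 2) : comp ups (\sum_(j < n.+1 | j != ord0)
   (io (A (V (yi j))) * (X K (xi j) - io (V (xi j))) - io (B (V (xi j))) * X K (yi j))) = 0.
  rewrite raddf_sum big1 // => j j0 /=; rewrite compB !compM compB !upsio !upsX qV /ups dblk_x dblk_y.
  by rewrite (negPf j0) subrr !mulr0 subrr.
have upsg i : comp ups (genx W i) = sig i.
  elim/xy_ind: i => j; rewrite /genx /sig ?dblk_x ?dblk_y; last by rewrite upsX /ups dblk_y.
  rewrite compD upsX /ups dblk_x -/ups; case: eqP => [->|/eqP j0].
    rewrite Dy1 compD transv addr0 upsio compB qG comp_X0 //.
    by rewrite /q /pair2 /= addrCA subrr addr0.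
  by rewrite Dy // raddfN /= upsio qV subrr.
have sigth i : comp sig (tht i) = ups i.
  by rewrite -(eq_comp _ upsg) -comp_comp gt upsX.
move=> i; rewrite phiE comp_comp (eq_comp _ sigth).
elim/xy_ind: i => j; rewrite /geny ?dblk_x ?dblk_y; first by rewrite upsX /ups dblk_x.
rewrite compD upsX /ups dblk_y -/ups; case: eqP => [->|/eqP j0].
  rewrite Dx1 compD transv addr0 upsio compB qV comp_X0 //.
  by rewrite /q /pair2 /= addrCA subrr addr0.
by rewrite Dx // upsio qV add0r.
Qed.

Let Lop_sig F : Lop (comp sig F) = G * comp sig (D x1 F) - X1 * comp sig (D y1 F).
Proof.
rewrite Lop_comp big_xy (bigD1 ord0) //= [X in _ + X](bigD1 ord0) //= !big1.
- by rewrite /sig dblk_x dblk_y eqxx LG Lop_X1; ring.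
- by move=> j j0; rewrite /sig dblk_y (negPf j0) Lop0 mulr0.
- by move=> j j0; rewrite /sig dblk_x (negPf j0) Lop0 mulr0.
Qed.

Lemma straighten : exists phi : 'I_m -> fps K m,
  [/\ forall i, conv (phi i), forall i, ord 2 (phi i - X K i), symplectic phi,
      forall a, wdeg tw a = 0%N -> a x1 != a y1 -> comp phi H a = 0
    & forall a, wdeg tw a = 1%N -> comp phi H a = 0].
Proof.
have [phi [cphi phi2 sphi phiu]] := straight_core.
exists phi; split=> // [a ta a1|a ta]; set L := comp phi H.
  have sL : comp sig L = comp u H by rewrite /L comp_comp (eq_comp _ phiu).
  have sig0 i : sig i m0 = 0.
    by elim/xy_ind: i => j; rewrite /sig ?dblk_x ?dblk_y; case: ifP; rewrite ?X_m0 ?fps0E.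
  have : comp sig (X K x1 * D x1 L - X K y1 * D y1 L) = 0.
    rewrite compB !compM !comp_X0 // -Lh -sL Lop_sig.
    by rewrite /sig dblk_x dblk_y eqxx.
  move=> /comp_sig_eq0 /comp_base_eq0 /(_ a ta) /eqP.
  rewrite fpsBE !XDE -mulrBl mulf_eq0 subr_eq0 eqr_nat (negPf a1) => /eqP; exact.
have [i [b [-> tb ix iy]]] := wdeg_tw1 ta.
suff /comp_sig_eq0/comp_base_eq0/(_ b tb) : comp sig (D i L) = 0.
  by rewrite DE => /eqP; rewrite mulrn_eq0 /= => /eqP.
rewrite /L chain raddf_sum /=.
rewrite (eq_bigr (fun k => comp u (D k H) * comp sig (D i (phi k)))) => [|k _]; last first.
  by rewrite compM comp_comp (eq_comp _ phiu).
rewrite -Om_ode.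
have Lu k : Lop (u k) = G * comp sig (D x1 (phi k)) - X1 * comp sig (D y1 (phi k)).
  by rewrite -phiu Lop_sig.
have -> : Om (fun k => Lop (u k)) (fun k => comp sig (D i (phi k))) =
    Om (fun k => G * comp sig (D x1 (phi k)) - X1 * comp sig (D y1 (phi k)))
       (fun k => comp sig (D i (phi k))).
  by rewrite /Om; apply: eq_bigr => j _; rewrite !Lu.
rewrite OmBl -!OmMl.
have Omc a' : (a' == x1) || (a' == y1) ->
    Om (fun k => comp sig (D a' (phi k))) (fun k => comp sig (D i (phi k))) = 0.
  move=> a'1; have := congr1 (comp sig) (sphi a' i); rewrite (Om_X a'1 ix iy) comp0 => <-.
  by rewrite /Om raddf_sum; apply: eq_bigr => j _; rewrite /= compB !compM.
by rewrite !Omc ?eqxx ?orbT // !mulr0 subrr mulr0.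
Qed.

End Straight.

(** * The part quadratic in the transverse variables *)

HB.lock Definition shf (K : numFieldType) m (p : pred (multinom m)) (c : multinom m)
  (g : fps K m) : fps K m := Fps (fun a => if p a then g (a +m c) else 0).

Section Shift.
Variables (R : realType) (m : nat).
Local Notation K := (CC R).
Implicit Types (p : pred (multinom m)) (g h : fps K m).
Lemma shfE p c g a : shf p c g a = if p a then g (a +m c) else 0.
Proof. by rewrite shf.unlock. Qed.
Lemma shfB p c g h : shf p c g - shf p c h = shf p c (g - h).
Proof. by apply/fpsP => a; rewrite !(shfE, fpsBE); case: ifP; rewrite ?subr0. Qed.
Lemma ord_shf k p c g : ord (k + mdeg c) g -> ord k (shf p c g).
Proof.
move=> /ordP G; apply/ordP => a ak; rewrite shfE; case: ifP => // _.
by apply: G; rewrite mdegD ltn_add2r.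
Qed.
Lemma nrm_shf r N p c g : 0 <= r -> nrm r N (shf p c g) * r ^+ mdeg c <= nrm r (N + mdeg c) g.
Proof.
move=> r0; rewrite -[leRHS]mul1r; apply: (@nrm_inj R m m r N _ _ _ 1 (fun a => a +m c)) => //.
- exact: addIm.
- by move=> a; rewrite mdegD.
- by move=> a; rewrite mul1r shfE; case: ifP => // _; rewrite normc0 normc_ge0.
Qed.
Lemma conv_shf p c g : conv g -> conv (shf p c g).
Proof.
apply: (@conv_inj _ _ _ _ _ _ (fun a => a +m c)); first exact: addIm.
  by move=> a; exact: mdegD.
by move=> a; rewrite shfE; case: ifP => // _; rewrite normc0 normc_ge0.
Qed.
End Shift.

Lemma comp_indep (K : numFieldType) p m (good : pred 'I_p) (u v : 'I_p -> fps K m) (f : fps K p) :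
  (forall b, f b != 0 -> forall i, ~~ good i -> b i = 0%N) ->
  (forall i, good i -> u i = v i) -> comp u f = comp v f.
Proof.
move=> fg uv; apply/fpsP => a; rewrite !comp_def; congr fcoef.
rewrite trunc.unlock !raddf_sum; apply: eq_bigr => b _ /=.
have [->|fb] := eqVneq (f b) 0; first by rewrite !scale0r !raddf0.
rewrite -!mul_mpolyC !rmorphM /= !sub_mX !subE !mmapC; congr (_ * _).
apply: eq_bigr => i _; have [gi|gi] := boolP (good i); first by rewrite uv.
by rewrite (fg _ fb _ gi) !expr0.
Qed.

Section Charge.
Variables (R : realType) (n : nat) (lam : 'I_n.+1 -> CC R).
Local Notation K := (CC R).
Local Notation m := (n.+1 + n.+1)%N.
Local Notation x1 := (xi (ord0 : 'I_n.+1)).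
Local Notation y1 := (yi (ord0 : 'I_n.+1)).
Local Notation tw := (@tw n).
Implicit Types (a b : multinom m).

Definition charge a : {ffun 'I_n.+1 -> int} := [ffun j => (a (xi j))%:Z - (a (yi j))%:Z].
Definition divisor a : K := \sum_j (charge a j)%:~R * lam j.

Lemma chargeD a b : charge (a +m b) = charge a + charge b.
Proof. by apply/ffunP => j; rewrite !ffunE !mnmDE; lia. Qed.
Lemma chargeDE a b j : charge (a +m b) j = charge a j + charge b j.
Proof. by rewrite chargeD ffunE. Qed.
Lemma chargeUx j k : charge (U (xi j)) k = (j == k)%:Z.
Proof. by rewrite ffunE !mnm1E xi_eq xi_yi subr0. Qed.
Lemma chargeUy j k : charge (U (yi j)) k = - (j == k)%:Z.
Proof. by rewrite ffunE !mnm1E yi_eq yi_xi sub0r. Qed.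
Lemma divisorD a b : divisor (a +m b) = divisor a + divisor b.
Proof.
by rewrite /divisor -big_split; apply: eq_bigr => j _; rewrite chargeD ffunE rmorphD mulrDl.
Qed.
Lemma divisorU i : divisor (U i) = mu lam i.
Proof.
elim/xy_ind: i => j; rewrite /divisor (bigD1 j) //= big1 ?addr0.
- by rewrite chargeUx eqxx mul1r /mu dblk_x.
- by move=> k kj; rewrite chargeUx eq_sym (negPf kj) mul0r.
- by rewrite chargeUy eqxx /mu dblk_y rmorphN mulN1r.
- by move=> k kj; rewrite chargeUy eq_sym (negPf kj) oppr0 mul0r.
Qed.

Lemma tw_xi (j : 'I_n.+1) : tw (xi j) = (j != ord0) :> nat. Proof. by rewrite /tw dblk_x. Qed.
Lemma tw_yi (j : 'I_n.+1) : tw (yi j) = (j != ord0) :> nat. Proof. by rewrite /tw dblk_y. Qed.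
Lemma tw0P a : wdeg tw a = 0%N -> forall j, j != ord0 -> a (xi j) = 0%N /\ a (yi j) = 0%N.
Proof.
move=> /eqP; rewrite /wdeg sum_nat_eq0 => /forallP H j j0.
have := H (xi j); have := H (yi j); rewrite tw_xi tw_yi j0 /= !mul1n => /eqP -> /eqP ->.
by [].
Qed.
Lemma tw0_chg a : wdeg tw a = 0%N -> forall j, j != ord0 -> charge a j = 0.
Proof. by move=> ta j /(tw0P ta) [ax ay]; rewrite ffunE ax ay. Qed.
Lemma divisor_tw0 a : wdeg tw a = 0%N -> divisor a = (charge a ord0)%:~R * lam ord0.
Proof.
move=> ta; rewrite /divisor (bigD1 ord0) //= big1 ?addr0 // => j j0.
by rewrite (tw0_chg ta j0) mul0r.
Qed.
Lemma transv_xi i : i != x1 -> i != y1 -> exists2 j, j != ord0 & i = xi j \/ i = yi j.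
Proof.
elim/xy_ind: i => j; rewrite ?xi_eq ?yi_eq ?xi_yi ?yi_xi => jx jy; exists j => //.
  by left. by right.
Qed.
Lemma wdeg_tw2 a : wdeg tw a = 2%N -> exists i k b,
  [/\ a = b +m U i +m U k, wdeg tw b = 0%N, i != x1 /\ i != y1 & k != x1 /\ k != y1].
Proof.
move=> ta; have [k] : exists i, (tw i * a i)%N != 0%N.
  apply/existsP; apply: contraTT isT => /existsPn H; move: ta; rewrite /wdeg big1 // => i _.
  by apply/eqP; have := H i; rewrite negbK.
rewrite muln_eq0 negb_or => /andP[twk /mnm_subU [b ab]].
have tb : wdeg tw b = 1%N.
  move: ta; rewrite ab wdegD wdegU; suff -> : tw k = 1%N by lia.
  by move: twk; elim/xy_ind: {ab}k => j; rewrite ?tw_xi ?tw_yi; case: (j == ord0).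
have [i [c [bc tc ix iy]]] := wdeg_tw1 tb.
exists i, k, c; rewrite -bc; split=> //; split.
- by apply: contraNneq twk => ->; rewrite tw_xi eqxx.
- by apply: contraNneq twk => ->; rewrite tw_yi eqxx.
Qed.

Lemma charge_transv i : i != x1 -> i != y1 -> charge (U i) ord0 = 0.
Proof.
by move=> ix iy; have [j j0 [->|->]] := transv_xi ix iy; rewrite ?chargeUx ?chargeUy (negPf j0).
Qed.

Hypotheses (lam1_neq0 : lam ord0 != 0)
    (nonres2_plus : forall (k : int) (nu nu' : 'I_n.+1),
       nu != ord0 -> nu' != ord0 ->
       lam nu + lam nu' - k%:~R * lam ord0 != 0)
    (nonres2_minus : forall (k : int) (nu nu' : 'I_n.+1),
       nu != ord0 -> nu' != ord0 -> ~ (nu = nu' /\ k = 0) ->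
       lam nu - lam nu' - k%:~R * lam ord0 != 0).

Lemma divisor_tw2 i k b : wdeg tw b = 0%N -> i != x1 /\ i != y1 -> k != x1 /\ k != y1 ->
  divisor (b +m U i +m U k) =
  (charge (b +m U i +m U k) ord0)%:~R * lam ord0 - (- (mu lam i + mu lam k)).
Proof.
move=> tb [ix iy] [kx ky]; rewrite !divisorD !divisorU divisor_tw0 // !chargeDE.
by rewrite (charge_transv ix iy) (charge_transv kx ky) !addr0 opprK addrA.
Qed.

Lemma divisor_neq0 a : wdeg tw a = 2%N -> charge a != 0 -> divisor a != 0.
Proof.
move=> /wdeg_tw2 [i [k [b [ab tb it kt]]]]; apply: contraNneq.
rewrite ab divisor_tw2 // => /eqP; rewrite !chargeDE !chargeD.
have [ix iy] := it; have [kx ky] := kt.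
rewrite (charge_transv ix iy) (charge_transv kx ky) !addr0 opprK.
set e := charge b ord0 => E.
have [j j0 ij] := transv_xi ix iy; have [l l0 kl] := transv_xi kx ky.
have bal p q : j = l -> e = 0 -> charge (U p) = - charge (U q) -> charge b + charge (U p) + charge (U q) = 0.
  move=> _ e0 pq; rewrite pq subrK; apply/ffunP => h; rewrite [RHS]ffunE.
  by have [->|/(tw0_chg tb) //] := eqVneq h ord0.
have UU h : charge (U (xi h)) = - charge (U (yi h)).
  by apply/ffunP => h'; rewrite [RHS]ffunE chargeUx chargeUy opprK.
case: ij kl E => -> [] ->; rewrite /mu ?dblk_x ?dblk_y.
- have := nonres2_plus (- e) j0 l0; rewrite rmorphN mulNr opprK addrC => /negPf -> //.
- have [[jl e0] _|ne] := pselect (j = l /\ - e = 0).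
    by apply/eqP/bal => //; [apply/eqP; rewrite -oppr_eq0 e0 | rewrite -jl UU].
  by have := nonres2_minus j0 l0 ne; rewrite rmorphN mulNr opprK addrC => /negPf ->.
- have [[lj e0] _|ne] := pselect (l = j /\ - e = 0).
    by apply/eqP/bal => //; [apply/eqP; rewrite -oppr_eq0 e0 | rewrite lj UU opprK].
  have := nonres2_minus l0 j0 ne; rewrite rmorphN mulNr opprK addrC => /negPf.
  by rewrite [- lam j + _]addrC => ->.
- have := nonres2_plus e j0 l0; rewrite -oppr_eq0 opprB opprD => /negPf -> //.
Qed.

Definition inv_divisor a : K :=
  if [&& wdeg tw a == 2%N, charge a != 0 & (3 <= mdeg a)%N] then (divisor a)^-1 else 0.

Lemma inv_divisor_bound : exists2 C : R, 0 <= C &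
  forall a, normc (inv_divisor a) <= C /\ normc ((charge a ord0)%:~R * inv_divisor a) <= C.
Proof.
pose c i k := projT1 (cid2 (divisor_bound (- (mu lam i + mu lam k)) lam1_neq0)).
have c0 i k : 0 <= c i k.
  exact: (proj1 (projT2 (cid2 (divisor_bound (- (mu lam i + mu lam k)) lam1_neq0)))).
have Hc i k (h : int) : (1 + `|h%:~R|) * normc (h%:~R * lam ord0 - - (mu lam i + mu lam k))^-1 <= c i k.
  by move: h; exact: (proj2 (projT2 (cid2 (divisor_bound (- (mu lam i + mu lam k)) lam1_neq0)))).
exists (\sum_i \sum_k c i k); first by apply: sumr_ge0 => i _; apply: sumr_ge0.
move=> a; have C0 : 0 <= \sum_i \sum_k c i k by apply: sumr_ge0 => i _; apply: sumr_ge0.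
rewrite /inv_divisor; case: ifP => [/and3P[/eqP ta _ _]|_]; last by rewrite mulr0 normc0.
have [i [k [b [ab tb it kt]]]] := wdeg_tw2 ta.
have ci : c i k <= \sum_i \sum_k c i k.
  rewrite (bigD1 i) //= (bigD1 k) //= -addrA lerDl addr_ge0 //; first exact: sumr_ge0.
  by apply: sumr_ge0 => j _; apply: sumr_ge0.
have := Hc i k (charge a ord0); rewrite {2}ab -divisor_tw2 // -ab normcM normc_int.
have := normc_ge0 (divisor a)^-1; have : 0 <= `|(charge a ord0)%:~R : R| by [].
by move=> e0 t0; rewrite mulrDl mul1r => Hh; split; nra.
Qed.

End Charge.

Section Quad.
Variables (R : realType) (n : nat) (lam : 'I_n.+1 -> CC R).
Local Notation K := (CC R).
Local Notation m := (n.+1 + n.+1)%N.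
Local Notation E := (fps K m).
Local Notation x1 := (xi (ord0 : 'I_n.+1)).
Local Notation y1 := (yi (ord0 : 'I_n.+1)).
Local Notation tw := (@tw n).
Local Notation H0 := (H0f lam).
Implicit Types (a b : multinom m).

Lemma XXE i j a : (X K i * X K j : E) a = (a == U i +m U j)%:R.
Proof. by rewrite /X -rmorphM /= -mpolyXD polE mcoeffX eq_sym. Qed.
Lemma H0E a : H0 a = \sum_j lam j * (a == U (xi j) +m U (yi j))%:R.
Proof. by rewrite /H0f fps_sumE; apply: eq_bigr => j _; rewrite cstM XXE. Qed.
Lemma UxUy (j k : 'I_n.+1) : (U (xi j) +m U (yi j) == U (xi k) +m U (yi k) :> multinom m) = (j == k).
Proof.
apply/eqP/eqP => [/mnmP/(_ (xi j))|->//]; rewrite !mnmDE !mnm1E !xi_eq !yi_xi eqxx.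
by rewrite (eq_sym k); case: eqP.
Qed.
Lemma H0_diag j : H0 (U (xi j) +m U (yi j)) = lam j.
Proof.
rewrite H0E (bigD1 j) //= big1 ?addr0 => [|k kj]; first by rewrite eqxx mulr1.
by rewrite UxUy eq_sym (negPf kj) mulr0.
Qed.
Lemma H0_eq0 a : (forall j, a <> U (xi j) +m U (yi j)) -> H0 a = 0.
Proof.
move=> H; rewrite H0E big1 // => j _; case: eqP => [/H//|_]; exact: mulr0.
Qed.
Lemma tw_UxUy j : wdeg tw (U (xi j) +m U (yi j)) = ((j != ord0) * 2)%N.
Proof. by rewrite wdegD !wdegU tw_xi tw_yi; case: (j == ord0). Qed.

Variable L : E.
Hypotheses (L3 : ord 3 (L - H0)) (cL : conv L).
Hypotheses (Ldiag : forall a, wdeg tw a = 0%N -> a x1 != a y1 -> L a = 0).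
Hypotheses (Llin : forall a, wdeg tw a = 1%N -> L a = 0).

Definition L0 : E := mulT (fun a => (wdeg tw a == 0%N)%:R) L.
Definition L2 : E := mulT (fun a => (wdeg tw a != 0%N)%:R) (L - H0).
Definition H0t : E := \sum_(j < n.+1 | j != ord0) cst m (lam j) * (X K (xi j) * X K (yi j)).
Definition al : E := shf predT (U x1) (D y1 L0).
Definition ah : E := al - cst m (lam ord0).

Lemma H0tE a : H0t a = if wdeg tw a == 0%N then 0 else H0 a.
Proof.
rewrite /H0t H0E fps_sumE [X in if _ then _ else X](bigD1 ord0) //=.
case: eqP => ta.
  rewrite big1 // => j j0; rewrite cstM XXE; case: eqP => [E|_]; last by rewrite mulr0.
  by move: ta; rewrite E tw_UxUy j0.
case: eqP => [E|_]; first by case: ta; rewrite E tw_UxUy.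
by rewrite mulr0 add0r; apply: eq_bigr => j _; rewrite cstM XXE.
Qed.
Lemma L_split : L = L0 + L2 + H0t.
Proof.
apply/fpsP => a; rewrite !fpsDE !mulTE H0tE fpsBE; case: eqP => _ /=.
  by rewrite mul1r mul0r !addr0.
by rewrite mul0r mul1r add0r subrK.
Qed.
Lemma L2_ord : ord 3 L2. Proof. exact: Wt_mulT. Qed.
Lemma L2_tw : Wt tw 2 L2.
Proof.
apply/WtP => a; rewrite mulTE fpsBE; case Ea: (wdeg tw a) => [|[|//]] _ /=.
  by rewrite mul0r.
rewrite Llin // H0_eq0 ?subrr ?mulr0 // => j E; move: Ea; rewrite E tw_UxUy.
by case: (j == ord0).
Qed.
Lemma L0_chg a : L0 a != 0 -> wdeg tw a = 0%N /\ charge a = 0.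
Proof.
rewrite mulTE; case: (wdeg tw a =P 0%N) => [ta|_]; last by rewrite mul0r eqxx.
rewrite mul1r => La; split=> //; apply/ffunP => j; rewrite !ffunE.
have [->|/(tw0P ta) [-> ->] //] := eqVneq j ord0.
apply/eqP; rewrite subr_eq0 eqz_nat; apply: contraNT La => xy.
by rewrite Ldiag.
Qed.
Lemma alE a : al a = L0 (a +m U x1 +m U y1) *+ (a y1).+1.
Proof. by rewrite shfE DE mnmDE mnm1E xi_yi addn0. Qed.
Lemma al_chg a : al a != 0 -> wdeg tw a = 0%N /\ charge a = 0.
Proof.
rewrite alE mulrn_eq0 /= => /L0_chg []; rewrite !wdegD !wdegU !chargeD => ta.
have -> : charge (U x1 : multinom m) = - charge (U y1).
  by apply/ffunP => j; rewrite [RHS]ffunE chargeUx chargeUy opprK.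
by rewrite subrK; split=> //; lia.
Qed.
Lemma X_al : X K x1 * al = D y1 L0 /\ X K y1 * al = D x1 L0.
Proof.
split; apply/fpsP => a.
  have [ax|ax] := eqVneq (a x1) 0%N.
    rewrite XM0 // DE; apply/esym/eqP; rewrite mulrn_eq0 /=; apply: contraTT isT => /L0_chg [_].
    by move=> /ffunP /(_ ord0); rewrite !ffunE !mnmDE !mnm1E eqxx yi_xi ax; lia.
  by have [b ->] := mnm_subU ax; rewrite XMU shfE.
have [ay|ay] := eqVneq (a y1) 0%N.
  rewrite XM0 // DE; apply/esym/eqP; rewrite mulrn_eq0 /=; apply: contraTT isT => /L0_chg [_].
  by move=> /ffunP /(_ ord0); rewrite !ffunE !mnmDE !mnm1E eqxx xi_yi ay; lia.
have [b ->] := mnm_subU ay; rewrite XMU alE DE mnmDE mnm1E yi_xi addn0.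
have -> : b +m U y1 +m U x1 = b +m U x1 +m U y1 by rewrite -!addmA [U y1 +m _]addmC.
have [->|/L0_chg [_]] := eqVneq (L0 (b +m U x1 +m U y1)) 0; first by rewrite !mul0rn.
move=> /ffunP /(_ ord0); rewrite !ffunE !mnmDE !mnm1E !eqxx yi_xi xi_yi => H.
by congr (_ *+ _); lia.
Qed.
Lemma ah_ord : ord 1 ah.
Proof.
apply/ordP => a; rewrite ltnS leqn0 mdeg_eq0 => /eqP ->.
rewrite fpsBE cstE eqxx mulr1 alE mnm0E add0m mulr1n mulTE tw_UxUy eqxx mul1r.
move/ordP: L3 => /(_ (U x1 +m U y1)); rewrite mdegD !mdeg1 fpsBE H0_diag; exact.
Qed.
Lemma ah_chg a : ah a != 0 -> wdeg tw a = 0%N /\ charge a = 0.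
Proof.
rewrite fpsBE cstE; case: (a =P m0) => [-> _|_].
  by rewrite wdeg0; split=> //; apply/ffunP => j; rewrite !ffunE !mnm0E.
by rewrite mulr0 subr0; exact: al_chg.
Qed.
Lemma conv_L0 : conv L0.
Proof.
apply: (@conv_dom _ _ L _ 1) => // a; rewrite mulTE normcM.
by case: eqP => _; rewrite ?normc1 ?normc0 // mul0r mul1r normc_ge0.
Qed.
Lemma conv_L2 : conv L2.
Proof.
apply: (@conv_dom _ _ (L - H0) _ 1) => // [a|].
  rewrite mulTE normcM.
  by case: eqP => _; rewrite ?normc1 ?normc0 // mul0r mul1r normc_ge0.
apply: conv_B => //; apply: conv_sum => j _; apply: conv_M; first exact: conv_cst.
by apply: conv_M; exact: conv_X.
Qed.
Lemma conv_ah : conv ah.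
Proof. by apply: conv_B; [apply/conv_shf/conv_Dx/conv_L0 | exact: conv_cst]. Qed.

Hypotheses (lam1_neq0 : lam ord0 != 0)
    (nonres2_plus : forall (k : int) (nu nu' : 'I_n.+1),
       nu != ord0 -> nu' != ord0 ->
       lam nu + lam nu' - k%:~R * lam ord0 != 0)
    (nonres2_minus : forall (k : int) (nu nu' : 'I_n.+1),
       nu != ord0 -> nu' != ord0 -> ~ (nu = nu' /\ k = 0) ->
       lam nu - lam nu' - k%:~R * lam ord0 != 0).

(* The generating function T f is quadratic in the transverse variables. Modulo terms of
   transverse degree 3, f = Phi f is the equation L o geny (T f) = N o genx (T f), where
   N = L0 + H0t + sum_j bb f j * x_j * y_j is the normal form. *)
Let T (f : E) : E := mulT (inv_divisor lam) f.
Let Lt (f : E) : E := mulT (fun a => (charge a ord0)%:~R * inv_divisor lam a) f.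
Let us (f : E) : 'I_m -> E := dblk (fun j => X K (xi j))
  (fun j => X K (yi j) + if j == ord0 then 0 else D (xi j) (T f)).
Let Z (f : E) : E := comp (us f) L2.
Let bb (f : E) j : E := shf (fun a => (wdeg tw a == 0%N) && (charge a == 0)) (U (xi j) +m U (yi j)) (Z f).
Let Y (f : E) j : E := X K (yi j) * D (yi j) (T f).
Let Phi (f : E) : E := - (ah * Lt f) - Z f + \sum_(j < n.+1 | j != ord0) bb f j * Y f j.

Let TB f g : T (f - g) = T f - T g. Proof. exact: mulTB. Qed.
Let T3 f : ord 3 (T f).
Proof.
apply/ordP => a a3; rewrite mulTE /inv_divisor [(3 <= _)%N]leqNgt a3 /= !andbF; exact: mul0r.
Qed.
Let Lt3 f : ord 3 (Lt f).
Proof.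
apply/ordP => a a3; rewrite mulTE /inv_divisor [(3 <= _)%N]leqNgt a3 /= !andbF mulr0; exact: mul0r.
Qed.
Let YE f j a : Y f j a = (a (yi j))%:R * T f a.
Proof. by rewrite /Y XDE. Qed.
Let Y3 f j : ord 3 (Y f j).
Proof. by apply/ordP => a a3; rewrite YE; move/ordP: (T3 f) => ->; rewrite ?mulr0. Qed.
Let us0 f i : us f i m0 = 0.
Proof.
elim/xy_ind: i => j; rewrite /us ?dblk_x ?dblk_y ?X_m0 // fpsDE X_m0 add0r.
case: ifP => _; rewrite ?fps0E //; apply: (@ord_coef0 _ _ 1); exact/ord_D.
Qed.
Let us1 f i : ord 1 (us f i).
Proof. by rewrite -[us f i]nc_id //; exact: ord_nc. Qed.
Let Z3 f : ord 3 (Z f).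
Proof. exact: (comp_Wt (w := fun _ => 1%N) (us1 f) L2_ord). Qed.
Let b1 f j : ord 1 (bb f j).
Proof. by apply: ord_shf; rewrite mdegD !mdeg1. Qed.

Let causal k f g : ord k (f - g) -> ord k.+1 (Phi f - Phi g).
Proof.
move=> fg.
have -> : Phi f - Phi g = - (ah * (Lt f - Lt g)) - (Z f - Z g) +
    \sum_(j < n.+1 | j != ord0) (bb f j * Y f j - bb g j * Y g j).
  by rewrite sumrB /Phi; ring.
have usB i : ord k.-1 (us f i - us g i).
  elim/xy_ind: i => j; rewrite /us ?dblk_x ?dblk_y; first by rewrite subrr; exact: Wt_0.
  rewrite opprD addrACA subrr add0r; case: eqP => _; first by rewrite subrr; exact: Wt_0.
  case: k fg => [|k] fg; first exact: Wt_0k.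
  by rewrite -DB -TB; apply/ord_D/Wt_mulT.
have ZB : ord (k.-1 + 2) (Z f - Z g) by exact: comp_causal usB L2_ord.
apply: Wt_D; first apply: Wt_B.
- apply: Wt_N; rewrite -[k.+1]add1n; apply: Wt_M; first exact: ah_ord.
  by rewrite -mulTB; apply: Wt_mulT.
- by apply: Wt_le ZB; lia.
- apply: Wt_sum => j _; rewrite mulrB_split; apply: Wt_D.
    apply: (@Wt_le _ _ _ _ (k.-1 + 3)); first lia.
    apply: Wt_M => //; rewrite shfB; apply: ord_shf; rewrite mdegD !mdeg1.
    by apply: Wt_le ZB; lia.
  rewrite -[k.+1]add1n; apply: Wt_M => //; apply/ordP => a ak.
  rewrite fpsBE !YE -mulrBr -fpsBE -TB mulTE; move/ordP: fg => ->//.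
  by rewrite !mulr0.
Qed.

Let T_tw f a : T f a != 0 -> wdeg tw a = 2%N.
Proof.
rewrite mulTE /inv_divisor; case: ifP => [/and3P[/eqP //]|_]; by rewrite mul0r eqxx.
Qed.
Let le_tw a j : j != ord0 -> (a (xi j) <= wdeg tw a)%N /\ (a (yi j) <= wdeg tw a)%N.
Proof.
move=> j0; rewrite /wdeg; split.
  by rewrite (bigD1 (xi j)) //= tw_xi j0 mul1n leq_addr.
by rewrite (bigD1 (yi j)) //= tw_yi j0 mul1n leq_addr.
Qed.

Lemma quad_fixed : exists f, Phi f = f /\ conv (T f).
Proof.
have [C C0 tC] := inv_divisor_bound lam1_neq0.
have [R1 [M [R10 M0 ahM L2M]]] := conv2 conv_ah conv_L2.
pose k := 1 + 2 * C.
have k0 : 0 < k by rewrite /k; lra.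
pose N1 : R := n.+1%:R.
have N10 : 0 <= N1 by rewrite ler0n.
pose A := M * C / R1 + M * k ^+ 3 / R1 ^+ 3 * (1 + N1 * (2 * C)).
have A0 : 0 <= A.
  have Mk : 0 <= M * k ^+ 3 / R1 ^+ 3.
    by apply: divr_ge0; [apply: mulr_ge0 => //; apply: exprn_ge0; exact: ltW | exact/exprn_ge0/ltW].
  have MC : 0 <= M * C / R1 by apply: divr_ge0; [exact: mulr_ge0 | exact: ltW].
  by apply: addr_ge0 => //; apply: mulr_ge0 => //; rewrite addr_ge0 // !mulr_ge0.
have [r [r0 rA rk]] := small_radius A0 (ltW (divr_gt0 k0 R10)).
have r_ge0 := ltW r0.
have kr0 : 0 < k * r by rewrite mulr_gt0.
have krR : k * r <= R1 by move: rk; rewrite mulrAC ler_pdivrMr // mul1r.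
have rR : r <= R1 by apply: le_trans krR; rewrite /k; nra.
have TC f N : nrm r N f <= r ^+ 2 -> nrm r N (T f) <= C * r ^+ 2.
  move=> fr; apply: le_trans (nrm_mulT _ _ r_ge0 C0 (fun a => proj1 (tC a))) _.
  exact: ler_wpM2l.
pose Phi' (F : 'I_1 -> E) (i : 'I_1) := Phi (F ord0).
have causal' h F G : (forall i, ord h (F i - G i)) -> forall i, ord h.+1 (Phi' F i - Phi' G i).
  by move=> FG i; apply: causal; apply: FG.
have r2 : 0 <= r ^+ 2 by rewrite exprn_ge0.
have [|F [fixF Fr]] := fixed_point causal' r_ge0 r2; last first.
  exists (F ord0); split; first exact: (fixF ord0).
  by apply: (@convP _ _ _ r (C * r ^+ 2)) => // N; exact: TC.
move=> F Fr i N; rewrite /Phi'; have := Fr ord0; move: (F ord0) => f fr {F Fr i}.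
have DT j N' : j != ord0 -> nrm r N' (D (xi j) (T f)) <= 2 * C * r.
  move=> j0; have : nrm r N' (D (xi j) (T f)) * r ^+ 1 <= 2 * nrm r (N' + 1) (T f).
    apply: (@nrm_inj R m m r N' 1 _ _ 2 (fun a => a +m U (xi j))) => //.
    - exact: addIm.
    - by move=> a; rewrite mdegD mdeg1.
    - move=> a; rewrite DE normcMn; have [->|/T_tw ta] := eqVneq (T f (a +m U (xi j))) 0.
        by rewrite normc0 mul0rn mulr0.
      have [aj _] := le_tw (a +m U (xi j)) j0.
      rewrite -[leLHS]mulr_natl ler_wpM2r ?normc_ge0 // ler_nat -ta.
      by apply: leq_trans aj; rewrite mnmDE mnm1E eqxx addn1.
  move=> H; rewrite -(ler_pM2r r0); apply: le_trans H _.
  have := TC f (N' + 1)%N (fr _); lra.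
have YC j N' : j != ord0 -> nrm r N' (Y f j) <= 2 * (C * r ^+ 2).
  move=> j0; apply: (@le_trans _ _ (2 * nrm r N' (T f))); last by apply: ler_wpM2l => //; exact: TC.
  apply: nrm_dom => // a; rewrite YE normcM.
  have [->|/T_tw ta] := eqVneq (T f a) 0; first by rewrite normc0 !mulr0.
  rewrite ler_wpM2r ?normc_ge0 // normcMn normc1 ler_nat -ta.
  by have [_] := le_tw a j0.
have usk i N' : nrm r N' (nc (us f i)) <= k * r.
  apply: le_trans (nrm_nc _ _ r_ge0) _.
  elim/xy_ind: i => j; rewrite /us ?dblk_x ?dblk_y.
    by apply: le_trans (nrm_X _ _ r_ge0) _; rewrite /k; nra.
  apply: le_trans (nrmD _ _ _ r_ge0) _; have := nrm_X N' (yi j) r_ge0.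
  case: eqP => [_|/eqP /(DT j N')]; rewrite ?nrm0 /k; nra.
pose z := (k * r / R1) ^+ 3 * M.
have q0 : 0 <= (k * r / R1) ^+ 3 by apply/exprn_ge0/divr_ge0; exact: ltW.
have z0 : 0 <= z by exact: mulr_ge0.
have Zz N' : nrm r N' (Z f) <= z.
  apply: (@le_trans _ _ (nrm (k * r) N' L2)).
    by apply: nrm_comp => //; exact: ltW.
  apply: le_trans (nrm_radius _ (ltW kr0) krR R10 L2_ord) _.
  exact: ler_wpM2l.
have bz j N' : nrm r N' (bb f j) <= z / r ^+ 2.
  rewrite ler_pdivlMr ?exprn_gt0 //; apply: le_trans (Zz (N' + 2)%N).
  have := nrm_shf N' (fun a => (wdeg tw a == 0%N) && (charge a == 0)) (U (xi j) +m U (yi j)) (Z f) r_ge0.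
  by rewrite mdegD !mdeg1.
have ahr : nrm r N ah <= (r / R1) ^+ 1 * M.
  apply: le_trans (nrm_radius _ r_ge0 rR R10 ah_ord) _.
  by apply: ler_wpM2l => //; apply/exprn_ge0/divr_ge0 => //; exact: ltW.
have Ltr : nrm r N (Lt f) <= C * r ^+ 2.
  apply: le_trans (nrm_mulT _ _ r_ge0 C0 (fun a => proj2 (tC a))) _.
  exact: ler_wpM2l.
have P1 : nrm r N (ah * Lt f) <= (r / R1) ^+ 1 * M * (C * r ^+ 2).
  apply: le_trans (nrmM _ _ _ r_ge0) _; apply: ler_pM => //; exact: nrm_ge0.
have P2 : nrm r N (\sum_(j < n.+1 | j != ord0) bb f j * Y f j) <= N1 * (z / r ^+ 2 * (2 * (C * r ^+ 2))).
  apply: le_trans (nrm_sum _ _ _ _ r_ge0) _.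
  have c0 : 0 <= z / r ^+ 2 * (2 * (C * r ^+ 2)) by apply: mulr_ge0; [exact: divr_ge0 | apply: mulr_ge0 => //; exact: mulr_ge0].
  apply: (@le_trans _ _ (\sum_(j < n.+1 | j != ord0) z / r ^+ 2 * (2 * (C * r ^+ 2)))).
    apply: ler_sum => j j0; apply: le_trans (nrmM _ _ _ r_ge0) _.
    apply: ler_pM => //; [exact: nrm_ge0 | exact: nrm_ge0 | exact: YC].
  move: (_ * (2 * _)) c0 => c c0.
  have -> : N1 * c = \sum_(j < n.+1) c by rewrite sumr_const card_ord mulr_natl.
  by rewrite [leRHS](bigID (fun j : 'I_n.+1 => j != ord0)) /= lerDl; apply: sumr_ge0.
apply: le_trans (nrmD _ _ _ r_ge0) _.
have := nrmB N (- (ah * Lt f)) (Z f) r_ge0; rewrite nrmN => P3.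
have eA : (r / R1) ^+ 1 * M * (C * r ^+ 2) + z + N1 * (z / r ^+ 2 * (2 * (C * r ^+ 2))) = A * r * r ^+ 2.
  by rewrite /z /A; field; rewrite !lt0r_neq0.
have : A * r * r ^+ 2 <= r ^+ 2 by rewrite ler_piMl.
rewrite -eA; have := Zz N; lra.
Qed.

Let chg_tw2 a : wdeg tw a = 2%N -> charge a = 0 ->
  exists j b, [/\ j != ord0, wdeg tw b = 0%N & a = b +m U (xi j) +m U (yi j)].
Proof.
move=> /wdeg_tw2 [i [k [b [-> tb [ix iy] [kx ky]]]]].
have [j j0 ij] := transv_xi ix iy; have [l l0 kl] := transv_xi kx ky.
case: ij kl => -> [] -> /ffunP /(_ j); rewrite !chargeDE (tw0_chg tb j0) ?chargeUx ?chargeUy [RHS]ffunE eqxx.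
- by case: (l == j); lia.
- by case: (l =P j) => [-> _|_]; [exists j, b | lia].
- case: (l =P j) => [-> _|_]; [|lia]; exists j, b; split=> //.
  by rewrite -!addmA [U (yi j) +m _]addmC.
- by case: (l == j); lia.
Qed.

Lemma normalize_quadratic : exists phi : 'I_m -> E,
  [/\ forall i, conv (phi i), forall i, ord 2 (phi i - X K i), symplectic phi
    & forall a, (wdeg tw a < 3)%N -> charge a != 0 -> comp phi L a = 0].
Proof.
have [f [fixf cW]] := quad_fixed; pose W := T f.
have W3 : ord 3 W by exact: T3.
have W2 : Wt tw 2 W.
  apply/WtP => a ta; apply/eqP; apply: contraTT ta => /T_tw ->; by [].
have DxW j : Wt tw (2 - (j != ord0)) (D (xi j) W) by rewrite -tw_xi; exact: Wt_D'.
have DyW j : Wt tw (2 - (j != ord0)) (D (yi j) W) by rewrite -tw_yi; exact: Wt_D'.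
have DW2 i : ord 2 (D i W) by exact: ord_D.
have D0W i : D i W m0 = 0 by exact: (ord_coef0 (DW2 i)).
have [th [phi [_ [cphi phi2 sphi] _ gphi]]] := generating W3 cW.
exists phi; split=> //.
pose gx := genx W; pose gy := geny W.
have gxx j : gx (xi j) = X K (xi j) + D (yi j) W by rewrite /gx /genx dblk_x.
have gxy j : gx (yi j) = X K (yi j) by rewrite /gx /genx dblk_y.
have gyx j : gy (xi j) = X K (xi j) by rewrite /gy /geny dblk_x.
have gyy j : gy (yi j) = X K (yi j) + D (xi j) W by rewrite /gy /geny dblk_y.
have cgxx j : comp gx (X K (xi j)) = X K (xi j) + D (yi j) W by rewrite comp_X0 gxx // fpsDE X_m0 D0W addr0.
have cgxy j : comp gx (X K (yi j)) = X K (yi j) by rewrite comp_X0 gxy // X_m0.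
have cgyx j : comp gy (X K (xi j)) = X K (xi j) by rewrite comp_X0 gyx // X_m0.
have cgyy j : comp gy (X K (yi j)) = X K (yi j) + D (xi j) W by rewrite comp_X0 gyy // fpsDE X_m0 D0W addr0.
have gxt i : Wt tw (tw i) (gx i).
  elim/xy_ind: i => j; rewrite ?gxx ?gxy; last exact: Wt_X.
  by apply: Wt_D; [exact: Wt_X | apply: Wt_le (DyW j); rewrite tw_xi; case: (j == ord0)].
have gyt i : Wt tw (tw i) (gy i).
  elim/xy_ind: i => j; rewrite ?gyx ?gyy; first exact: Wt_X.
  by apply: Wt_D; [exact: Wt_X | apply: Wt_le (DxW j); rewrite tw_yi; case: (j == ord0)].
have ust i : Wt tw (tw i) (us f i).
  elim/xy_ind: i => j; rewrite /us ?dblk_x ?dblk_y; first exact: Wt_X.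
  apply: Wt_D; first exact: Wt_X.
  case: eqP => [_|/eqP j0]; first exact: Wt_0.
  by apply: Wt_le (DxW j); rewrite tw_yi j0.
pose S := \sum_(j < n.+1 | j != ord0) bb f j * (X K (xi j) * X K (yi j)).
pose Nst := L0 + H0t + S.
have bb_chg j a : bb f j a != 0 -> wdeg tw a = 0%N /\ charge a = 0.
  by rewrite shfE; case: ifP => [/andP[/eqP -> /eqP ->]|_]; rewrite ?eqxx.
have chgxy j : charge (U (xi j) +m U (yi j) : multinom m) = 0.
  by rewrite chargeD; apply/ffunP => k; rewrite !ffunE !mnm1E !xi_eq !yi_eq xi_yi yi_xi; lia.
have XX_chg (j : 'I_n.+1) a : charge a != 0 -> (X K (xi j) * X K (yi j) : E) a = 0.
  by move=> ca; rewrite XXE; case: eqP => // aE; move: ca; rewrite aE chgxy eqxx.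
have chgM (g h : E) : (forall a, charge a != 0 -> g a = 0) -> (forall a, charge a = 0 -> h a = 0) ->
    forall a, charge a = 0 -> (g * h) a = 0.
  by move=> g0 h0 a ca; apply: (@charge_mul _ _ _ _ _ _ 0 0 (@chargeD n) g0 h0); rewrite addr0.
have S_chg a : charge a != 0 -> S a = 0.
  move=> ca; rewrite /S fps_sumE big1 // => j j0.
  apply: (@charge_mul _ _ _ _ _ _ 0 (charge a) (@chargeD n)); last by rewrite add0r.
    by move=> b; apply: contraNeq => /bb_chg [_ ->].
  by move=> b bc; apply: XX_chg; rewrite bc.
have Nst_chg a : charge a != 0 -> Nst a = 0.
  move=> ca; rewrite !fpsDE S_chg // addr0.
  have -> : L0 a = 0 by apply/eqP; apply: contraNT ca => /L0_chg [_ ->].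
  rewrite add0r /H0t fps_sumE big1 // => j _; rewrite cstM XX_chg ?mulr0 //.
pose good (i : 'I_m) := (i == x1) || (i == y1).
have L0good b : L0 b != 0 -> forall i, ~~ good i -> b i = 0%N.
  move=> /L0_chg [/tw0P tb _] i; rewrite negb_or => /andP[ix iy].
  by have [j /tb [bx byy] [->|->]] := transv_xi ix iy.
have P1 : Wt tw 3 (comp gy L0 - L0 - D y1 L0 * D x1 W).
  pose v (i : 'I_m) := if i == y1 then D x1 W else 0.
  have -> : comp gy L0 = comp (fun i => X K i + v i) L0.
    apply: (comp_indep L0good) => i /orP[] /eqP ->; rewrite ?gyx ?gyy /v ?xi_yi ?eqxx //.
    by rewrite addr0.
  have := @comp_taylor _ _ _ (fun i => X K i) v tw 2 L0.
  rewrite comp_id (bigD1 y1) //= /v eqxx comp_id big1 ?addr0 => [H|i /negPf ->]; last by rewrite mulr0.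
  apply: Wt_le (H _ _) => // i; case: ifP => _; rewrite ?fps0E //; last exact: Wt_0.
  exact: DxW ord0.
have P2 : Wt tw 3 (comp gx L0 - L0 - D x1 L0 * D y1 W).
  pose v (i : 'I_m) := if i == x1 then D y1 W else 0.
  have -> : comp gx L0 = comp (fun i => X K i + v i) L0.
    apply: (comp_indep L0good) => i /orP[] /eqP ->; rewrite ?gxx ?gxy /v ?yi_xi ?eqxx //.
    by rewrite addr0.
  have := @comp_taylor _ _ _ (fun i => X K i) v tw 2 L0.
  rewrite comp_id (bigD1 x1) //= /v eqxx comp_id big1 ?addr0 => [H|i /negPf ->]; last by rewrite mulr0.
  apply: Wt_le (H _ _) => // i; case: ifP => _; rewrite ?fps0E //; last exact: Wt_0.
  exact: DyW ord0.
have P3 : Wt tw 3 (comp gy L2 - Z f).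
  apply: (comp_Wt_diff (w := tw) (k := 2) (s := 1)) L2_tw => // i.
  elim/xy_ind: i => j; rewrite ?gyx ?gyy /us ?dblk_x ?dblk_y; first by rewrite subrr; exact: Wt_0.
  rewrite opprD addrACA subrr add0r; case: eqP => [->|_]; last by rewrite subrr; exact: Wt_0.
  by rewrite subr0 tw_yi eqxx; apply: Wt_le (DxW ord0).
have P4 : comp gy H0t - comp gx H0t = \sum_(j < n.+1 | j != ord0) cst m (lam j) *
    (X K (xi j) * D (xi j) W - X K (yi j) * D (yi j) W).
  rewrite /H0t (raddf_sum (comp gy)) (raddf_sum (comp gx)) -sumrB; apply: eq_bigr => j _ /=.
  by rewrite !compM !comp_cst cgxx cgxy cgyx cgyy; ring.
have P5 : Wt tw 3 (comp gx S - \sum_(j < n.+1 | j != ord0) bb f j * ((X K (xi j) + D (yi j) W) * X K (yi j))).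
  rewrite /S (raddf_sum (comp gx)) -sumrB; apply: Wt_sum => j j0 /=.
  rewrite !compM cgxx cgxy -mulrBl; apply: (@Wt_M _ _ _ 1 2).
    rewrite -[X in _ - X]comp_id.
    apply: (comp_Wt_diff (w := fun _ => 0%N) (k := 0) (s := 1)); try by move=> *; exact: Wt_0k.
    move=> i; elim/xy_ind: i => l; rewrite ?gxx ?gxy ?subrr; last exact: Wt_0.
    rewrite addrC addKr; apply: Wt_le (DyW l); by case: (l == ord0).
  apply: (@Wt_M _ _ _ 1 1); last by have := Wt_X K tw (yi j); rewrite tw_yi j0.
  apply: Wt_D; first by have := Wt_X K tw (xi j); rewrite tw_xi j0.
  by have := DyW j; rewrite j0.
have LtE : X K x1 * D x1 W - X K y1 * D y1 W = Lt f.
  apply/fpsP => a; rewrite fpsBE !XDE -mulrBl !mulTE mulrA; congr (_ * _ * _).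
  by rewrite ffunE rmorphB.
have DvW : mulT (divisor lam) W = cst m (lam ord0) * Lt f + \sum_(j < n.+1 | j != ord0) cst m (lam j) *
    (X K (xi j) * D (xi j) W - X K (yi j) * D (yi j) W).
  rewrite -LtE; apply/fpsP => a; rewrite mulTE /divisor (bigD1 ord0) //= mulrDl fpsDE fps_sumE mulr_suml.
  congr (_ + _); last apply: eq_bigr => j _;
    by rewrite cstM fpsBE !XDE -mulrBl ffunE rmorphB mulrA [lam _ * _]mulrC.
have [al1 al2] := X_al.
have main : Wt tw 3 (comp gy L - comp gx Nst).
  pose Rm := mulT (divisor lam) W - f - S.
  have Lt2 : Wt tw 2 (Lt f).
    apply/WtP => a ta; rewrite mulTE -mulrA -[inv_divisor _ _ * _]mulTE -/(T f) -/W.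
    by move/WtP: W2 => ->; rewrite ?mulr0.
  have Z2 : Wt tw 2 (Z f) by exact: comp_Wt ust L2_tw.
  have Y2 j : Wt tw 2 (Y f j).
    by apply/WtP => a ta; rewrite YE -/W; move/WtP: W2 => ->; rewrite ?mulr0.
  have f2 : Wt tw 2 f.
    rewrite -fixf; apply: Wt_D; last by apply: Wt_sum => j _; exact: Wt_Mr.
    by apply: Wt_B => //; apply: Wt_N; exact: Wt_Mr.
  have f3 : ord 3 f.
    rewrite -fixf; apply: Wt_D; last by apply: Wt_sum => j _; exact: Wt_Mr.
    by apply: Wt_B => //; apply: Wt_N; exact: Wt_Mr.
  have S2 : Wt tw 2 S.
    apply: Wt_sum => j j0; apply: Wt_Mr; apply: (@Wt_M _ _ _ 1 1).
      by have := Wt_X K tw (xi j); rewrite tw_xi j0.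
    by have := Wt_X K tw (yi j); rewrite tw_yi j0.
  have S3 : ord 3 S.
    apply: Wt_sum => j j0; apply: (@Wt_M _ _ _ 1 2) => //.
    by apply: (@Wt_M _ _ _ 1 1); exact: ord_X.
  have HR : Wt tw 3 Rm.
    apply/WtP => a; rewrite ltnS leq_eqVlt => /orP[/eqP ta|ta]; last first.
      rewrite !fpsBE mulTE; move/WtP: W2 => ->//; move/WtP: f2 => ->//; move/WtP: S2 => ->//.
      by rewrite mulr0 !subr0.
    have [a3|a3] := ltnP (mdeg a) 3.
      rewrite !fpsBE mulTE; move/ordP: W3 => ->//; move/ordP: f3 => ->//; move/ordP: S3 => ->//.
      by rewrite mulr0 !subr0.
    have [ca|ca] := eqVneq (charge a) 0; last first.
      rewrite !fpsBE S_chg // subr0 !mulTE /inv_divisor ta ca a3 /= mulrA divff ?mul1r ?subrr //.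
      exact: divisor_neq0.
    have W0 b : charge b = 0 -> W b = 0 by move=> cb; rewrite mulTE /inv_divisor cb eqxx /= andbF mul0r.
    have Sa : S a = Z f a.
      have [j [b [j0 tb ab]]] := chg_tw2 ta ca.
      have cb : charge b = 0 by move: ca; rewrite ab -addmA chargeD chgxy addr0.
      rewrite /S fps_sumE (bigD1 j) //= big1 ?addr0 => [|l /andP[l0 lj]]; last first.
        rewrite mulrCA XM0 // ab !mnmDE !mnm1E xi_eq yi_xi addn0 eq_sym (negPf lj) addn0.
        by have [] := tw0P tb l0.
      have -> : bb f j * (X K (xi j) * X K (yi j)) = X K (yi j) * (X K (xi j) * bb f j) by ring.
      by rewrite ab !XMU shfE tb cb !eqxx addmA.
    have fE : f a = - Z f a.
      rewrite -[in LHS]fixf !fpsDE !fpsNE (chgM ah (Lt f)) //; first last.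
      - by move=> b cb; rewrite mulTE cb ffunE mul0r mul0r.
      - by move=> b; apply: contraNeq => /ah_chg [_ ->].
      rewrite fps_sumE big1 => [|j j0]; first by rewrite oppr0 add0r addr0.
      apply: chgM => // [b|b cb]; first by apply: contraNeq => /bb_chg [_ ->].
      by rewrite YE -/W W0 // mulr0.
    by rewrite !fpsBE Sa mulTE W0 // mulr0 sub0r fE opprK subrr.
  rewrite {1}L_split /Nst !compD.
  set SY := \sum_(j < n.+1 | j != ord0) bb f j * ((X K (xi j) + D (yi j) W) * X K (yi j)) in P5.
  have ESY : SY = S + \sum_(j < n.+1 | j != ord0) bb f j * Y f j.
    by rewrite /SY /S -big_split; apply: eq_bigr => j _; rewrite /Y -/W /=; ring.
  have ERm : Rm = D y1 L0 * D x1 W - D x1 L0 * D y1 W + Z f + (comp gy H0t - comp gx H0t) - SY.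
    have alE' : D y1 L0 * D x1 W - D x1 L0 * D y1 W = (ah + cst m (lam ord0)) * Lt f.
      by rewrite -al1 -al2 -LtE /ah; ring.
    rewrite /Rm DvW P4 ESY alE'; move: (esym fixf); rewrite {1}/Phi.
    set lf := Lt f; set zf := Z f; set bY := \sum_(j < n.+1 | j != ord0) bb f j * Y f j.
    by clearbody lf zf bY => fE; rewrite {1}fE; ring.
  have -> : comp gy L0 + comp gy L2 + comp gy H0t - (comp gx L0 + comp gx H0t + comp gx S) =
     (comp gy L0 - L0 - D y1 L0 * D x1 W) - (comp gx L0 - L0 - D x1 L0 * D y1 W)
     + (comp gy L2 - Z f) - (comp gx S - SY) + Rm by rewrite ERm; ring.
  apply: Wt_D => //; apply: Wt_B => //; apply: Wt_D => //; exact: Wt_B.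
have gL : comp gx (comp phi L) = comp gy L by rewrite comp_comp; apply: eq_comp.
pose F := comp phi L - Nst.
have gF : Wt tw 3 (comp gx F) by rewrite compB gL.
suff F0 k a : (wdeg tw a < 3)%N -> (mdeg a < k)%N -> F a = 0.
  move=> a ta ca; have /eqP := F0 _ a ta (ltnSn _).
  by rewrite fpsBE Nst_chg // subr0 => /eqP.
elim: k a => [//|k IH] a ta ak; case: k IH ak => [|k] IH ak.
  move: ak; rewrite ltnS leqn0 mdeg_eq0 => /eqP ->.
  by rewrite -(comp_coef0 gx); move/WtP: gF; apply; rewrite wdeg0.
pose F1 := mulT (fun a => (2 < wdeg tw a)%N%:R) F; pose F2 := F - F1.
have F1t : Wt tw 3 F1 by apply/WtP => b tb; rewrite mulTE ltnNge -ltnS tb mul0r.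
have F2k : ord k.+1 F2.
  apply/ordP => b bk; rewrite fpsBE mulTE; have [tb|tb] := ltnP 2 (wdeg tw b).
    by rewrite mul1r subrr.
  by rewrite IH // mulr0 subrr.
have gx2 i : ord 2 (gx i - X K i).
  elim/xy_ind: i => j; rewrite ?gxx ?gxy ?subrr; last exact: Wt_0.
  by rewrite addrC addKr.
have /ordP/(_ a ak) := comp_causal gx2 F2k.
rewrite fpsBE comp_id {1}/F2 compB fpsBE => /eqP.
move/WtP: gF => ->//; move/WtP: (comp_Wt gxt F1t) => ->//.
rewrite subrr sub0r oppr_eq0 fpsBE mulTE ltnNge -ltnS ta mul0r subr0 => /eqP.
exact.
Qed.

End Quad.

Section Formal.
Variables (R : realType) (n : nat).
Local Notation K := (CC R).

Lemma Om_bilin d (E : comNzRingType) p (A B : 'I_p -> 'I_(d + d) -> E) (u v : 'I_p -> E) :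
  Om (fun i => \sum_k A k i * u k) (fun i => \sum_l B l i * v l) =
  \sum_k \sum_l Om (A k) (B l) * (u k * v l).
Proof.
rewrite /Om (eq_bigr (fun j => \sum_k \sum_l (A k (xi j) * B l (yi j) - A k (yi j) * B l (xi j)) * (u k * v l))).
  rewrite exchange_big; apply: eq_bigr => k _; rewrite exchange_big; apply: eq_bigr => l _.
  by rewrite -mulr_suml.
move=> j _; rewrite !mulr_suml -sumrB; apply: eq_bigr => k _.
by rewrite !mulr_sumr -sumrB; apply: eq_bigr => l _; ring.
Qed.

Lemma symplectic_comp d (phi psi : 'I_(d + d) -> fps K (d + d)) :
  symplectic phi -> symplectic psi -> symplectic (fun i => comp psi (phi i)).
Proof.
move=> sphi spsi a b; rewrite -spsi.
have E c i : D c (comp psi (phi i)) = \sum_k comp psi (D k (phi i)) * D c (psi k) by rewrite chain.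
have Xd c i : D c (psi i) = \sum_k comp psi (D k (X K i)) * D c (psi k).
  rewrite (bigD1 i) //= D_X eqxx comp1 mul1r big1 ?addr0 // => k ki.
  by rewrite D_X (negPf ki) comp0 mul0r.
transitivity (Om (fun i => \sum_k comp psi (D k (phi i)) * D a (psi k))
                 (fun i => \sum_k comp psi (D k (phi i)) * D b (psi k))).
  by apply: eq_bigr => j _; rewrite !E.
transitivity (Om (fun i => \sum_k comp psi (D k (X K i)) * D a (psi k))
                 (fun i => \sum_k comp psi (D k (X K i)) * D b (psi k))); last first.
  by apply: eq_bigr => j _; rewrite -!Xd.
rewrite !Om_bilin; apply: eq_bigr => k _; apply: eq_bigr => l _; congr (_ * _).
have := congr1 (comp psi) (sphi k l); rewrite /Om !raddf_sum /= => H.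
under eq_bigr => j _ do rewrite -!compM -compB.
by rewrite H; apply: eq_bigr => j _; rewrite compB !compM.
Qed.

Local Notation m := (n.+1 + n.+1)%N.
Variable lam : 'I_n.+1 -> CC R.
Hypotheses (lam1_neq0 : lam ord0 != 0)
  (nonres1 : forall (k : int) (nu : 'I_n.+1), nu != ord0 -> lam nu - k%:~R * lam ord0 != 0)
    (nonres2_plus : forall (k : int) (nu nu' : 'I_n.+1),
       nu != ord0 -> nu' != ord0 ->
       lam nu + lam nu' - k%:~R * lam ord0 != 0)
    (nonres2_minus : forall (k : int) (nu nu' : 'I_n.+1),
       nu != ord0 -> nu' != ord0 -> ~ (nu = nu' /\ k = 0) ->
       lam nu - lam nu' - k%:~R * lam ord0 != 0).

Lemma ord3_comp (phi : 'I_m -> fps K m) (H H' : fps K m) : (forall i, ord 2 (phi i - X K i)) ->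
  ord 3 (H - H') -> ord 2 H' -> ord 3 (comp phi H - H').
Proof.
move=> phi2 H3 H2.
have -> : comp phi H - H' = comp phi (H - H') + (comp phi H' - comp (fun i => X K i) H').
  by rewrite compB comp_id; ring.
by apply: Wt_D; [exact: comp_ord | exact: comp_causal phi2 H2].
Qed.

Lemma H0f_ord : ord 2 (H0f lam).
Proof.
apply: Wt_sum => j _; apply: Wt_Mr; apply: (@Wt_M _ _ _ 1 1); exact: ord_X.
Qed.

Lemma formal_normal_form (H : fps K m) : ord 3 (H - H0f lam) -> conv H ->
  exists phi : 'I_m -> fps K m,
  [/\ forall i, conv (phi i), forall i, ord 2 (phi i - X K i), symplectic phi,
      ord 3 (comp phi H - H0f lam)
    & forall a, (wdeg (@tw n) a < 3)%N -> charge a != 0 -> comp phi H a = 0].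
Proof.
move=> H3 cH.
have [u [w [cu u2 w0 [Lw Lh] ode]]] := invariant_plane lam1_neq0 nonres1 H3 cH.
have [phi [cphi phi2 sphi Hdiag Hlin]] := straighten cu u2 w0 Lw Lh ode.
have L3 := ord3_comp phi2 H3 H0f_ord.
have cL : conv (comp phi H) by exact: conv_comp.
have [psi [cpsi psi2 spsi Hpsi]] := normalize_quadratic L3 cL Hdiag Hlin lam1_neq0 nonres2_plus nonres2_minus.
exists (fun i => comp psi (phi i)).
have phi2' i : ord 2 (comp psi (phi i) - X K i).
  have -> : comp psi (phi i) - X K i = comp psi (phi i - X K i) + (psi i - X K i).
    rewrite compB comp_X nc_id; first by ring.
    by rewrite (ord_m0 (psi2 i)) X_m0.
  by apply: Wt_D => //; exact: comp_ord.
split=> //.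
- by move=> i; exact: conv_comp.
- exact: symplectic_comp.
- exact: ord3_comp H0f_ord.
- by move=> a ta ca; rewrite -comp_comp Hpsi.
Qed.

End Formal.

(** * Action variables *)

Section Actions.
Variables (R : realType) (n : nat).
Local Notation K := (CC R).
Local Notation m := (n.+1 + n.+1)%N.
Local Notation tw := (@tw n).

Definition act (a : multinom n.+1) : multinom m := Multinom [tuple dblk a a i | i < m].
Lemma act_x a j : act a (xi j) = a j. Proof. by rewrite mnmE dblk_x. Qed.
Lemma act_y a j : act a (yi j) = a j. Proof. by rewrite mnmE dblk_y. Qed.
Lemma act_inj : injective act.
Proof. by move=> a b ab; apply/mnmP => j; rewrite -(act_x a) ab act_x. Qed.
Lemma wdeg_xy (w : 'I_m -> nat) (a : multinom m) :
  wdeg w a = \sum_j (w (xi j) * a (xi j) + w (yi j) * a (yi j))%N.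
Proof. by rewrite /wdeg big_split_ord big_split. Qed.
Lemma mdeg_act a : mdeg (act a) = (2 * mdeg a)%N.
Proof.
rewrite -wdeg1 wdeg_xy mdegE big_distrr; apply: eq_bigr => j _ /=.
by rewrite act_x act_y; lia.
Qed.
Lemma wdeg_tw (a : multinom m) :
  wdeg tw a = \sum_(j < n.+1 | j != ord0) (a (xi j) + a (yi j))%N.
Proof.
rewrite wdeg_xy [RHS]big_mkcond; apply: eq_bigr => j _.
by rewrite tw_xi tw_yi; case: (j != ord0); rewrite ?mul1n ?mul0n.
Qed.
Lemma tw_act a : wdeg tw (act a) = (2 * \sum_(j < n.+1 | j != ord0) a j)%N.
Proof.
rewrite wdeg_tw big_distrr; apply: eq_bigr => j _ /=.
by rewrite act_x act_y; lia.
Qed.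
Lemma charge0_act (a : multinom m) : charge a = 0 -> exists c, a = act c.
Proof.
move=> ca; exists (Multinom [tuple a (xi j) | j < n.+1]); apply/mnmP; elim/xy_ind => j.
  by rewrite act_x mnmE.
have : charge a j = 0 by rewrite ca ffunE.
by rewrite act_y mnmE ffunE => /eqP; rewrite subr_eq0 => /eqP[->].
Qed.
Lemma charge_act c : charge (act c) = 0.
Proof. by apply/ffunP => j; rewrite !ffunE act_x act_y subrr. Qed.

Definition acts (j : 'I_n.+1) : fps K m := X K (xi j) * X K (yi j).
Lemma acts0 j : acts j m0 = 0.
Proof. by rewrite mul_m0 !X_m0 mul0r. Qed.

Lemma comp_acts g a : comp acts g a = \sum_(b : bmultinom n.+1 (mdeg a).+1) g b * (act b == a)%:R.
Proof.
rewrite comp_def trunc.unlock raddf_sum fps_sumE; apply: eq_bigr => b _ /=.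
rewrite -mul_mpolyC subM subE mmapC cstM sub_mX; congr (_ * _).
rewrite -polXE mpolyXE_id rmorph_prod /=; congr ((_ : fps K m) a).
rewrite big_split_ord /= -big_split; apply: eq_bigr => j _ /=.
by rewrite nc_id ?acts0 // -[lshift _ j]/(xi j) -[rshift _ j]/(yi j) act_x act_y !rmorphXn -exprMn.
Qed.
Lemma comp_acts_act g c : comp acts g (act c) = g c.
Proof.
have cN : (mdeg c < (mdeg (act c)).+1)%N by rewrite mdeg_act; lia.
rewrite comp_acts (bigD1 (BMultinom cN)) //= eqxx mulr1 big1 ?addr0 // => b bc.
case: eqP => [/act_inj E|_]; last by rewrite mulr0.
by move: bc; rewrite -val_eqE /= E eqxx.
Qed.
Lemma comp_acts_chg g a : charge a != 0 -> comp acts g a = 0.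
Proof.
move=> ca; rewrite comp_acts big1 // => b _; case: eqP => [E|_]; last by rewrite mulr0.
by case/eqP: ca; rewrite -[LHS](congr1 (@charge n) E) charge_act.
Qed.

Definition Gamma_series (f : fps K m) : fps K n.+1 :=
  Fps (fun a => if (2 <= mdeg a)%N && (\sum_(j < n.+1 | j != ord0) a j <= 1)%N then f (act a) else 0).

Lemma conv_Gamma_series f : conv f -> conv (Gamma_series f).
Proof.
move=> [r [M [r0 fM]]]; apply: (@convP _ _ _ (r ^+ 2) M) => [|N]; first by rewrite exprn_gt0.
apply: le_trans (fM (2 * N)%N); rewrite !nrmE.
have hb (b : bmultinom n.+1 N) : (mdeg (act b) < 2 * N)%N.
  by case: b => b /= bN; rewrite mdeg_act; lia.
pose h (b : bmultinom n.+1 N) := BMultinom (hb b).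
have hi : injective h by move=> b b' /(congr1 (fun x : bmultinom _ _ => (x : multinom _))) /act_inj; apply: val_inj.
pose F (b : bmultinom m (2 * N)) := normc (f b) * r ^+ mdeg b.
have F0 b : 0 <= F b by rewrite mulr_ge0 ?normc_ge0 ?exprn_ge0 ?ltW.
apply: le_trans (ler_sum_inj hi F0); apply: ler_sum => b _; rewrite /F /= mdeg_act exprM.
rewrite ler_wpM2r ?exprn_ge0 ?(ltW r0) //; case: ifP => _ //.
by rewrite normc0 normc_ge0.
Qed.

Lemma Gamma_series_form f a : Gamma_series f a != 0 -> exists (j : nat) (nu : 'I_n.+1), (0 < j)%N /\
  a = mnm_add (mnm_muln (mnm1 ord0) j) (mnm1 nu).
Proof.
rewrite /=; case: ifP => [/andP[a2 a1] _|]; last by rewrite eqxx.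
have md : mdeg a = (a ord0 + \sum_(j < n.+1 | j != ord0) a j)%N by rewrite mdegE (bigD1 ord0).
have [[nu nu0 anu]|H] := pselect (exists2 nu : 'I_n.+1, nu != ord0 & a nu != 0%N).
  have s1 : \sum_(j < n.+1 | j != ord0) a j = (a nu + \sum_(j < n.+1 | (j != ord0) && (j != nu)) a j)%N.
    by rewrite (bigD1 nu).
  move: md a1; rewrite s1; set S := (X in (_ + (_ + X))%N) => md a1.
  have z : S == 0%N by lia.
  have anu1 : a nu = 1%N by lia.
  exists (a ord0), nu; split; first by lia.
  apply/mnmP => k; rewrite mnmDE mulmnE !mnm1E.
  have [<-|k0] := eqVneq ord0 k; first by rewrite (negPf nu0) mul1n addn0.
  have [<-|kn] := eqVneq nu k; first by rewrite mul0n.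
  move: z; rewrite sum_nat_eq0 => /forallP/(_ k); rewrite eq_sym k0 eq_sym kn /= mul0n => /eqP ->.
  by [].
have z k : k != ord0 -> a k = 0%N.
  by move=> k0; apply/eqP/negP => /negP ak; apply: H; exists k.
have s0 : \sum_(j < n.+1 | j != ord0) a j = 0%N by rewrite big1.
rewrite s0 addn0 in md.
exists (a ord0).-1, ord0; split; first by lia.
apply/mnmP => k; rewrite mnmDE mulmnE !mnm1E.
have [<-|k0] := eqVneq ord0 k; first by lia.
by rewrite z 1?eq_sym.
Qed.

Variable lam : 'I_n.+1 -> K.
Lemma Gamma_series_remainder f : ord 3 (f - H0f lam) ->
  (forall a, (wdeg tw a < 3)%N -> charge a != 0 -> f a = 0) ->
  Wt tw 3 (f - H0f lam - comp acts (Gamma_series f)).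
Proof.
move=> /ordP f3 fc; apply/WtP => a a3.
have [ca|ca] := eqVneq (charge a) 0; last first.
  rewrite !fpsBE fc // comp_acts_chg // H0_eq0 ?subrr // => j E.
  by move: ca; rewrite E chargeD; apply/negP/negPn/eqP/ffunP => k; rewrite !ffunE !mnm1E xi_eq yi_eq xi_yi yi_xi; lia.
have [c E] := charge0_act ca; subst a.
rewrite fpsBE comp_acts_act /=; move: a3; rewrite tw_act => a3.
have -> : (\sum_(j < n.+1 | j != ord0) c j <= 1)%N by lia.
have [c2|c2] := ltnP 1 (mdeg c) => /=; last by rewrite f3 ?subrr // mdeg_act; lia.
rewrite fpsBE H0_eq0 ?subr0 ?subrr // => j /(congr1 mdeg).
by rewrite mdegD !mdeg1 mdeg_act; lia.
Qed.

End Actions.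

(** * Values of convergent series *)

Section Real.
Variable R : realType.

Lemma le_of_geometric (x y C : R) : (forall N, x <= y + C / 2 ^+ N) -> x <= y.
Proof.
move=> H; rewrite leNgt; apply/negP => yx.
have d : 0 < x - y by lra.
pose N := (Num.truncn (C / (x - y))).+1.
have : C / (x - y) < N%:R by exact: truncnS_gt.
rewrite ltr_pdivrMr // => CN; have := H N; rewrite -lerBlDl ler_pdivlMr ?exprn_gt0 // => H'.
have : (N%:R : R) <= 2 ^+ N by rewrite -natrX ler_nat ltnW // ltn_expl.
nra.
Qed.

Lemma normc_ReIm (x : CC R) : normc x <= `|complex.Re x| + `|complex.Im x|.
Proof.
case: x => a b /=; rewrite -[leRHS]ger0_norm ?addr_ge0 // -sqrtr_sqr ler_wsqrtr //.
rewrite sqrrD !real_normK ?num_real // -addrA lerD2l lerDr mulrn_wge0 // mulr_ge0 //.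
Qed.
Lemma Re_normc (x : CC R) : `|complex.Re x| <= normc x.
Proof. by case: x => a b /=; rewrite -sqrtr_sqr ler_wsqrtr // lerDl sqr_ge0. Qed.
Lemma Im_normc (x : CC R) : `|complex.Im x| <= normc x.
Proof. by case: x => a b /=; rewrite -sqrtr_sqr ler_wsqrtr // lerDr sqr_ge0. Qed.
Lemma normcB (x y : CC R) : normc (x - y) = normc (y - x).
Proof. by rewrite -normcN opprB. Qed.
Lemma normc_tri (x y z : CC R) : normc (x - z) <= normc (x - y) + normc (y - z).
Proof. by apply: le_trans (le_normcD _ _); rewrite addrA subrK. Qed.
Lemma normc_eq0 (x : CC R) : normc x <= 0 -> x = 0.
Proof. by move=> x0; apply: eq0_normc; apply: le_anti; rewrite x0 normc_ge0. Qed.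

Lemma real_geometric_limit (x : nat -> R) (C : R) : 
  (forall N N', (N <= N')%N -> `|x N' - x N| <= C / 2 ^+ N) ->
  exists l, forall N, `|l - x N| <= C / 2 ^+ N.
Proof.
move=> H; pose A := [set y | exists N, y = x N - C / 2 ^+ N]%classic.
have C0 : 0 <= C by have := H 0%N 0%N (leqnn _); rewrite subrr normr0 expr0 divr1.
have up N : (ubound A) (x N + C / 2 ^+ N).
  move=> _ [N' ->]; have [NN|/ltnW NN] := leqP N N'.
    have := H _ _ NN; rewrite ler_norml => /andP[_].
    have : 0 <= C / 2 ^+ N' by rewrite divr_ge0 // exprn_ge0.
    lra.
  have := H _ _ NN; rewrite ler_norml => /andP[].
  have : 0 <= C / 2 ^+ N by rewrite divr_ge0 // exprn_ge0.
  lra.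
have ne : (A !=set0)%classic by exists (x 0%N - C / 2 ^+ 0); exists 0%N.
exists (sup A) => N; rewrite ler_distl; apply/andP; split.
  by apply: ub_le_sup; [exists (x 0%N + C / 2 ^+ 0); exact: up | exists N].
by apply: ge_sup => //; exact: up.
Qed.

Lemma complex_geometric_limit (x : nat -> CC R) (C : R) : 
  (forall N N', (N <= N')%N -> normc (x N' - x N) <= C / 2 ^+ N) ->
  exists l, forall N, normc (l - x N) <= (C + C) / 2 ^+ N.
Proof.
move=> H.
have ReB (a b : CC R) : complex.Re (a - b) = complex.Re a - complex.Re b by case: a; case: b.
have ImB (a b : CC R) : complex.Im (a - b) = complex.Im a - complex.Im b by case: a; case: b.
have [a Ha] := @real_geometric_limit (fun N => complex.Re (x N)) C (fun N N' NN =>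
  le_trans (eq_ind _ (fun u => `|u| <= normc (x N' - x N)) (Re_normc _) _ (ReB _ _)) (H N N' NN)).
have [b Hb] := @real_geometric_limit (fun N => complex.Im (x N)) C (fun N N' NN =>
  le_trans (eq_ind _ (fun u => `|u| <= normc (x N' - x N)) (Im_normc _) _ (ImB _ _)) (H N N' NN)).
exists (Complex a b) => N; apply: le_trans (normc_ReIm _) _; rewrite ReB ImB mulrDl.
by apply: lerD; [exact: Ha | exact: Hb].
Qed.

End Real.

Section Eval.
Variables (R : realType).
Local Notation K := (CC R).

Definition mon m (z : 'I_m -> K) (a : multinom m) : K := \prod_k z k ^+ a k.
Definition psum m N (f : fps K m) (z : 'I_m -> K) : K :=
  \sum_(b : bmultinom m N) f b * mon z b.
Definition small m (r : R) (z : 'I_m -> K) := forall k, normc (z k) <= r / 2.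
Definition bounded_at m (r M : R) (f : fps K m) := forall N, nrm r N f <= M.
Definition sums_to m (f : fps K m) (z : 'I_m -> K) (s : K) :=
  exists M : R, forall N, normc (s - psum N f z) <= M / 2 ^+ N.

Lemma psumE m N (f : fps K m) z : psum N f z = meval z (trunc N f).
Proof.
rewrite trunc.unlock raddf_sum; apply: eq_bigr => b _ /=.
by rewrite mevalZ mevalX.
Qed.

Lemma mcoeff_trunc_ge m N (f : fps K m) a : (N <= mdeg a)%N -> mcoeff a (trunc N f) = 0.
Proof.
move=> Na; rewrite trunc.unlock raddf_sum big1 //= => -[b bN] _ /=.
rewrite mcoeffZ mcoeffX; case: eqP => [ba|_]; last by rewrite mulr0.
by move: bN; rewrite ba ltnNge Na.
Qed.

Lemma psumB m N (f g : fps K m) z : psum N (f - g) z = psum N f z - psum N g z.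
Proof. by rewrite /psum -sumrB; apply: eq_bigr => b _; rewrite fpsBE mulrBl. Qed.
Lemma psumD m N (f g : fps K m) z : psum N (f + g) z = psum N f z + psum N g z.
Proof. by rewrite /psum -big_split; apply: eq_bigr => b _; rewrite fpsDE mulrDl. Qed.

Lemma psum_trunc m N N' (f : fps K m) z : (N <= N')%N ->
  psum N f z = psum N' (pol (trunc N f)) z.
Proof.
move=> NN; rewrite !psumE; congr meval; apply/mpolyP => a.
have [aN|aN] := ltnP (mdeg a) N'; first by rewrite [RHS]mcoeff_trunc // polE.
by rewrite !mcoeff_trunc_ge // (leq_trans NN).
Qed.

Lemma mon_bound m (r : R) (z : 'I_m -> K) a : (forall k, normc (z k) <= r) -> normc (mon z a) <= r ^+ mdeg a.
Proof.
move=> zr; rewrite mdegE -prodrXr /mon.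
apply: (@le_trans _ _ (\prod_k normc (z k) ^+ a k)).
  apply: (big_ind2 (fun x y => normc x <= y)); first by rewrite normc1.
    by move=> x y x' y' H H'; rewrite normcM; apply: ler_pM => //; exact: normc_ge0.
  by move=> k _; rewrite normcX.
apply: ler_prod => k _; rewrite exprn_ge0 ?normc_ge0 //=.
by rewrite lerXn2r // nnegrE ?(le_trans (normc_ge0 _) (zr k)) ?normc_ge0.
Qed.

Lemma psum_bound m N (r : R) (f : fps K m) z : (forall k, normc (z k) <= r) ->
  normc (psum N f z) <= nrm r N f.
Proof.
move=> zr; rewrite nrmE; apply: le_trans (normc_sum _ _ _) _; apply: ler_sum => b _.
by rewrite normcM ler_wpM2l ?normc_ge0 // mon_bound.
Qed.

Lemma psum_tail m N N' (r M : R) (f : fps K m) z : 0 < r -> bounded_at r M f -> small r z ->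
  (N <= N')%N -> normc (psum N' f z - psum N f z) <= M / 2 ^+ N.
Proof.
move=> r0 fM zr NN; rewrite (psum_trunc _ _ NN) -psumB.
set g := f - _; have gN : ord N g by exact: ord_trunc.
have r2 : r / 2 <= r by rewrite ler_pdivrMr // ler_peMr ?ler1n // ltW.
have r20 : 0 <= r / 2 by rewrite divr_ge0 // ltW.
apply: le_trans (psum_bound _ _ zr) _; apply: le_trans (nrm_radius _ r20 r2 r0 gN) _.
have -> : r / 2 / r = 2^-1 by field; exact: lt0r_neq0.
rewrite exprVn mulrC ler_wpM2r ?invr_ge0 ?exprn_ge0 //; apply: le_trans (fM N').
apply: nrm_le (ltW r0) _ => a; rewrite /g fpsBE polE.
have [aN|aN] := ltnP (mdeg a) N; first by rewrite mcoeff_trunc // subrr normc0 normc_ge0.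
by rewrite mcoeff_trunc_ge // subr0.
Qed.

Lemma bnd_ge0 m (r M : R) (f : fps K m) : 0 < r -> bounded_at r M f -> 0 <= M.
Proof. by move=> r0 /(_ 0%N); apply: le_trans; apply: nrm_ge0 (ltW r0). Qed.

Lemma sums_to_ex m (r M : R) (f : fps K m) z : 0 < r -> bounded_at r M f -> small r z -> exists s, sums_to f z s.
Proof.
move=> r0 fM zr; have [l Hl] := complex_geometric_limit (fun N N' => psum_tail r0 fM zr (N:=N) (N':=N')).
by exists l, (M + M).
Qed.

Lemma sums_to_sharp m (r M : R) (f : fps K m) z s : 0 < r -> bounded_at r M f -> small r z -> sums_to f z s ->
  forall N, normc (s - psum N f z) <= M / 2 ^+ N.
Proof.
move=> r0 fM zr [M' H] N; apply: (@le_of_geometric _ _ _ `|M'|) => N'.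
have [NN|/ltnW NN] := leqP N N'.
  apply: le_trans (normc_tri _ (psum N' f z) _) _; rewrite addrC; apply: lerD.
    exact: psum_tail r0 fM zr NN.
  by apply: le_trans (H N') _; rewrite ler_wpM2r ?invr_ge0 ?exprn_ge0 // ler_norm.
apply: le_trans (H N) _; apply: (@le_trans _ _ (`|M'| / 2 ^+ N')); last first.
  by rewrite lerDr divr_ge0 ?exprn_ge0 // (bnd_ge0 r0 fM).
apply: (@le_trans _ _ (`|M'| / 2 ^+ N)); first by rewrite ler_wpM2r ?invr_ge0 ?exprn_ge0 // ler_norm.
by rewrite ler_wpM2l // lef_pV2 ?posrE ?exprn_gt0 // ler_eXn2l // ltr1n.
Qed.

Lemma sums_to_uniq m (f : fps K m) z s s' : sums_to f z s -> sums_to f z s' -> s = s'.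
Proof.
move=> [M H] [M' H']; apply/eqP; rewrite -subr_eq0; apply/eqP/normc_eq0.
apply: (@le_of_geometric _ _ _ (M + M')) => N; rewrite add0r mulrDl.
apply: le_trans (normc_tri _ (psum N f z) _) _; apply: lerD => //.
by rewrite normcB.
Qed.

Lemma sums_to_D m (f g : fps K m) z s t : sums_to f z s -> sums_to g z t -> sums_to (f + g) z (s + t).
Proof.
move=> [M H] [M' H']; exists (M + M') => N; rewrite psumD opprD addrACA mulrDl.
by apply: le_trans (le_normcD _ _) _; apply: lerD.
Qed.
Lemma sums_to_pol m (q : mpoly m K) z : sums_to (pol q) z (meval z q).
Proof.
exists (normc (\sum_(b : bmultinom m (msize q)) 0) + \sum_(N < msize q) normc (meval z q - psum N (pol q) z) * 2 ^+ N) => N.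
rewrite big1 // normc0 add0r ler_pdivlMr ?exprn_gt0 //.
have [Nq|Nq] := ltnP N (msize q).
  rewrite (bigD1 (Ordinal Nq)) //= lerDl; apply: sumr_ge0 => i _.
  by rewrite mulr_ge0 ?normc_ge0 ?exprn_ge0.
have -> : psum N (pol q) z = meval z q.
  rewrite psumE; congr meval; apply/mpolyP => a; have [aN|aN] := ltnP (mdeg a) N.
    by rewrite mcoeff_trunc // polE.
  by rewrite mcoeff_trunc_ge // memN_msupp_eq0 // msize_mdeg_ge // (leq_trans Nq).
rewrite subrr normc0 mul0r; apply: sumr_ge0 => i _.
by rewrite mulr_ge0 ?normc_ge0 ?exprn_ge0.
Qed.
Lemma sums_to_cst m c z : sums_to (cst m c : fps K m) z c.
Proof. by have := sums_to_pol (@mpolyC m K c) z; rewrite mevalC. Qed.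
Lemma sums_to_X m i z : sums_to (X K i : fps K m) z (z i).
Proof. by have := sums_to_pol (mpolyX K (U i)) z; rewrite mevalXU. Qed.
Lemma sums_to_sum m (I : Type) (r : seq I) (P : pred I) (F : I -> fps K m) (s : I -> K) z :
  (forall i, P i -> sums_to (F i) z (s i)) ->
  sums_to (\sum_(i <- r | P i) F i) z (\sum_(i <- r | P i) s i).
Proof.
move=> H; apply: (big_ind2 (fun f t => sums_to f z t)) => // [|f t g t' ? ?]; last exact: sums_to_D.
by have := sums_to_cst 0 z; rewrite rmorph0.
Qed.

Lemma sums_to_M m (r M M' : R) (f g : fps K m) z s t : 0 < r -> bounded_at r M f -> bounded_at r M' g -> small r z ->
  sums_to f z s -> sums_to g z t -> sums_to (f * g) z (s * t).
Proof.
move=> r0 fM gM zr fs gt.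
have M0 := bnd_ge0 r0 fM; have M'0 := bnd_ge0 r0 gM.
have Hs := sums_to_sharp r0 fM zr fs; have Ht := sums_to_sharp r0 gM zr gt.
exists (M * (M' + M') + M * M' + M * M') => N.
pose q := trunc N f * trunc N g.
have bq : bounded_at r (M * M') (pol q).
  move=> N'; rewrite rmorphM; apply: le_trans (nrmM _ _ _ (ltW r0)) _.
  have tb M1 (h : fps K m) : bounded_at r M1 h -> nrm r N' (pol (trunc N h)) <= M1.
    move=> hM; apply: le_trans (hM N'); apply: nrm_le (ltW r0) _ => a; rewrite polE.
    have [aN|aN] := ltnP (mdeg a) N; first by rewrite mcoeff_trunc.
    by rewrite mcoeff_trunc_ge // normc0 normc_ge0.
  by apply: ler_pM; rewrite ?nrm_ge0 ?(ltW r0) ?tb.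
have e1 : psum N (f * g) z = psum N (pol q) z.
  apply: eq_bigr => -[b bN] _ /=; congr (_ * _).
  by rewrite polE [_ * _]/GRing.mul /= (fps_mulE _ _ bN).
have e2 : meval z q = psum N f z * psum N g z by rewrite mevalM !psumE.
have H3 := sums_to_sharp r0 bq zr (sums_to_pol q z) N.
rewrite e1; apply: le_trans (normc_tri _ (meval z q) _) _; rewrite mulrDl; apply: lerD => //.
rewrite e2 mulrB_split; apply: le_trans (le_normcD _ _) _; rewrite !normcM mulrDl; apply: lerD.
  rewrite mulrAC; apply: ler_pM; rewrite ?normc_ge0 //.
  have := Ht 0%N; rewrite expr0 divr1 => Ht0; rewrite -[t](subrK (psum 0 g z)).
  apply: le_trans (le_normcD _ _) _; apply: lerD => //.
  apply: le_trans (gM 0%N); apply: psum_bound => k; apply: le_trans (zr k) _.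
  by rewrite ler_pdivrMr // ler_peMr ?ler1n // ltW.
rewrite -mulrA; apply: ler_pM; rewrite ?normc_ge0 //; apply: le_trans (fM N).
apply: psum_bound => k; apply: le_trans (zr k) _.
by rewrite ler_pdivrMr // ler_peMr ?ler1n // ltW.
Qed.

Lemma bnd_exp m (r M : R) (f : fps K m) k : 0 < r -> bounded_at r M f -> bounded_at r (M ^+ k) (f ^+ k).
Proof. by move=> r0 fM N; apply: nrm_exp => //; exact: ltW. Qed.
Lemma bnd_1 m (r : R) : 0 < r -> bounded_at r 1 (1 : fps K m).
Proof. by move=> r0 N; apply: nrm1 (ltW r0). Qed.
Lemma bnd_M m (r M M' : R) (f g : fps K m) : 0 < r -> bounded_at r M f -> bounded_at r M' g -> bounded_at r (M * M') (f * g).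
Proof.
move=> r0 fM gM N; apply: le_trans (nrmM _ _ _ (ltW r0)) _.
by apply: ler_pM => //; exact: nrm_ge0 (ltW r0).
Qed.

Lemma sums_to_mon p m (r M : R) (u : 'I_p -> fps K m) (w : 'I_p -> K) z b :
  0 < r -> small r z -> (forall i, bounded_at r M (u i)) -> (forall i, sums_to (u i) z (w i)) ->
  sums_to (\prod_i u i ^+ b i) z (\prod_i w i ^+ (b i : nat)).
Proof.
move=> r0 zr uM uw.
have one : sums_to (1 : fps K m) z 1 by have := sums_to_cst 1 z; rewrite rmorph1.
have exps i k : sums_to (u i ^+ k) z (w i ^+ k).
  elim: k => [//|k IH]; rewrite !exprS.
  exact: sums_to_M r0 (uM i) (bnd_exp (f := u i) _ r0 (uM i)) zr (uw i) IH.
suff [] : (exists M', bounded_at r M' (\prod_i u i ^+ b i)) /\ sums_to (\prod_i u i ^+ b i) z (\prod_i w i ^+ (b i : nat)) by [].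
apply: (big_ind2 (fun f s => (exists M', bounded_at r M' f) /\ sums_to f z s)).
- by split=> //; exists 1; exact: bnd_1.
- move=> f s g t [[M1 fM] fs] [[M2 gM] gt]; split; last exact: sums_to_M r0 fM gM zr fs gt.
  by exists (M1 * M2); exact: bnd_M.
- by move=> i _; split; [exists (M ^+ b i); exact: bnd_exp | exact: exps].
Qed.

Lemma sums_to_comp p m (r rho M : R) (u : 'I_p -> fps K m) (f : fps K p) (w : 'I_p -> K) z s :
  0 < r -> 0 < rho -> small r z -> small rho w -> (forall i, u i m0 = 0) ->
  (forall i, bounded_at r rho (u i)) -> (forall i, sums_to (u i) z (w i)) -> bounded_at rho M f ->
  sums_to f w s -> sums_to (comp u f) z s.
Proof.
move=> r0 rho0 zr wr u0 uM uw fM fs.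
have Hs := sums_to_sharp rho0 fM wr fs.
exists (M + M) => N; rewrite mulrDl.
apply: le_trans (normc_tri _ (psum N f w) _) _; apply: lerD => //.
pose P := sub u (trunc N f).
have nu i : nc (u i) = u i by rewrite nc_id.
have -> : psum N (comp u f) z = psum N P z.
  apply: eq_bigr => -[b bN] _ /=; congr (_ * _).
  by have /ordP/(_ b bN)/eqP := comp_sub u N f; rewrite fpsBE subr_eq0 => /eqP.
apply: (@sums_to_sharp _ r) => // [N'|].
  rewrite /P -comp_pol; apply: le_trans (fM N'); apply: (@le_trans _ _ (nrm rho N' (pol (trunc N f)))).
    by apply: nrm_comp (ltW r0) (ltW rho0) _ => i; rewrite nu; exact: uM.
  apply: nrm_le (ltW rho0) _ => a; rewrite polE.
  have [aN|aN] := ltnP (mdeg a) N; first by rewrite mcoeff_trunc.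
  by rewrite mcoeff_trunc_ge // normc0 normc_ge0.
rewrite /P trunc.unlock raddf_sum; apply: sums_to_sum => b _ /=.
rewrite -mul_mpolyC subM sub_mX subE mmapC.
under eq_bigr => i _ do rewrite nu.
have bm : exists M', bounded_at r M' (\prod_i u i ^+ b i).
  apply: (big_ind (fun f => exists M', bounded_at r M' f)); first by exists 1; exact: bnd_1.
    by move=> g h [M1 gM] [M2 hM]; exists (M1 * M2); exact: bnd_M.
  by move=> i _; exists (rho ^+ b i); exact: bnd_exp.
have [M' bM'] := bm.
apply: (sums_to_M r0 (M := normc (f b)) _ bM' zr (sums_to_cst _ _)).
  by move=> N'; apply: nrm_cst (ltW r0).
exact: sums_to_mon r0 zr uM uw.
Qed.

End Eval.

(** * Unordered sums *)

#[local] Existing Instance summability.totally_filter.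

Section Sums.
Variables (R : realType).
Local Notation K := (CC R).

Lemma CC_normE (x : K) : `|x| = (normc x)%:C%C. Proof. by []. Qed.
Lemma CC_pos (x : K) : 0 < x -> exists e : R, 0 < e /\ x = e%:C%C.
Proof. by case: x => a b; rewrite ltcE /= => /andP[/eqP -> ?]; exists a. Qed.
Lemma normc_real (x : R) : normc (x%:C%C : K) = `|x|.
Proof. by rewrite /= expr0n addr0 sqrtr_sqr. Qed.

Lemma mx_ballP m (z w : 'rV[K]_m) (e : K) : 0 < e ->
  ball z e w <-> forall k, `|z 0 k - w 0 k| < e.
Proof.
move=> e0; split=> [[_ H] k|H]; first by have := H 0 k; rewrite -ball_normE.
by split=> // i k; rewrite -ball_normE (ord1 i); exact: H.
Qed.

Lemma near0P m (P : 'rV[K]_m -> Prop) : (\forall z \near (0 : 'rV[K]_m), P z) <->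
  exists d : R, 0 < d /\ forall z : 'rV[K]_m, (forall k, normc (z 0 k) <= d) -> P z.
Proof.
split.
  move=> /nbhs_ballP[e /= /CC_pos[d [d0 ->]] H]; exists (d / 2); split=> [|z zd]; first by rewrite divr_gt0.
  apply/H/mx_ballP => [|k]; first by rewrite ltcR.
  rewrite mxE sub0r normrN CC_normE ltcR; apply: le_lt_trans (zd k) _; lra.
move=> [d [d0 H]]; apply/nbhs_ballP; exists (d%:C%C : K); first by rewrite /= ltcR.
move=> z /mx_ballP zd; apply: H => k.
have : `|(0 : 'rV[K]_m) 0 k - z 0 k| < d%:C%C by apply: zd; rewrite ltcR.
by rewrite mxE sub0r normrN CC_normE ltcR => /ltW.
Qed.

Lemma coord_le_norm m (z : 'rV[K]_m) k : `|z 0 k| <= `|z|.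
Proof.
apply/ler_addgt0Pr => e e0; apply/ltW.
have ze : 0 < `|z| + e by apply: ltr_wpDl.
have /(mx_ballP _ _ ze)/(_ k) : ball (0 : 'rV[K]_m) (`|z| + e) z.
  by rewrite mx_norm_ball /ball_ /= sub0r normrN ltrDl.
by rewrite mxE sub0r normrN.
Qed.

Lemma norm_le_coord m (z : 'rV[K]_m) e : 0 <= e -> (forall k, `|z 0 k| <= e) -> `|z| <= e.
Proof.
move=> e0 H; apply/ler_addgt0Pr => d d0; apply/ltW.
have ed : 0 < e + d by apply: ltr_wpDl.
have : ball (0 : 'rV[K]_m) (e + d) z.
  by apply/mx_ballP => // k; rewrite mxE sub0r normrN; apply: le_lt_trans (H k) _; rewrite ltrDl.
by rewrite mx_norm_ball /ball_ /= sub0r normrN.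
Qed.

Definition cut m (J : {pred multinom m}) (f : fps K m) : fps K m :=
  Fps (fun a => if a \in J then f a else 0).

Lemma partial_sum_cut m (J : {fset multinom m}) (f : fps K m) (z : 'rV[K]_m) :
  exists N0, forall N, (N0 <= N)%N ->
    summability.partial_sum (fun a => f a * monomial z a) J = psum N (cut (fun a => a \in J) f) (fun k => z 0 k).
Proof.
exists (\max_(a <- finmap.enum_fset J) mdeg a).+1 => N NN.
have JN (a : multinom m) : a \in J -> (mdeg a < N)%N.
  by move=> aJ; apply: leq_trans NN; rewrite ltnS; exact: (leq_bigmax_seq (F := fun a => mdeg a)).
rewrite /summability.partial_sum -(big_seq_fsetE +%R J predT (fun a => f a * monomial z a)) /psum /=.
transitivity (\sum_(b : bmultinom m N | (b : multinom m) \in J) f b * monomial z b); last first.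
  rewrite big_mkcond; apply: eq_bigr => b _ /=.
  by case: ifP => _; rewrite ?mul0r.
have -> : \sum_(b : bmultinom m N | (b : multinom m) \in J) f b * monomial z b =
   \sum_(a <- [seq val b | b <- enum [pred b : bmultinom m N | (b : multinom m) \in J]]) f a * monomial z a.
  by rewrite big_map big_enum.
apply: perm_big; apply: uniq_perm.
- exact: finmap.fset_uniq.
- by rewrite map_inj_uniq ?enum_uniq //; exact: val_inj.
move=> a; apply/idP/mapP => [aJ|[b]].
  by exists (BMultinom (JN _ aJ)) => //; rewrite mem_enum.
by rewrite mem_enum => bJ ->.
Qed.

Lemma psum_agree m N (f g : fps K m) z :
  (forall a, (mdeg a < N)%N -> f a = g a) -> psum N f z = psum N g z.
Proof. by move=> fg; apply: eq_bigr => -[b bN] _ /=; rewrite fg. Qed.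

Lemma bnd_cut m (r M : R) (J : {pred multinom m}) f : 0 < r -> bounded_at r M f -> bounded_at r M (cut J f).
Proof.
move=> r0 fM N; apply: le_trans (fM N); apply: nrm_le (ltW r0) _ => a /=.
by case: ifP => _ //; rewrite normc0 normc_ge0.
Qed.

Lemma geometric_small (C e : R) : 0 < e -> exists N, C / 2 ^+ N <= e.
Proof.
move=> e0; apply: contrapT => H.
suff : C + e <= C by lra.
have {}H N : e <= C / 2 ^+ N.
  by rewrite leNgt; apply/negP => /ltW H'; apply: H; exists N.
have : e <= 0 by apply: (@le_of_geometric _ _ _ C) => N; rewrite add0r.
lra.
Qed.

Lemma has_sum_sums_to m (r M : R) (f : fps K m) (z : 'rV[K]_m) s : 0 < r -> bounded_at r M f ->
  small r (fun k => z 0 k) -> sums_to f (fun k => z 0 k) s -> has_sum (fun a => f a * monomial z a) s.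
Proof.
move=> r0 fM zr fs; apply/cvgrPdist_le => _ /CC_pos[e [e0 ->]].
have [N HN] := geometric_small (M + M) e0.
pose J0 := finmap.seq_fset tt [seq val b | b <- enum {: bmultinom m N}].
exists J0 => // J J0J; rewrite CC_normE lecR; apply: le_trans HN.
have JN (a : multinom m) : (mdeg a < N)%N -> a \in J.
  move=> aN; apply: (finmap.fsubsetP J0J); rewrite finmap.seq_fsetE.
  by apply/mapP; exists (BMultinom aN) => //; rewrite mem_enum.
have [N0 HJ] := partial_sum_cut J f z.
rewrite (HJ (maxn N0 N)) ?leq_maxl // mulrDl.
apply: le_trans (normc_tri _ (psum N f (fun k => z 0 k)) _) _; apply: lerD.
  exact: sums_to_sharp r0 fM zr fs N.
rewrite normcB (@psum_agree _ N f (cut (fun a => a \in J) f)); last by move=> a /JN /= ->.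
exact: psum_tail r0 (bnd_cut _ r0 fM) zr (leq_maxr _ _).
Qed.

Lemma has_sum_bounded (I : choiceType) (u : I -> K) s : has_sum u s ->
  exists B : R, forall i, normc (u i) <= B.
Proof.
move=> /cvgrPdist_le/(_ 1 ltr01)[J0 _ H].
have pU (i : I) : i \notin J0 ->
    summability.partial_sum u (finmap.fsetU (finmap.fset1 i) J0) = u i + summability.partial_sum u J0.
  move=> iJ; rewrite /summability.partial_sum.
  rewrite -(big_seq_fsetE +%R _ predT u) -(finmap.big_seq_fsetE +%R J0 predT u).
  transitivity (\sum_(j <- i :: J0) u j); last by rewrite big_cons.
  apply: perm_big; apply: uniq_perm => [||j].
  - exact: fset_uniq.
  - by rewrite /= iJ fset_uniq.
  - by rewrite in_fset1U inE.
exists (2 + \sum_(i <- finmap.enum_fset J0) normc (u i)) => i.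
have [iJ|iJ] := boolP (i \in J0).
  rewrite (big_rem i) //= addrCA lerDl addr_ge0 // sumr_ge0 // => j _; exact: normc_ge0.
apply: (@le_trans _ _ 2); last by rewrite lerDl sumr_ge0 // => j _; exact: normc_ge0.
have H1 := H J0 (finmap.fsubset_refl _).
have H2 := H (finmap.fsetU (finmap.fset1 i) J0) (finmap.fsubsetUr _ _).
move: H1 H2; rewrite pU // !CC_normE -[1]/(1%:C%C : K) !lecR => H1 H2.
have -> : u i = (u i + summability.partial_sum u J0 - s) + (s - summability.partial_sum u J0) by ring.
apply: le_trans (le_normcD _ _) _; rewrite (_ : 2 = 1 + 1) //; apply: lerD => //.
by rewrite normcB.
Qed.

Lemma geom2_le N : \sum_(i < N) (2^-1 : R) ^+ i <= 2.
Proof.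
suff : \sum_(i < N) (2^-1 : R) ^+ i + 2 * 2^-1 ^+ N <= 2.
  by apply: le_trans; rewrite lerDl mulr_ge0 // exprn_ge0 // invr_ge0.
elim: N => [|N IH]; first by rewrite big_ord0 expr0 add0r mulr1.
rewrite big_ord_recr /= -addrA exprS mulrA divff // mul1r.
by apply: le_trans IH; rewrite mulr_natl mulr2n.
Qed.

Lemma sum_half_le m N : \sum_(b : bmultinom m N) (2^-1 : R) ^+ mdeg b <= 2 ^+ m.
Proof.
have lt (b : bmultinom m N) k : ((b : multinom m) k < N)%N.
  by case: b => b /= bN; apply: leq_ltn_trans bN; rewrite mdegE (bigD1 k) //= leq_addr.
pose h (b : bmultinom m N) : {ffun 'I_m -> 'I_N} := [ffun k => Ordinal (lt b k)].
have hi : injective h.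
  move=> b b' /ffunP bb; apply/val_inj/mnmP => k; have := bb k.
  by rewrite !ffunE => /(congr1 val).
apply: (@le_trans _ _ (\sum_(g : {ffun 'I_m -> 'I_N}) \prod_k (2^-1 : R) ^+ g k)).
  apply: le_trans (ler_sum_inj (F := fun g : {ffun 'I_m -> 'I_N} => \prod_k (2^-1 : R) ^+ g k) hi _).
    apply: ler_sum => b _; rewrite mdegE -prodrXr le_eqVlt; apply/orP; left; apply/eqP.
    by apply: eq_bigr => k _; rewrite ffunE.
  by move=> g; apply: prodr_ge0 => k _; rewrite exprn_ge0 // invr_ge0.
rewrite -(bigA_distr_bigA (fun (_ : 'I_m) (i : 'I_N) => (2^-1 : R) ^+ i)).
rewrite -[X in 2 ^+ X](card_ord m) -prodr_const.
apply: ler_prod => k _; rewrite geom2_le andbT.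
by apply: sumr_ge0 => i _; rewrite exprn_ge0 // invr_ge0.
Qed.

Lemma has_sum_uniq (I : choiceType) (u : I -> K) s s' : has_sum u s -> has_sum u s' -> s = s'.
Proof. by apply: cvg_unique; exact: norm_hausdorff. Qed.

Lemma pseries_sums_to m (f : 'rV[K]_m -> K) (c : fps K m) : has_pseries f c ->
  conv c /\ exists d : R, 0 < d /\
    forall z : 'rV[K]_m, (forall k, normc (z 0 k) <= d) -> sums_to c (fun k => z 0 k) (f z).
Proof.
move=> /near0P[d [d0 H]].
have [B HB] := has_sum_bounded (H (const_mx (d%:C%C : K))
  (fun k => eq_ind_r (fun x : K => normc x <= d) (eq_ind_r (fun x => x <= d) (lexx _) (etrans (normc_real d) (gtr0_norm d0))) (mxE _ _ _ _))).
have r0 : 0 < d / 2 by rewrite divr_gt0.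
have cM : bounded_at (d / 2) (B * 2 ^+ m) c.
  move=> N; rewrite nrmE.
  have B0 : 0 <= B by apply: le_trans (HB m0); exact: normc_ge0.
  apply: (@le_trans _ _ (B * \sum_(b : bmultinom m N) 2^-1 ^+ mdeg b)).
    rewrite mulr_sumr; apply: ler_sum => b _.
    rewrite exprMn mulrA ler_wpM2r ?exprn_ge0 ?invr_ge0 //.
    apply: le_trans (HB b); rewrite normcM ler_wpM2l ?normc_ge0 //.
    have -> : monomial (const_mx (d%:C%C : K)) b = (d%:C%C) ^+ mdeg b.
      by rewrite mdegE -prodrXr; apply: eq_bigr => k _; rewrite mxE.
    by rewrite normcX normc_real (gtr0_norm d0).
  by rewrite ler_wpM2l // sum_half_le.
split; first exact: convP r0 cM.
exists (d / 2 / 2); split=> [|z zd]; first by rewrite !divr_gt0.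
have [s Hs] := sums_to_ex r0 cM zd.
rewrite (@has_sum_uniq _ _ (f z) s _ (has_sum_sums_to r0 cM zd Hs)) //; apply: H => k.
apply: le_trans (zd k) _; lra.
Qed.

Lemma sums_to_pseries m (f : 'rV[K]_m -> K) (c : fps K m) (d : R) : conv c -> 0 < d ->
  (forall z : 'rV[K]_m, (forall k, normc (z 0 k) <= d) -> sums_to c (fun k => z 0 k) (f z)) ->
  has_pseries f c.
Proof.
move=> [r [M [r0 cM]]] d0 H; apply/near0P.
have [d' [d'0 d1 d2]] : exists d', [/\ 0 < d', d' <= d & d' <= r / 2].
  have [le|lt] := leP d (r / 2); first by exists d.
  by exists (r / 2); rewrite lexx divr_gt0 // ltW.
exists d'; split=> // z zd.
by apply: has_sum_sums_to r0 cM _ _ => [k|]; [|apply: H => k]; apply: le_trans (zd k) _.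
Qed.

End Sums.

(** * Differentiability *)

Section Diff.
Variables (R : realType).
Local Notation K := (CC R).

Lemma sums_to_weight m (w : 'I_m -> nat) (r M q : R) (f : fps K m) (z : 'I_m -> K) s k :
  0 < r -> 0 <= q -> q <= 1 -> bounded_at r M f -> Wt w k f -> (forall i, normc (z i) <= r * q ^+ w i) ->
  sums_to f z s -> normc s <= M * q ^+ k.
Proof.
move=> r0 q0 q1 fM /WtP fk zq [M' H].
apply: (@le_of_geometric _ _ _ M') => N; rewrite addrC.
rewrite -[s](subrK (psum N f z)); apply: le_trans (le_normcD _ _) _; apply: lerD; first exact: H.
apply: (@le_trans _ _ (nrm r N f * q ^+ k)); last by rewrite ler_wpM2r ?exprn_ge0.
apply: le_trans (normc_sum _ _ _) _; rewrite nrmE mulr_suml; apply: ler_sum => b _.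
have [bk|kb] := ltnP (wdeg w b) k; first by rewrite fk // !(mul0r, normc0).
rewrite normcM -mulrA ler_wpM2l ?normc_ge0 //.
apply: (@le_trans _ _ (r ^+ mdeg b * q ^+ wdeg w b)); last first.
  by rewrite ler_wpM2l ?exprn_ge0 ?(ltW r0) // -(subnKC kb) exprD ler_piMr ?exprn_ge0 // exprn_ile1.
rewrite mdegE /wdeg -!prodrXr -big_split /=.
apply: (@le_trans _ _ (\prod_i normc (z i) ^+ b i)).
  apply: (big_ind2 (fun x y => normc x <= y)); first by rewrite normc1.
    by move=> x y x' y' H1 H2; rewrite normcM; apply: ler_pM => //; exact: normc_ge0.
  by move=> i _; rewrite normcX.
apply: ler_prod => i _; rewrite exprn_ge0 ?normc_ge0 //= exprM -exprMn lerXn2r ?nnegrE ?normc_ge0 //.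
by rewrite mulr_ge0 ?exprn_ge0 // ltW.
Qed.

Lemma sums_to_B m (f g : fps K m) z s t : sums_to f z s -> sums_to g z t -> sums_to (f - g) z (s - t).
Proof.
move=> [M H] [M' H']; exists (M + M') => N; rewrite psumB mulrDl.
have -> : s - t - (psum N f z - psum N g z) = (s - psum N f z) - (t - psum N g z) by ring.
by apply: le_trans (le_normcD _ _) _; rewrite normcN; apply: lerD.
Qed.

(* As a series in (z, h), the Taylor remainder has order 2 in h. *)
Lemma taylor_bound m (g : fps K m) : conv g -> exists d M : R, [/\ 0 < d, 0 <= M &
  forall (z h : 'I_m -> K) (eta : R) s s' (t : 'I_m -> K), (forall k, normc (z k) <= d) ->
   0 <= eta -> eta <= d -> (forall k, normc (h k) <= eta) -> sums_to g z s ->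
   sums_to g (fun k => z k + h k) s' -> (forall k, sums_to (D k g) z (t k)) ->
   normc (s' - s - \sum_k t k * h k) <= M * eta ^+ 2].
Proof.
move=> cg.
have [rho [M0 [rho0 M00 gM]]] := @conv_fam _ (option 'I_m) m
  (fun o => if o is Some k then D k g else g) (fun o => if o is Some k then conv_Dx k cg else cg).
have g0M : bounded_at rho M0 g := gM None; have gkM k : bounded_at rho M0 (D k g) := gM (Some k).
pose r := rho / 2; have r0 : 0 < r by rewrite divr_gt0.
pose u (k : 'I_m) : fps K (m + m) := X K (lshift m k).
pose v (k : 'I_m) : fps K (m + m) := X K (rshift m k).
pose Rem := comp (fun k => u k + v k) g - comp u g - \sum_k comp u (D k g) * v k.
pose w (i : 'I_(m + m)) : nat := if fintype.split i is inl _ then 0 else 1.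
have wl k : w (lshift m k) = 0%N by rewrite /w; case: splitP => // j /= E; have := ltn_ord k; rewrite E ltnNge leq_addr.
have wr k : w (rshift m k) = 1%N by rewrite /w; case: splitP => // j /= E; have := ltn_ord j; rewrite -E ltnNge leq_addr.
have W2 : Wt w 2 Rem.
  apply: (@comp_taylor _ _ _ u v w 1%N g) => i; first by rewrite X_m0.
  by rewrite -(wr i); exact: Wt_X.
have u0 k : u k m0 = 0 by rewrite X_m0.
have uv0 k : (u k + v k) m0 = 0 by rewrite fpsDE !X_m0 addr0.
have ub k : bounded_at r rho (u k).
  by move=> N; apply: le_trans (nrm_X _ _ (ltW r0)) _; rewrite /r; lra.
have vb k : bounded_at r rho (v k).
  by move=> N; apply: le_trans (nrm_X _ _ (ltW r0)) _; rewrite /r; lra.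
have uvb k : bounded_at r rho (u k + v k).
  move=> N; apply: le_trans (nrmD _ _ _ (ltW r0)) _.
  have := nrm_X N (lshift m k) (ltW r0); have := nrm_X N (rshift m k) (ltW r0); rewrite /u /v /r; lra.
have cb (u' : 'I_m -> fps K (m + m)) f : (forall k, u' k m0 = 0) -> (forall k, bounded_at r rho (u' k)) -> bounded_at rho M0 f -> bounded_at r M0 (comp u' f).
  move=> u'0 u'b fb N; apply: le_trans (fb N); apply: nrm_comp (ltW r0) (ltW rho0) _ => i.
  by rewrite nc_id //; exact: u'b.
have [r1 [M [r10 RM]]] : conv Rem.
  apply: conv_B; first apply: conv_B.
  - exact: convP r0 (cb _ _ uv0 uvb g0M).
  - exact: convP r0 (cb _ _ u0 ub g0M).
  apply: conv_sum => k _; apply: conv_M; last exact: conv_X.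
  exact: convP r0 (cb _ _ u0 ub (gkM k)).
have M0' : 0 <= M := bnd_ge0 r10 RM.
have [d [d0 d1 d2]] : exists d, [/\ 0 < d, d <= r / 2 & d <= r1].
  have [le|lt] := leP (r / 2) r1; first by exists (r / 2); rewrite lexx divr_gt0.
  by exists r1; rewrite lexx ltW.
exists d, (M / r1 ^+ 2); split=> //; first by rewrite divr_ge0 ?exprn_ge0 // ltW.
move=> z h eta s s' t zd eta0 etad heta gs gs' gt.
pose y (i : 'I_(m + m)) := match fintype.split i with inl k => z k | inr k => h k end.
have yl k : y (lshift m k) = z k by rewrite /y (unsplitK (inl k)).
have yr k : y (rshift m k) = h k by rewrite /y (unsplitK (inr k)).
have ysm : small r y.
  move=> i; rewrite -(splitK i); case: (fintype.split i) => k /=; rewrite ?yl ?yr.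
    by apply: le_trans (zd k) _.
  by apply: le_trans (heta k) _; exact: le_trans etad _.
have zrho : small rho z by move=> k; apply: le_trans (zd k) _; move: d1; rewrite /r; lra.
have zhrho : small rho (fun k => z k + h k).
  move=> k; apply: le_trans (le_normcD _ _) _; have := zd k; have := heta k; move: d1 etad; rewrite /r; lra.
have uy k : sums_to (u k) y (z k) by rewrite -yl; exact: sums_to_X.
have vy k : sums_to (v k) y (h k) by rewrite -yr; exact: sums_to_X.
have value : sums_to Rem y (s' - s - \sum_k t k * h k).
  apply: sums_to_B; first apply: sums_to_B.
  - by apply: sums_to_comp r0 rho0 ysm zhrho uv0 uvb _ g0M gs' => k; exact: sums_to_D.
  - exact: sums_to_comp r0 rho0 ysm zrho u0 ub uy g0M gs.
  apply: sums_to_sum => k _; apply: (sums_to_M r0 (cb _ _ u0 ub (gkM k)) (vb k) ysm _ (vy k)).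
  exact: sums_to_comp r0 rho0 ysm zrho u0 ub uy (gkM k) (gt k).
have q0 : 0 <= eta / r1 by rewrite divr_ge0 // ltW.
have q1 : eta / r1 <= 1 by rewrite ler_pdivrMr // mul1r; exact: le_trans etad d2.
have := sums_to_weight r10 q0 q1 RM W2 _ value => /(_ _)/le_trans; apply.
  move=> i; rewrite -(splitK i); case: (fintype.split i) => k /=; rewrite ?yl ?yr ?wl ?wr.
    by rewrite expr0 mulr1; apply: le_trans (zd k) d2.
  by rewrite expr1 mulrCA divff ?gt_eqF // mulr1.
by rewrite expr_div_n mulrA mulrAC.
Qed.

Lemma CC_ge0 (x : K) : 0 <= x -> exists e : R, 0 <= e /\ x = e%:C%C.
Proof. by case: x => a b; rewrite lecE /= => /andP[/eqP -> ?]; exists a. Qed.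

Lemma mulmxr_continuous m p (J : 'M[K]_(m, p)) : continuous (mulmxr J : 'rV[K]_m -> 'rV[K]_p).
Proof.
apply: (@bounded_linear_continuous _ _ _ (mulmxr J : {linear 'rV[K]_m -> 'rV[K]_p})).
pose C := \sum_i \sum_k `|J i k|.
exists C; split; first by rewrite ger0_real // sumr_ge0 // => i _; apply: sumr_ge0.
move=> M CM; apply/near0P; exists 1; split=> // z z1.
have M0 : 0 <= M by apply: le_trans (ltW CM); apply: sumr_ge0 => i _; apply: sumr_ge0.
apply: norm_le_coord => // k; rewrite mxE; apply: le_trans (ler_norm_sum _ _ _) _.
apply: le_trans (ltW CM); apply: ler_sum => i _; rewrite normrM (bigD1 k) //=.
apply: (@le_trans _ _ `|J i k|); last by rewrite lerDl sumr_ge0.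
rewrite ler_piMl // CC_normE -[1]/(1%:C%C : K) lecR; exact: z1.
Qed.

Lemma sums_to_differentiable m p (u : 'I_p -> fps K m) (phi : 'rV[K]_m -> 'rV[K]_p) (d : R) :
  (forall i, conv (u i)) -> 0 < d ->
  (forall z : 'rV[K]_m, (forall k, normc (z 0 k) <= d) -> forall i, sums_to (u i) (fun k => z 0 k) (phi z 0 i)) ->
  exists d' : R, [/\ 0 < d' & forall z : 'rV[K]_m, (forall k, normc (z 0 k) <= d') ->
    forall J : 'M[K]_(m, p), (forall k i, sums_to (D k (u i)) (fun k => z 0 k) (J k i)) ->
    differentiable phi z /\ forall h, 'd phi z h = h *m J].
Proof.
move=> cu d0 value.
have /choice[dM HdM] : forall i, exists dM : R * R, [/\ 0 < dM.1, 0 <= dM.2 &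
  forall (z h : 'I_m -> K) (eta : R) s s' (t : 'I_m -> K), (forall k, normc (z k) <= dM.1) ->
   0 <= eta -> eta <= dM.1 -> (forall k, normc (h k) <= eta) -> sums_to (u i) z s ->
   sums_to (u i) (fun k => z k + h k) s' -> (forall k, sums_to (D k (u i)) z (t k)) ->
   normc (s' - s - \sum_k t k * h k) <= dM.2 * eta ^+ 2].
  by move=> i; have [d1 [M H]] := taylor_bound (cu i); exists (d1, M).
have [e [e0 ed ei]] : exists e, [/\ 0 < e, e <= d / 2 & forall i, e <= (dM i).1].
  exists (\big[Order.min/d / 2]_i (dM i).1); split.
  - by apply: lt_bigmin => [|i _]; [rewrite divr_gt0 | case: (HdM i)].
  - exact: bigmin_le_id.
  - by move=> i; exact: bigmin_le.
pose M := \sum_i (dM i).2.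
have MP i : (dM i).2 <= M.
  by rewrite /M (bigD1 i) //= lerDl sumr_ge0 // => j _; case: (HdM j).
have M0 : 0 <= M by apply: sumr_ge0 => j _; case: (HdM j).
exists e; split=> // z ze J HJ.
have est (h : 'rV[K]_m) (eta : R) : 0 <= eta -> eta <= e -> `|h| = eta%:C%C ->
   `|phi (h + z) - phi z - h *m J| <= (M * eta ^+ 2)%:C%C.
  move=> eta0 etae hE; apply: norm_le_coord => [|i]; first by rewrite lecR mulr_ge0 ?exprn_ge0.
  have hk k : normc (h 0 k) <= eta by rewrite -lecR -CC_normE -hE coord_le_norm.
  rewrite !mxE CC_normE lecR; have [_ _ HH] := HdM i.
  have := HH (fun k => z 0 k) (fun k => h 0 k) eta (phi z 0 i) (phi (h + z) 0 i) (fun k => J k i).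
  move=> /(_ _ eta0 _ hk _ _ (fun k => HJ k i)) H.
  under eq_bigr => k _ do rewrite mulrC.
  apply: le_trans (H _ _ _ _) _.
  - by move=> k; apply: le_trans (ze k) _.
  - exact: le_trans etae _.
  - by apply: value => k; apply: le_trans (ze k) _; lra.
  - have := value (h + z) _ i; under [X in sums_to _ X]funext => k do rewrite mxE addrC.
    apply=> k; rewrite mxE; apply: le_trans (le_normcD _ _) _; have := hk k; have := ze k; lra.
  by rewrite ler_wpM2r ?exprn_ge0.
pose V : normedModType K := 'rV[K]_m; pose W : normedModType K := 'rV[K]_p.
pose df : {linear V -> W} := mulmxr J; pose f : V -> W := phi.
have o : f \o shift (z : V) = functions.cst (f z) + df +o_ (0 : V) id.
  apply/eqaddoP => _ /CC_pos[eps [eps0 ->]].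
  have [c [c0 c1 c2]] : exists c, [/\ 0 < c, c <= e & M * c <= eps].
    exists (Order.min e (eps / (M + 1))); have Mp : 0 < M + 1 by lra.
    split; rewrite ?ge_min ?lexx // ?lt_min ?e0 ?divr_gt0 //.
    apply: (@le_trans _ _ (M * (eps / (M + 1)))); first by rewrite ler_wpM2l // ge_min lexx orbT.
    by rewrite mulrA ler_pdivrMr // mulrC ler_pM2l //; lra.
  apply/near0P; exists c; split=> // h hc.
  have [eta [eta0 hE]] := CC_ge0 (normr_ge0 h).
  have etac : eta <= c.
    by rewrite -lecR -hE; apply: norm_le_coord => [|k]; rewrite ?CC_normE lecR // ltW.
  have fE : (f \o shift (z : V) - (functions.cst (f z) + df)) h = phi (h + z) - phi z - h *m J.
    by rewrite -addrA -opprD.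
  rewrite fE hE; apply: le_trans (est h eta eta0 (le_trans etac c1) hE) _.
  rewrite -rmorphM lecR expr2 mulrA ler_wpM2r //; apply: le_trans c2; exact: ler_wpM2l.
have dE : 'd f (z : V) = df :> (V -> W) := diff_unique (@mulmxr_continuous _ _ J) o.
split; last by move=> h; rewrite dE.
by apply/diff_locallyP; rewrite dE; split=> //; exact: mulmxr_continuous.
Qed.

End Diff.

(** * The normal form *)

Section Ev.
Variables (R : realType).
Local Notation K := (CC R).

Definition value m (f : fps K m) (z : 'rV[K]_m) : K := xget 0 [set s | sums_to f (fun k => z 0 k) s].

Lemma value_near m (I : finType) (u : I -> fps K m) : (forall i, conv (u i)) ->
  exists d : R, 0 < d /\ forall z : 'rV[K]_m, (forall k, normc (z 0 k) <= d) ->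
    forall i, sums_to (u i) (fun k => z 0 k) (value (u i) z).
Proof.
move=> /conv_fam[r [M [r0 M0 uM]]]; exists (r / 2); split=> [|z zr i]; first by rewrite divr_gt0.
exact: (xgetPex 0 (sums_to_ex r0 (uM i) zr)).
Qed.

Lemma sums_to_comp_near p m (u : 'I_p -> fps K m) (f : fps K p) (e : R) :
  (forall i, u i m0 = 0) -> (forall i, conv (u i)) -> conv f -> 0 < e ->
  exists d : R, 0 < d /\ forall z : 'rV[K]_m, (forall k, normc (z 0 k) <= d) ->
    forall w : 'rV[K]_p, (forall i, sums_to (u i) (fun k => z 0 k) (w 0 i)) ->
    (forall i, normc (w 0 i) <= e) /\
    forall s, sums_to f (fun k => w 0 k) s -> sums_to (comp u f) (fun k => z 0 k) s.
Proof.
move=> u0 /conv_fam[r [M [r0 M0 uM]]] [rho [Mf [rho0 fM]]] e0.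
pose c := Order.min e (rho / 2).
have c0 : 0 < c by rewrite lt_min e0 divr_gt0.
pose r' := r * Order.min 1 (c / (M + 1)).
have Mp : 0 < M + 1 by lra.
have q0 : 0 < Order.min 1 (c / (M + 1)) by rewrite lt_min ltr01 divr_gt0.
have r'0 : 0 < r' by rewrite mulr_gt0.
have r'r : r' <= r by rewrite ler_piMr ?(ltW r0) // ge_min lexx.
have ub i : bounded_at r' c (u i).
  move=> N; have o1 : ord 1 (u i).
    by apply/ordP => a; rewrite ltnS leqn0 mdeg_eq0 => /eqP ->.
  apply: le_trans (nrm_radius N (ltW r'0) r'r r0 o1) _.
  rewrite expr1 /r' [_ / r]mulrAC divff ?gt_eqF // mul1r.
  apply: (@le_trans _ _ (c / (M + 1) * M)).
    by apply: ler_pM; rewrite ?(ltW q0) ?nrm_ge0 ?(ltW r0) ?uM // ge_min lexx orbT.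
  by rewrite mulrAC ler_pdivrMr // ler_pM2l //; lra.
exists (r' / 2); split=> [|z zr w uw]; first by rewrite divr_gt0.
have wc i : normc (w 0 i) <= c.
  rewrite -[c]mulr1; apply: (@sums_to_weight _ _ (fun _ => 0%N) r' c 1 (u i) _ _ 0%N) (uw i) => //.
    exact: Wt_0k.
  move=> k; rewrite expr0 mulr1; apply: le_trans (zr k) _; lra.
have cr : c <= rho / 2 by rewrite ge_min lexx orbT.
split=> [i|s]; first by apply: le_trans (wc i) _; rewrite ge_min lexx.
apply: (sums_to_comp r'0 rho0 zr _ u0 _ uw fM); first by move=> i; apply: le_trans (wc i) _.
by move=> i N; apply: le_trans (ub i N) _; apply: le_trans cr _; lra.
Qed.

Lemma omega_mulmx n p (u v : 'rV[K]_p) (J : 'M[K]_(p, n + n)) :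
  omega (u *m J) (v *m J) = \sum_a \sum_b u 0 a * v 0 b * omega (row a J) (row b J).
Proof.
rewrite /omega; under [RHS]eq_bigr => a _ do under eq_bigr => b _ do rewrite mulr_sumr.
under [RHS]eq_bigr => a _ do rewrite exchange_big.
rewrite [RHS]exchange_big; apply: eq_bigr => j _.
rewrite !mxE !big_distrlr -sumrB; apply: eq_bigr => a _.
rewrite -sumrB; apply: eq_bigr => b _ /=.
by rewrite !mxE; ring.
Qed.

Lemma symplectic_canonical n (phi : 'I_(n + n) -> fps K (n + n)) (f : 'rV[K]_(n + n) -> 'rV[K]_(n + n)) (d : R) :
  (forall i, conv (phi i)) -> symplectic phi -> 0 < d ->
  (forall z : 'rV[K]_(n + n), (forall k, normc (z 0 k) <= d) ->
     forall i, sums_to (phi i) (fun k => z 0 k) (f z 0 i)) -> canonical_at0 f.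
Proof.
move=> cphi sphi d0 fev.
have [d1 [d10 H1]] := sums_to_differentiable cphi d0 fev.
have cD (ki : 'I_(n + n) * 'I_(n + n)) : conv (D ki.1 (phi ki.2)) by exact: conv_Dx.
have [r [M [r0 M0 DM]]] := conv_fam cD.
apply/near0P; exists (Order.min d1 (r / 2)); split=> [|z zd]; first by rewrite lt_min d10 divr_gt0.
have zd1 k : normc (z 0 k) <= d1 by apply: le_trans (zd k) _; rewrite ge_min lexx.
have zr k : normc (z 0 k) <= r / 2 by apply: le_trans (zd k) _; rewrite ge_min lexx orbT.
have [J HJ] : exists J : 'M[K]_(n + n), forall k i, sums_to (D k (phi i)) (fun k => z 0 k) (J k i).
  exists (\matrix_(k, i) value (D k (phi i)) z) => k i; rewrite mxE.
  exact: (xgetPex 0 (sums_to_ex r0 (DM (k, i)) zr)).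
have [dz dE] := H1 z zd1 J HJ; split=> // u v.
rewrite !dE -[in RHS](mulmx1 u) -[in RHS](mulmx1 v) !omega_mulmx.
apply: eq_bigr => a _; apply: eq_bigr => b _; congr (_ * _).
apply: (@sums_to_uniq _ _ (Om (fun i => D a (phi i)) (fun i => D b (phi i))) (fun k => z 0 k)).
  apply: sums_to_sum => j _; rewrite !mxE; apply: sums_to_B.
    exact: sums_to_M r0 (DM (a, xi j)) (DM (b, yi j)) zr (HJ _ _) (HJ _ _).
  exact: sums_to_M r0 (DM (a, yi j)) (DM (b, xi j)) zr (HJ _ _) (HJ _ _).
rewrite sphi; have -> : Om (fun i => D a (X K i)) (fun i => D b (X K i)) = cst _ (omega (row a 1%:M) (row b 1%:M)).
  rewrite /omega rmorph_sum; apply: eq_bigr => j _.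
  by rewrite !D_X !mxE rmorphB !rmorphM !rmorph_nat.
exact: sums_to_cst.
Qed.

Lemma pol_H0 n (lam : 'I_n.+1 -> K) : pol (H0 lam) = H0f lam.
Proof.
rewrite /H0 raddf_sum; apply: eq_bigr => j _ /=.
by rewrite -mul_mpolyC !rmorphM.
Qed.

End Ev.

Theorem theorem2 (R : realType) (n : nat) (lam : 'I_n.+1 -> CC R)
    (H : 'rV[CC R]_(n.+1 + n.+1) -> CC R)
    (Hs : nat -> mpoly (n.+1 + n.+1) (CC R))
    (Hs_homog : forall s, Hs s \is ishomog1 s.+2 mdeg)
    (Hs0 : Hs 0%N = H0 lam)
    (H_analytic : has_pseries H (hseries Hs))
    (lam1_neq0 : lam ord0 != 0)
    (nonres1 : forall (k : int) (nu : 'I_n.+1), nu != ord0 ->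
       lam nu - k%:~R * lam ord0 != 0)
    (nonres2_plus : forall (k : int) (nu nu' : 'I_n.+1),
       nu != ord0 -> nu' != ord0 ->
       lam nu + lam nu' - k%:~R * lam ord0 != 0)
    (nonres2_minus : forall (k : int) (nu nu' : 'I_n.+1),
       nu != ord0 -> nu' != ord0 -> ~ (nu = nu' /\ k = 0) ->
       lam nu - lam nu' - k%:~R * lam ord0 != 0) :
  exists (phi : 'rV[CC R]_(n.+1 + n.+1) -> 'rV[CC R]_(n.+1 + n.+1))
         (Gamma : 'rV[CC R]_n.+1 -> CC R)
         (F : 'rV[CC R]_(n.+1 + n.+1) -> CC R),
    [/\ canonical_at0 phi,
        near_identity phi,
        Gamma_form Gamma,
        cubic_transverse F
      & \forall z \near (0 : 'rV[CC R]_(n.+1 + n.+1)),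
          H (phi z) = meval (z 0) (H0 lam) + Gamma (actions z) + F z].
Proof.
pose c : fps (CC R) (n.+1 + n.+1) := Fps (hseries Hs).
have [cc [d0 [d00 Hc]]] := @pseries_sums_to _ _ H c H_analytic.
have c3 : ord 3 (c - H0f lam).
  apply/ordP => a a3; rewrite fpsBE -pol_H0 polE /= /hseries.
  by have /eqP -> : (mdeg a - 2 == 0)%N; [lia | rewrite Hs0 subrr].
have [phi [cphi phi2 sphi M3 Mc]] :=
  formal_normal_form lam1_neq0 nonres1 nonres2_plus nonres2_minus c3 cc.
set M := comp phi c in M3 Mc.
have cM : conv M by exact: conv_comp.
pose g := Gamma_series M; have cg : conv g := conv_Gamma_series cM.
have ca j : conv (acts R j : fps (CC R) (n.+1 + n.+1)) by apply: conv_M; exact: conv_X.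
pose f := M - H0f lam - comp (@acts R n) g.
have cH0 : conv (H0f lam).
  by apply: conv_sum => j _; apply: conv_M; [exact: conv_cst | exact: ca].
have cf : conv f by apply: conv_B; [exact: conv_B | exact: conv_comp].
have f3 : Wt (@tw n) 3 f := Gamma_series_remainder M3 Mc.
have [d1 [d10 phi_ev]] := value_near cphi.
have [d2 [d20 g_ev]] := value_near (fun _ : 'I_1 => cg).
have [d3 [d30 f_ev]] := value_near (fun _ : 'I_1 => cf).
pose Phi (z : 'rV[CC R]_(n.+1 + n.+1)) := \row_i value (phi i) z.
have Phi_ev (z : 'rV[CC R]_(n.+1 + n.+1)) : (forall k, normc (z 0 k) <= d1) ->
  forall i, sums_to (phi i) (fun k => z 0 k) (Phi z 0 i) by move=> zd i; rewrite mxE; exact: phi_ev.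
have phi0 i : phi i m0 = 0.
  by rewrite -[phi i](subrK (X _ i)) fpsDE X_m0 (ord_coef0 (phi2 i)) addr0.
exists Phi, (value g), (value f); split.
- exact: symplectic_canonical cphi sphi d10 Phi_ev.
- move=> i; exists (phi i - X _ i); split; last first.
    by move=> a; rewrite leqNgt; apply: contraNN => a2; have /ordP/(_ a a2) -> := phi2 i.
  apply: (sums_to_pseries _ d10) => [|z zd]; first by apply: conv_B => //; exact: conv_X.
  by apply: sums_to_B; [exact: Phi_ev | exact: sums_to_X].
- exists g; split; last exact: Gamma_series_form.
  by apply: (sums_to_pseries cg d20) => z zd; exact: (g_ev z zd ord0).
- exists f; split; last first.
    by move=> a; rewrite -wdeg_tw leqNgt; apply: contraNN => a3; have /WtP/(_ a a3) -> := f3.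
  by apply: (sums_to_pseries cf d30) => z zd; exact: (f_ev z zd ord0).
have [d4 [d40 H4]] := sums_to_comp_near phi0 cphi cc d00.
have [d5 [d50 H5]] := sums_to_comp_near (@acts0 R n) ca cg d20.
have near_le d : 0 < d -> nbhs (0 : 'rV[CC R]_(n.+1 + n.+1)) [set z | forall k, normc (z 0 k) <= d].
  by move=> dp; apply/near0P; exists d.
near=> z.
have z1 : forall k, normc (z 0 k) <= d1 by near: z; exact: near_le.
have z3 : forall k, normc (z 0 k) <= d3 by near: z; exact: near_le.
have z4 : forall k, normc (z 0 k) <= d4 by near: z; exact: near_le.
have z5 : forall k, normc (z 0 k) <= d5 by near: z; exact: near_le.
have [Pd /(_ (H (Phi z)) (Hc _ _)) E1] := H4 z z4 (Phi z) (Phi_ev z z1).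
have [Ad E2] : (forall i, normc (actions z 0 i) <= d2) /\
    forall s, sums_to g (fun k => actions z 0 k) s -> sums_to (comp (@acts R n) g) (fun k => z 0 k) s.
  apply: H5 => // j; rewrite mxE.
  pose r := 2 * \sum_k normc (z 0 k) + 1.
  have r0 : 0 < r by rewrite ltr_wpDl // mulr_ge0 // sumr_ge0 // => k _; exact: normc_ge0.
  have Xb i : bounded_at r r (X (CC R) i : fps _ (n.+1 + n.+1)) by move=> N; exact: nrm_X (ltW r0).
  apply: (sums_to_M r0 (Xb _) (Xb _)); try exact: sums_to_X.
  move=> k; rewrite /r (bigD1 k) //=.
  have : 0 <= \sum_(i | i != k) normc (z 0 i) by apply: sumr_ge0 => i _; exact: normc_ge0.
  lra.
have E3 := sums_to_D (sums_to_D (sums_to_pol (H0 lam) (fun k => z 0 k)) (E2 _ (g_ev _ Ad ord0))) (f_ev z z3 ord0).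
apply: sums_to_uniq (E1 Pd) _; congr (sums_to _ _ _): E3.
by rewrite pol_H0 /f; ring.
Unshelve. all: by end_near.
Qed.
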